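(* Let $T=(V,E)$ be a semi-labeled tree with regular nodes $[n]$. Let $Z=(Z_v)_{v\in V}$ be a Gaussian vector whose distribution is a graphical model over $T$, with edge correlations satisfying $0<|\mathrm{corr}(Z_u,Z_v)|<1$ for all $uv\in E$. Let $Y_v=f_v(Z_v)$ for strictly increasing functions $f_v$, $v\in V$, and let $X=(X_1,\dots,X_n)$ be the subvector of $Y$ indexed by the regular nodes (a non-paranormal distribution over $T$). Let $$\kappa_{ij}=\mathrm{corr}\bigl(\mathrm{sgn}(X_i-X_i'),\mathrm{sgn}(X_j-X_j')\bigr),$$ where $X'$ is an independent copy of $X$, be the Kendall-$\tau$ coefficients. Then the algorithm TREE described in the context, applied to the distance oracle $$d(i,j):=-\log\left|\sin\left(\tfrac{\pi}{2}\kappa_{ij}\right)\right|,\qquad i\ne j\in[n],$$ recovers $T$, i.e. returns its edge set (up to the naming of the latent nodes).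
   Context: Trees. A semi-labeled tree is a finite tree $T=(V,E)$ with a set $W\subseteq V$ of regular (labeled) nodes, here $W=[n]=\{1,\dots,n\}$, such that every vertex of degree $\le 2$ lies in $W$; vertices in $V\setminus W$ are called latent. $\Delta=\max_{v\in V}\deg(v)$. A random vector $Z=(Z_v)_{v\in V}$ is a graphical model over $T$ if its density factorizes as $f(z)=\prod_{uv\in E}\psi_{uv}(z_u,z_v)$ with nonnegative $\psi_{uv}$. In the algorithm, $d(u,v)$ is accessed for pairs of regular nodes through the oracle. Bags. A bag is a set $B\subseteq V$ with a distinguished representative $\rho(B)\in B$; all elements of $B$ other than possibly $\rho(B)$ are regular. When $\rho(B)$ is latent, the distances $d(v,\rho(B))$, $v\in B$, have been computed, so it acts as a regular node. The tree induced by $B$ is the smallest subtree of $T$ containing $B$. A skeleton is a set of edges. BASIC$(B,\alpha)$, $\alpha\in B\setminus\{\rho\}$, $\rho=\rho(B)$: query $d(v,\alpha)$ for all $v\in B$; put $D(v)=d(v,\alpha)-d(v,\rho)$; partition $B$ into bags $B_1,\dots,B_k$ according to the distinct values of $D$, ordered by that value. For each $i$ let $u_i\in\arg\min_{v\in B_i}d(v,\alpha)$. If $d(\rho,u_i)+d(u_i,\alpha)=d(\rho,\alpha)$, set $\rho(B_i)=u_i$. Otherwise introduce the latent node $w_i$ connecting the path from $\alpha$ to $\rho$ with $B_i$, add $w_i$ to $B_i$, set $\rho(B_i)=w_i$, and record $d(v,w_i)=\frac12\left(d(v,\alpha)+d(v,\rho)-d(\alpha,\rho)\right)$ for $v\in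 B_i$. Return $B_1,\dots,B_k$ and the skeleton $\{(\rho(B_1),\rho(B_2)),\dots,(\rho(B_{k-1}),\rho(B_k))\}$. EXPLODE$(B)$: while $|B|>1$, take $u\in B$, $u\ne\rho(B)$; set $B^*=\{v\in B\setminus\{\rho(B)\}: d(u,v)<d(u,\rho(B))+d(v,\rho(B))\}\cup\{\rho(B)\}$ with $\rho(B^* )=\rho(B)$; output $B^*$; replace $B$ by $\{\rho(B)\}\cup(B\setminus B^* )$. BIGSPLIT$(B)$, with sample-size parameter $m$: repeat the following pass until $M\le|B|/\sqrt\Delta$. Pass: sample $u_1,\dots,u_m$ uniformly at random without replacement from $B\setminus\{\rho(B)\}$; set $\mathcal B=\{B\}$, $S=\emptyset$; for $i=1,\dots,m$, find the bag $B^*\in\mathcal B$ containing $u_i$ and, if $u_i\ne\rho(B^* )$, apply BASIC$(B^*,u_i)$, replace $B^*$ in $\mathcal B$ by the bags returned, and add the returned skeleton to $S$; then let $\mathcal C$ be the collection of all bags output by EXPLODE applied to the bags of $\mathcal B$, and let $M$ be the maximal size of a bag in $\mathcal C$ ($0$ if there are none). Output $S$ and $\mathcal C$ from the last pass. (Passes use independent randomness.) TREE (with $m=\Delta$): pick $u\in W$, set $\rho(W)=u$; let $Q$ be a queue containing only the bag $W$; $S=\emptyset$. While $Q$ is nonempty: remove the front bag $B$. If $|B|\le m$, query all $\binom{|B|}{2}$ distances in $B$, find the full set of edges of the tree induced by $B$ and add it to $S$. Otherwise apply BIGSPLIT$(B)$, add its skeleton to $S$ and its output bags to the rear of $Q$.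 Return $S$. *)

(* Defs.v *)
From HB Require Import structures.
From mathcomp Require Import all_boot all_order all_algebra.
From mathcomp Require Import all_classical all_reals all_analysis.

Set Implicit Arguments.
Unset Strict Implicit.
Unset Printing Implicit Defensive.

Import Order.TTheory GRing.Theory Num.Theory.
Import numFieldNormedType.Exports.

Local Open Scope classical_set_scope.
Local Open Scope ring_scope.

Definition is_tree (V : finType) (e : rel V) : Prop :=
  [/\ (0 < #|V|)%N, symmetric e, irreflexive e,
      forall u v, connect e u v
    & forall c : seq V, cycle e c -> uniq c -> (size c <= 2)%N].

Definition degree (V : finType) (e : rel V) (v : V) : nat :=
  #|[pred u | e v u]|.

Definition max_degree (V : finType) (e : rel V) : nat :=
  \max_(v : V) degree e v.

Definition semi_labeled (V : finType) (e : rel V) (W : {set V}) : Prop :=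
  is_tree e /\ forall v, (degree e v <= 2)%N -> v \in W.

(* The integral over R^n with respect to Lebesgue measure of a nonnegative
   measurable function, as an iterated integral (Tonelli). *)
Fixpoint lebesgue_tuple_integral (R : realType) (n : nat) :
    (n.-tuple R -> \bar R) -> \bar R :=
  match n with
  | 0 => fun g => g [tuple]
  | n'.+1 => fun g =>
      (\int[@lebesgue_measure R]_x
         lebesgue_tuple_integral (fun t => g (cons_tuple x t)))%E
  end.

Definition random_tuple (R : realType) (T : Type) (n : nat)
    (X : 'I_n -> T -> R) (w : T) : n.-tuple R :=
  [tuple X i w | i < n].

(* A vector indexed by V is read as a tuple through the enumeration of V. *)
Definition random_vector (R : realType) (T : Type) (V : finType)
    (Z : V -> T -> R) : T -> #|V|.-tuple R :=
  random_tuple (fun i => Z (enum_val i)).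

Definition coord (R : realType) (V : finType) (z : #|V|.-tuple R) (v : V) : R :=
  tnth z (enum_rank v).

Definition has_density (d : measure_display) (T : measurableType d)
    (R : realType) (P : probability T R) (V : finType) (Z : V -> {RV P >-> R})
    (f : #|V|.-tuple R -> R) : Prop :=
  [/\ measurable_fun setT f, (forall z, 0 <= f z)
    & forall A : set (#|V|.-tuple R), measurable A ->
        P (random_vector Z @^-1` A) =
        lebesgue_tuple_integral (fun z => (\1_A z * f z)%:E)].

(* Each undirected edge contributes one factor: the ranks pick one of its two
   orientations. *)
Definition edge_product (R : realType) (V : finType) (e : rel V)
    (psi : V -> V -> R -> R -> R) (z : #|V|.-tuple R) : R :=
  \prod_(p : V * V | e p.1 p.2 && (enum_rank p.1 < enum_rank p.2)%N)
     psi p.1 p.2 (coord z p.1) (coord z p.2).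

Definition graphical_model (d : measure_display) (T : measurableType d)
    (R : realType) (P : probability T R) (V : finType) (e : rel V)
    (Z : V -> {RV P >-> R}) : Prop :=
  exists psi : V -> V -> R -> R -> R,
    (forall u v x y, 0 <= psi u v x y) /\ has_density Z (edge_product e psi).

Definition positive_definite (R : realType) (n : nat) (Sigma : 'M[R]_n) : Prop :=
  Sigma^T = Sigma /\ forall x : 'rV[R]_n, x != 0 -> 0 < (x *m Sigma *m x^T) 0 0.

Definition gaussian_pdf (R : realType) (n : nat) (mu : 'rV[R]_n) (Sigma : 'M[R]_n)
    (z : n.-tuple R) : R :=
  let y := \row_i tnth z i - mu in
  (Num.sqrt ((2 * pi) ^+ n * \det Sigma))^-1
    * expR (- (y *m invmx Sigma *m y^T) 0 0 / 2).

(* Graphical models are defined through a Lebesgue density, so the Gaussian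
   vectors of interest are the nondegenerate ones. *)
Definition gaussian_vector (d : measure_display) (T : measurableType d)
    (R : realType) (P : probability T R) (V : finType)
    (Z : V -> {RV P >-> R}) : Prop :=
  exists (mu : 'rV[R]_#|V|) (Sigma : 'M[R]_#|V|),
    positive_definite Sigma /\ has_density Z (gaussian_pdf mu Sigma).

Definition corr (d : measure_display) (T : measurableType d) (R : realType)
    (P : probability T R) (X Y : T -> R) : R :=
  fine (covariance P X Y)
    / (Num.sqrt (fine 'V_P[X]) * Num.sqrt (fine 'V_P[Y])).

Definition independent_copy (d : measure_display) (T : measurableType d)
    (R : realType) (P : probability T R) (n : nat)
    (X X' : 'I_n -> {RV P >-> R}) : Prop :=
  (forall A : set (n.-tuple R), measurable A ->
     P (random_tuple X' @^-1` A) = P (random_tuple X @^-1` A)) /\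
  (forall A A' : set (n.-tuple R), measurable A -> measurable A' ->
     P (random_tuple X @^-1` A `&` random_tuple X' @^-1` A') =
     (P (random_tuple X @^-1` A) * P (random_tuple X' @^-1` A'))%E).

Definition kendall_tau (d : measure_display) (T : measurableType d)
    (R : realType) (P : probability T R) (n : nat)
    (X X' : 'I_n -> {RV P >-> R}) (i j : 'I_n) : R :=
  corr P (fun w => Num.sg (X i w - X' i w)) (fun w => Num.sg (X j w - X' j w)).

(* A computation is the list of its outcomes, weighted by probabilities; the
   missing mass is the probability of not returning.  Loops take a bound on the
   number of iterations (fuel), and running out of it returns nothing: an event
   has probability 1 when its mass tends to 1 as the fuel grows. *)
Definition comp (R : realType) (A : Type) : Type := seq (R * A).

Definition ret (R : realType) (A : Type) (a : A) : comp R A := [:: (1, a)].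

Definition diverge (R : realType) (A : Type) : comp R A := [::].

Definition bind (R : realType) (A B : Type) (c : comp R A) (f : A -> comp R B) :
    comp R B :=
  flatten [seq [seq (x.1 * y.1, y.2) | y <- f x.2] | x <- c].

Definition uniform (R : realType) (A : Type) (s : seq A) : comp R A :=
  [seq ((size s)%:R^-1, x) | x <- s].

Fixpoint sample_without_replacement (R : realType) (A : eqType) (m : nat)
    (s : seq A) : comp R (seq A) :=
  if m is m'.+1 then
    bind (uniform R s) (fun x =>
    bind (sample_without_replacement R m' (rem x s)) (fun t =>
    ret R (x :: t)))
  else ret R [::].

Definition prob_returns (R : realType) (A : Type) (c : comp R A)
    (Q : A -> Prop) : R :=
  \sum_(x <- c | `[< Q x.2 >]) x.1.

(* inl i is the regular node i; inr k is the latent node named k. *)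
Notation node n := ('I_n + nat)%type.
Notation edge n := (node n * node n)%type.

(* bag_elems is duplicate-free.  Only bag_rep can be latent; then bag_rdist i is
   the recorded distance between i and bag_rep (otherwise it is unused). *)
Record bag (R : realType) (n : nat) := Bag {
  bag_elems : seq (node n);
  bag_rep : node n;
  bag_rdist : 'I_n -> R }.

Definition bag_size (R : realType) (n : nat) (B : bag R n) : nat :=
  size (bag_elems B).

Definition bag_nonrep (R : realType) (n : nat) (B : bag R n) : seq (node n) :=
  [seq v <- bag_elems B | v != bag_rep B].

(* Distances between two elements of B: oracle queries, or recorded values. *)
Definition bag_dist (R : realType) (n : nat) (d : 'I_n -> 'I_n -> R)
    (B : bag R n) (x y : node n) : R :=
  match x, y with
  | inl i, inl j => if i == j then 0 else d i j
  | inl i, inr _ => bag_rdist B i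
  | inr _, inl j => bag_rdist B j
  | inr _, inr _ => 0
  end.

(* Resolves the free choices of an element of a nonempty finite set. *)
Definition selector (n : nat) (sel : seq (node n) -> node n) : Prop :=
  forall s, s != [::] -> sel s \in s.

(* The bag made from the class C of B, with w the name of the latent node to
   introduce if there is one. *)
Definition basic_bag (R : realType) (n : nat) (d : 'I_n -> 'I_n -> R)
    (sel : seq (node n) -> node n) (B : bag R n) (alpha : node n)
    (w : node n) (C : seq (node n)) : bag R n :=
  let dB := bag_dist d B in
  let rho := bag_rep B in
  let u := sel [seq v <- C | all (fun v' => dB v alpha <= dB v' alpha) C] in
  if dB rho u + dB u alpha == dB rho alpha then Bag C u (bag_rdist B)
  else Bag (w :: C) w
         (fun i => (dB (inl i) alpha + dB (inl i) rho - dB alpha rho) / 2).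

(* The counter k bounds the latent names in use: names >= k are fresh.  The
   result is the new counter, the bags and the skeleton. *)
Definition basic (R : realType) (n : nat) (d : 'I_n -> 'I_n -> R)
    (sel : seq (node n) -> node n) (k : nat) (B : bag R n) (alpha : node n) :
    nat * seq (bag R n) * seq (edge n) :=
  let D v := bag_dist d B v alpha - bag_dist d B v (bag_rep B) in
  let values := sort <=%R (undup [seq D v | v <- bag_elems B]) in
  let classes := [seq [seq v <- bag_elems B | D v == x] | x <- values] in
  let bags := [seq basic_bag d sel B alpha (inr p.1) p.2
              | p <- zip (iota k (size classes)) classes] in
  let reps := [seq bag_rep B' | B' <- bags] in
  ((k + size classes)%N, bags, zip reps (behead reps)).

Fixpoint explode (R : realType) (n : nat) (d : 'I_n -> 'I_n -> R)
    (sel : seq (node n) -> node n) (fuel : nat) (B : bag R n) :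
    comp R (seq (bag R n)) :=
  if (bag_size B <= 1)%N then ret R [::]
  else if fuel is fuel'.+1 then
    let dB := bag_dist d B in
    let rho := bag_rep B in
    let u := sel (bag_nonrep B) in
    let branch := [seq v <- bag_nonrep B | dB u v < dB u rho + dB v rho] in
    let rest := [seq v <- bag_nonrep B | v \notin branch] in
    bind (explode d sel fuel' (Bag (rho :: rest) rho (bag_rdist B)))
      (fun C => ret R (Bag (rho :: branch) rho (bag_rdist B) :: C))
  else diverge R _.

Definition explode_all (R : realType) (n : nat) (d : 'I_n -> 'I_n -> R)
    (sel : seq (node n) -> node n) (fuel : nat) (Bs : seq (bag R n)) :
    comp R (seq (bag R n)) :=
  foldr (fun B c => bind (explode d sel fuel B) (fun C =>
                    bind c (fun C' => ret R (C ++ C'))))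
        (ret R [::]) Bs.

(* A partially processed pass: fresh counter, current bags, skeleton so far. *)
Definition pass_step (R : realType) (n : nat) (d : 'I_n -> 'I_n -> R)
    (sel : seq (node n) -> node n) (B0 : bag R n)
    (st : nat * seq (bag R n) * seq (edge n)) (u : node n) :
    nat * seq (bag R n) * seq (edge n) :=
  let: (k, Bs, E) := st in
  let i := find (fun B => u \in bag_elems B) Bs in
  let B := nth B0 Bs i in
  if u == bag_rep B then (k, Bs, E)
  else let: (k', bags, E') := basic d sel k B u in
       (k', take i Bs ++ bags ++ drop i.+1 Bs, E ++ E').

Fixpoint bigsplit (R : realType) (n : nat) (d : 'I_n -> 'I_n -> R)
    (sel_arg sel_exp : seq (node n) -> node n) (Delta m : nat) (fuel : nat)
    (k : nat) (B : bag R n) : comp R (nat * seq (bag R n) * seq (edge n)) :=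
  if fuel is fuel'.+1 then
    bind (sample_without_replacement R m (bag_nonrep B)) (fun us =>
    let: (k', Bs, E) := foldl (pass_step d sel_arg B) (k, [:: B], [::]) us in
    bind (explode_all d sel_exp fuel' Bs) (fun C =>
    let M := \max_(B' <- C) bag_size B' in
    if M%:R <= (bag_size B)%:R / Num.sqrt Delta%:R :> R then ret R (k', C, E)
    else bigsplit d sel_arg sel_exp Delta m fuel' k' B))
  else diverge R _.

(* E lists the edges of the tree (V, e), in either orientation, when its
   vertices are named by phi. *)
Definition lists_edges (n : nat) (V : finType) (e : rel V) (phi : V -> node n)
    (E : seq (edge n)) : Prop :=
  forall a b : node n,
    ((a, b) \in E \/ (b, a) \in E) <->
    exists u v, [/\ e u v, phi u = a & phi v = b].

(* E is the edge set of a semi-labeled tree whose regular nodes are the elements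
   of B, whose latent nodes have names in [k, k'[, and which realizes the
   distances between the elements of B for some positive edge lengths. *)
Definition realizes (R : realType) (n : nat) (d : 'I_n -> 'I_n -> R)
    (k : nat) (B : bag R n) (k' : nat) (E : seq (edge n)) : Prop :=
  (k <= k')%N /\
  exists (V : finType) (e : rel V) (W : {set V}) (len : V -> V -> R)
         (phi : V -> node n),
    [/\ semi_labeled e W, injective phi, lists_edges e phi E &
    [/\ (forall a, a \in bag_elems B <-> exists2 w, w \in W & phi w = a),
        (forall v, v \notin W -> exists2 j : nat, (k <= j < k')%N & phi v = inr j),
        (forall u v, len u v = len v u),
        (forall u v, e u v -> 0 < len u v)
      & forall x p, path e x p -> uniq (x :: p) -> x \in W -> last x p \in W ->
          bag_dist d B (phi x) (phi (last x p)) = \sum_(l <- pairmap len x p) l]].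

(* An exhaustive reconstruction routine for small bags; it returns the new
   fresh counter and the edges, and it only sees the distances within the bag. *)
Definition exact_solver (R : realType) (n : nat) (d : 'I_n -> 'I_n -> R)
    (solve : nat -> bag R n -> nat * seq (edge n)) : Prop :=
  forall k B, (exists k' E, realizes d k B k' E) ->
    realizes d k B (solve k B).1 (solve k B).2.

Fixpoint tree_loop (R : realType) (n : nat) (d : 'I_n -> 'I_n -> R)
    (sel_arg sel_exp : seq (node n) -> node n)
    (solve : nat -> bag R n -> nat * seq (edge n)) (Delta m : nat) (fuel : nat)
    (k : nat) (Q : seq (bag R n)) (E : seq (edge n)) : comp R (seq (edge n)) :=
  if Q is B :: Q' then
    if fuel is fuel'.+1 then
      if (bag_size B <= m)%N then
        let: (k', E') := solve k B in
        tree_loop d sel_arg sel_exp solve Delta m fuel' k' Q' (E ++ E')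
      else
        bind (bigsplit d sel_arg sel_exp Delta m fuel' k B) (fun r =>
        let: (k', C, E') := r in
        tree_loop d sel_arg sel_exp solve Delta m fuel' k' (Q' ++ C) (E ++ E'))
    else diverge R _
  else ret R E.

Definition TREE (R : realType) (n : nat) (d : 'I_n -> 'I_n -> R)
    (sel_arg sel_exp : seq (node n) -> node n)
    (solve : nat -> bag R n -> nat * seq (edge n)) (Delta : nat) (u : 'I_n)
    (fuel : nat) : comp R (seq (edge n)) :=
  let W := Bag [seq inl i | i <- enum 'I_n] (inl u) (fun _ => 0) in
  tree_loop d sel_arg sel_exp solve Delta Delta fuel 0 [:: W] [::].

Definition recovers (n : nat) (V : finType) (e : rel V) (lab : 'I_n -> V)
    (E : seq (edge n)) : Prop :=
  exists phi : V -> node n,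
    [/\ injective phi, (forall i, phi (lab i) = inl i) & lists_edges e phi E].

(* Main.v *)
Require Import Defs.
From HB Require Import structures.
From mathcomp Require Import all_boot all_order all_algebra.
From mathcomp Require Import all_classical all_reals all_analysis.
From mathcomp Require Import measurable_realfun ring lra.

(** The proof has a statistical half, which identifies the oracle d with the
    restriction to the labels of a metric D on the vertices of the tree, and an
    algorithmic half, which is about tree metrics only.

    Statistics. Put D u v = - ln |rho u v|, with rho the correlations of Z.
    Let f be the density of Z, u and v two vertices that are not adjacent, and
    write z + u for z with its coordinate u increased by one. Since f is a
    product over edges, f (z + u + v) * f z = f (z + u) * f (z + v); since f
    is Gaussian, the quotient of the two sides is the exponential of minus the
    entry (u, v) of the inverse covariance matrix, which is therefore zero
    (precision_zero). This sparsity implies that the covariances across a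
    separating vertex p satisfy S v x * S p p = S v p * S p x, so correlations
    multiply along paths (gcorr_mul); edges have nonzero correlation
    (uncorrelated_corr0), so D is additive along paths with positive edge
    lengths (gcorr_tree_metric). For the Kendall coefficients, the sign of X_i
    - X_i' is that of the difference of the Gaussian variables, for any
    increasing transformation. The difference of two independent copies of a
    Gaussian pair has a density proportional to exp (- q / 4), with q a
    quadratic form; the mass of the cone where both coordinates have the same
    sign is an arctangent, and sin (pi / 2 * kappa) turns out to be the
    correlation (sin_kendall_tau).

    Correctness.  A bag is the trace on the known vertices of a cell, that is, a
    representative w together with a set of vertices A that contains w and, apart
    from w, is a union of branches at w.  The relation refines states that some
    cells meeting only at their representatives, together with a list of edges,
    account for every edge of a given cell.  It is preserved by BASIC, which cuts a
    cell along the path from its representative to a sampled label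
    (basic_refines), by EXPLODE, which separates the branches at the representative
    (explode_refines), and by the exhaustive search on small bags
    (solve_refines), because the distances between labels determine a
    semi-labeled tree (tree_metric_unique).  When no bag is left, every edge is
    listed, so whatever TREE returns is right (tree_loop_always).

    Termination.  Some set of at most Delta labels of a bag meets every subtree
    that contains too many labels (good_sample).  A pass that samples it succeeds,
    and it is sampled with probability at least (n + 1) ^ (- Delta), so that
    BIGSPLIT returns with probability one.  The vertices that belong to a cell
    without being its representative decrease in number at each round of the main
    loop (open_vertices_decrease), so the number of rounds is bounded and the
    probability that TREE returns tends to one (tree_loop_mass). *)

Set Implicit Arguments.
Unset Strict Implicit.
Unset Printing Implicit Defensive.

Import Order.TTheory GRing.Theory Num.Theory.
Import numFieldNormedType.Exports.

Local Open Scope ring_scope.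

(** * Tree metrics *)

Section TreeMetric.
Variables (R : realFieldType) (V : finType).
Implicit Types (e : rel V) (D : V -> V -> R) (A : {set V}).

(** The vertex m lies on the path from x to y. *)
Definition btw D (x m y : V) : bool := D x m + D m y == D x y.

Definition median_of D (x y z m : V) : bool :=
  [&& btw D x m y, btw D y m z & btw D x m z].

(** Path lengths of a tree with vertex set A: the four-point condition says that
    the metric embeds in a tree, the medians that the branching points are in A,
    and edges are the pairs with nothing in between. This form avoids paths, and
    betweenness becomes linear arithmetic. *)
Record tree_metric_on A e D : Prop := TreeMetricOn {
  tm_refl : forall x, x \in A -> D x x = 0;
  tm_pos : forall x y, x \in A -> y \in A -> x != y -> 0 < D x y;
  tm_sym : forall x y, D x y = D y x;
  tm_four : forall x y z t, x \in A -> y \in A -> z \in A -> t \in A ->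
    D x y + D z t <= D x z + D y t \/ D x y + D z t <= D x t + D y z;
  tm_median : forall x y z, x \in A -> y \in A -> z \in A ->
    exists2 m, m \in A & median_of D x y z m;
  tm_edge : forall x y, x \in A -> y \in A ->
    (e x y <-> x != y /\
       forall z, z \in A -> btw D x z y -> z = x \/ z = y) }.

Definition tree_metric e D := tree_metric_on [set: V]%SET e D.

Section Grow.
Variables (e : rel V) (len : V -> V -> R).
Hypothesis len_pos : forall x y, e x y -> 0 < len x y.
Hypothesis len_sym : forall x y, len x y = len y x.
Hypothesis e_sym : symmetric e.
Hypothesis e_irr : irreflexive e.
Hypothesis e_acyclic : forall c : seq V, cycle e c -> uniq c -> (size c <= 2)%N.

Definition connected_in A := forall x y, x \in A -> y \in A ->
  exists p, [/\ path e x p, last x p = y & all (mem A) p].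

(** A second neighbour in A would close a simple cycle through v. *)
Lemma one_neighbor A p q v : connected_in A -> p \in A -> q \in A -> v \notin A ->
  e v p -> e v q -> p = q.
Proof.
move=> cA pA qA vA evp evq; apply/eqP; apply: contraT => pq.
have [s [es ls sA]] := cA p q pA qA.
case: (shortenP es) ls => s' es' us' ss' ls'.
have /e_acyclic /(_ _) : cycle e (v :: p :: s').
  by rewrite /= evp rcons_path es' ls' e_sym.
have -> : uniq (v :: p :: s').
  rewrite cons_uniq us' andbT inE negb_or; apply/andP; split.
    by apply: contraNneq vA => ->.
  by apply: contra vA => /ss' /(allP sA).
by case: s' ls' {es' us' ss'} => [/= E|//]; [rewrite E eqxx in pq | move=> ? ? _ /(_ isT)].
Qed.

Definition extended_dist D (v p : V) (x y : V) : R :=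
  if x == v then (if y == v then 0 else len v p + D p y)
  else if y == v then len v p + D p x else D x y.

(** A vertex v outside A hangs on A by the single edge v p, so each distance
    from v is the length of that edge plus a distance from p; each axiom for the
    extended set is an axiom for A with v replaced by p. *)
Lemma tree_metric_grow A D v p : connected_in A -> p \in A -> v \notin A -> e v p ->
  tree_metric_on A e D ->
  (forall x y, x \in A -> y \in A -> e x y -> D x y = len x y) ->
  let D' := extended_dist D v p in
  tree_metric_on (v |: A)%SET e D' /\
  (forall x y, x \in (v |: A)%SET -> y \in (v |: A)%SET -> e x y -> D' x y = len x y).
Proof.
move=> cA pA vA evp [D0 Dp Ds D4 Dm De] Dl D'.
have l0 := len_pos evp.
have neqv x : x \in A -> (x == v) = false.
  by move=> xA; apply/negbTE; apply: contraNneq vA => <-.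
have in2 x : x \in (v |: A)%SET -> x = v \/ x \in A.
  by rewrite !inE => /orP[/eqP ->|]; [left|right].
have D'vv : D' v v = 0 by rewrite /D' /extended_dist eqxx.
have D'vx x : x \in A -> D' v x = len v p + D p x.
  by move=> xA; rewrite /D' /extended_dist eqxx neqv.
have D'xv x : x \in A -> D' x v = len v p + D p x.
  by move=> xA; rewrite /D' /extended_dist eqxx neqv.
have D'xy x y : x \in A -> y \in A -> D' x y = D x y.
  by move=> xA yA; rewrite /D' /extended_dist !neqv.
have Dge x y : x \in A -> y \in A -> 0 <= D x y.
  move=> xA yA; have [->|xy] := eqVneq x y; first by rewrite D0.
  exact/ltW/Dp.
have D's x y : D' x y = D' y x.
  by rewrite /D' /extended_dist; do 2!case: ifP => //; rewrite Ds.
have tri x y z : x \in A -> y \in A -> z \in A -> D x y <= D x z + D z y.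
  move=> xA yA zA; have := D4 x y z z xA yA zA zA.
  by rewrite D0 // (Ds y z); lra.
split.
  split=> //.
  - by move=> x /in2[->|xA]; rewrite ?D'vv ?D'xy ?D0.
  - move=> x y /in2[->|xA] /in2[->|yA]; rewrite ?eqxx // => xy.
    + by rewrite D'vx // ltr_wpDr // Dge.
    + by rewrite D'xv // ltr_wpDr // Dge.
    + by rewrite D'xy // Dp.
  - move=> x y z t Hx Hy Hz Ht.
    have := tri; have := D4; have := Ds.
    case/in2: Hx => [->|xA]; case/in2: Hy => [->|yA]; case/in2: Hz => [->|zA];
      case/in2: Ht => [->|tA];
      rewrite ?D'vv ?(D'vx _ xA) ?(D'vx _ yA) ?(D'vx _ zA) ?(D'vx _ tA)
        ?(D'xv _ xA) ?(D'xv _ yA) ?(D'xv _ zA) ?(D'xv _ tA)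
        ?(D'xy _ _ xA yA) ?(D'xy _ _ xA zA) ?(D'xy _ _ xA tA)
        ?(D'xy _ _ yA zA) ?(D'xy _ _ yA tA) ?(D'xy _ _ zA tA) => s f4 t3.
    + lra.
    + lra.
    + lra.
    + by have := t3 _ _ _ zA tA pA; rewrite (s z p); lra.
    + lra.
    + lra.
    + lra.
    + by have := f4 _ _ _ _ pA yA zA tA; lra.
    + lra.
    + lra.
    + lra.
    + by have := f4 _ _ _ _ xA pA zA tA; rewrite (s x p); lra.
    + by have := t3 _ _ _ xA yA pA; rewrite (s x p); lra.
    + by have := f4 _ _ _ _ xA yA pA tA; rewrite (s x p) (s y p); lra.
    + by have := f4 _ _ _ _ xA yA zA pA; rewrite (s x p) (s y p) (s z p); lra.
    + exact: f4.
  - have medv y z : y \in A -> z \in A ->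
        exists2 m, m \in A & [&& btw D' v m y, btw D' y m z & btw D' v m z].
      move=> yA zA; have [m mA /and3P[/eqP a /eqP b /eqP c]] := Dm p y z pA yA zA.
      exists m => //; apply/and3P; split; apply/eqP;
        rewrite ?D'vx ?D'xy //; lra.
    have bv x : x \in (v |: A)%SET -> btw D' x x v /\ btw D' x v v.
      by move=> /in2[->|xA]; rewrite /btw ?D'vv ?D'xv ?D'xy ?D0 ?add0r ?addr0 ?eqxx.
    have bs x m y : btw D' x m y = btw D' y m x.
      by rewrite /btw (D's x m) (D's m y) (D's x y) addrC.
    have vI : v \in (v |: A)%SET by rewrite !inE eqxx.
    have AI x : x \in A -> x \in (v |: A)%SET by rewrite !inE orbC => ->.
    have bvv m : btw D' v m v -> m \in (v |: A)%SET -> m = v.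
      move=> + /in2[//|mA]; rewrite /btw D'vv D'vx // D'xv // => /eqP h.
      by exfalso; have := Dge p m pA mA; lra.
    move=> x y z Hx Hy Hz; rewrite /median_of.
    case/in2: (Hx) => [->|xA]; case/in2: (Hy) => [->|yA]; case/in2: (Hz) => [->|zA].
    + by have [h1 h2] := bv _ vI; exists v; rewrite // h1.
    + by have [h1 h2] := bv _ vI; have [h3 h4] := bv _ Hz; exists v; rewrite // h1 (bs v) h4.
    + by have [h1 h2] := bv _ vI; have [h3 h4] := bv _ Hy; exists v; rewrite // h1 h4 (bs v) h4.
    + by have [m mA mm] := medv y z yA zA; exists m => //; exact: AI.
    + by have [h1 h2] := bv _ vI; have [h3 h4] := bv _ Hx; exists v; rewrite // h1 h4.
    + have [m mA /and3P[a b c]] := medv x z xA zA; exists m; first exact: AI.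
      by rewrite bs a c b.
    + have [m mA /and3P[a b c]] := medv x y xA yA; exists m; first exact: AI.
      by rewrite b bs c bs a.
    + have [m mA] := Dm x y z xA yA zA; exists m; first exact: AI.
      by rewrite /btw !D'xy.
  - have edgev x : x \in A -> (e v x <-> v != x /\
        forall z, z \in (v |: A)%SET -> btw D' v z x -> z = v \/ z = x).
      move=> xA; split.
        move=> evx; have xp : x = p by apply: (one_neighbor cA xA pA vA).
        subst x; split; first by rewrite eq_sym neqv.
        move=> z /in2[->|zA]; first by left.
        rewrite /btw !D'vx // D'xy // D0 // addr0 => /eqP h.
        right; apply/eqP; apply: contraT => zp.
        have := Dp _ _ zA pA zp; have := Dge p z pA zA; lra.
      move=> [_ h]; have [||E|<-//] := h p.
      - by rewrite !inE pA orbT.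
      - by rewrite /btw !D'vx ?D'xy // D0 // addr0.
      - by rewrite -E pA in vA.
    move=> x y /in2[->|xA] /in2[->|yA].
    + by rewrite eqxx e_irr; split => // -[].
    + exact: edgev.
    + rewrite e_sym edgev // eq_sym; split=> -[h1 h2]; split=> // z zA.
        rewrite /btw addrC D's (D's x z) (D's x v) => /h2 h.
        by case: h => //; [right|left].
      rewrite /btw addrC D's (D's v z) (D's v x) => /h2 h.
      by case: h => //; [right|left].
    + rewrite De //; split=> -[h1 h2]; split=> // z.
        move=> /in2[->|zA]; last by rewrite /btw !D'xy //; exact: h2.
        rewrite /btw D'xv // D'vx // D'xy // => /eqP h.
        by exfalso; have := tri x y p xA yA pA; rewrite (Ds x p); lra.
      move=> zA bz; apply: h2; first by rewrite !inE zA orbT.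
      by rewrite /btw !D'xy.
move=> x y /in2[->|xA] /in2[->|yA]; rewrite ?e_irr // => exy.
- have yp : y = p by apply: (one_neighbor cA yA pA vA).
  by rewrite D'vx // yp D0 // addr0.
- rewrite e_sym in exy; have yp : x = p by apply: (one_neighbor cA xA pA vA).
  by rewrite D'xv // yp D0 // addr0 len_sym.
- by rewrite D'xy // Dl.
Qed.

Hypothesis e_conn : forall x y, connect e x y.
Hypothesis V_inh : (0 < #|V|)%N.

Lemma connected_grow A p v : connected_in A -> p \in A -> e p v -> connected_in (v |: A)%SET.
Proof.
move=> cA pA epv.
have sub s : all (mem A) s -> all (mem (v |: A)%SET) s.
  by apply: sub_all => z; rewrite !inE orbC => ->.
move=> x y; rewrite !inE => /orP[/eqP->|xA] /orP[/eqP->|yA].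
- by exists [::].
- have [s [es ls sA]] := cA p y pA yA; exists (p :: s); split=> //=.
    by rewrite e_sym epv.
  by rewrite !inE pA orbT sub.
- have [s [es ls sA]] := cA x p xA pA; exists (rcons s v); split.
  + by rewrite rcons_path es ls.
  + by rewrite last_rcons.
  + by rewrite all_rcons /= !inE eqxx sub.
- by have [s [es ls sA]] := cA x y xA yA; exists s; split=> //; exact: sub.
Qed.

(** Positive edge lengths extend to a metric by growing a connected vertex set
    one adjacent vertex at a time until it is the whole tree. *)
Lemma tree_metric_exists :
  exists D, tree_metric e D /\ forall x y, e x y -> D x y = len x y.
Proof.
have [r _] := card_gt0P V_inh.
suff H k : (k < #|V|)%N -> exists A D, [/\ #|A| = k.+1, connected_in A,
    tree_metric_on A e D & forall x y, x \in A -> y \in A -> e x y -> D x y = len x y].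
  have [|A [D [cA _ tD lD]]] := H #|V|.-1; first by rewrite prednK.
  have AT : A = [set: V]%SET.
    by apply/eqP; rewrite eqEcard finset.subsetT cardsT cA prednK /= ?leqnn.
  by exists D; rewrite /tree_metric -AT; split=> // x y; apply: lD; rewrite AT inE.
elim: k => [_|k IH kV].
  exists [set r]%SET, (fun _ _ => 0); split.
  - by rewrite cards1.
  - by move=> x y; rewrite !inE => /eqP-> /eqP->; exists [::].
  - split=> //.
    + by move=> x y; rewrite !inE => /eqP-> /eqP->; rewrite eqxx.
    + by move=> *; left.
    + by move=> x y z *; exists r; rewrite ?inE // /median_of /btw addr0 eqxx.
    + move=> x y; rewrite !inE => /eqP-> /eqP->.
      by rewrite e_irr eqxx; split => // -[].
  - by move=> x y; rewrite !inE => /eqP-> /eqP->; rewrite e_irr.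
have [A [D [cA conA tA lA]]] := IH (ltnW kV).
have [p [v [pA vA epv]]] : exists p v, [/\ p \in A, v \notin A & e p v].
  have [/existsP[p /existsP[v /and3P[? ? ?]]]|/existsPn no] :=
    boolP [exists p, [exists v, [&& p \in A, v \notin A & e p v]]].
    by exists p, v.
  have cl : fingraph.closed e (mem A).
    apply: (intro_closed (sym_connect_sym e_sym)) => x y exy xA.
    apply: contraT => yA; have /existsPn/(_ y) := no x.
    by rewrite -!topredE /= in xA yA *; rewrite xA yA exy.
  have [a aA] : exists a, a \in A by apply/card_gt0P; rewrite cA.
  have : [set: V]%SET \subset A.
    apply/fintype.subsetP => y _; have := closed_connect cl (e_conn a y).
    by rewrite aA.
  by move=> /subset_leq_card; rewrite cardsT cA leqNgt kV.
rewrite e_sym in epv.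
have [tA' lA'] := tree_metric_grow conA pA vA epv tA lA.
exists (v |: A)%SET, (extended_dist D v p); split=> //.
- by rewrite cardsU1 vA cA.
- by apply: connected_grow pA _ => //; rewrite e_sym.
Qed.

End Grow.
End TreeMetric.

(** * Geometry of a tree metric *)

Section TreeGeometry.
Variables (R : realFieldType) (V : finType) (e : rel V) (D : V -> V -> R).
Hypothesis tm : tree_metric e D.

Let inT (x : V) : x \in [set: V]%SET. Proof. by rewrite inE. Qed.

Lemma dist_refl x : D x x = 0. Proof. exact: (tm_refl tm). Qed.
Lemma dist_sym x y : D x y = D y x. Proof. exact: (tm_sym tm). Qed.
Lemma dist_gt0 x y : x != y -> 0 < D x y. Proof. exact: (tm_pos tm). Qed.
Lemma dist_ge0 x y : 0 <= D x y.
Proof. by have [->|/dist_gt0/ltW//] := eqVneq x y; rewrite dist_refl. Qed.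
Lemma dist_eq0 x y : D x y = 0 -> x = y.
Proof. by move=> h; have [//|/dist_gt0] := eqVneq x y; rewrite h ltxx. Qed.
Lemma four_point x y z t :
  D x y + D z t <= D x z + D y t \/ D x y + D z t <= D x t + D y z.
Proof. exact: (tm_four tm). Qed.
Lemma dist_triangle z x y : D x y <= D x z + D z y.
Proof. by have := four_point x y z z; rewrite dist_refl (dist_sym y z); lra. Qed.
Lemma median_exists x y z : exists m, median_of D x y z m.
Proof. by have [m _ mm] := tm_median tm (inT x) (inT y) (inT z); exists m. Qed.
Lemma edgeP x y : e x y <-> x != y /\ forall z, btw D x z y -> z = x \/ z = y.
Proof.
by split=> [/(tm_edge tm (inT x) (inT y))[xy h]|[xy h]]; [split=> // z; exact: h|
  apply/(tm_edge tm (inT x) (inT y)); split=> // z _; exact: h].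
Qed.

Lemma btw_sym x m y : btw D x m y = btw D y m x.
Proof. by rewrite /btw (dist_sym x m) (dist_sym m y) (dist_sym x y) addrC. Qed.
Lemma btw_l x y : btw D x x y. Proof. by rewrite /btw dist_refl add0r. Qed.
Lemma btw_r x y : btw D x y y. Proof. by rewrite /btw dist_refl addr0. Qed.
Lemma btw_id x m : btw D x m x -> m = x.
Proof.
rewrite /btw dist_refl => /eqP h; apply/dist_eq0.
by have := dist_ge0 m x; have := dist_ge0 x m; lra.
Qed.

Lemma btw_edge x y z : e x y -> btw D x z y -> z = x \/ z = y.
Proof. by move=> /edgeP[_]; apply. Qed.

Lemma edge_neq x y : e x y -> x != y. Proof. by move=> /edgeP[]. Qed.

Lemma edge_sym x y : e x y = e y x.
Proof.
by apply/idP/idP => /edgeP[xy h]; apply/edgeP; split; rewrite 1?eq_sym // => z;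
  rewrite btw_sym => /h[]; [right|left|right|left].
Qed.

(** The vertices occur in the order a, p, q, b. *)
Lemma btw_trans_l a q b p : btw D a q b -> btw D a p q -> btw D a p b.
Proof.
rewrite /btw => /eqP h1 /eqP h2; apply/eqP.
have := dist_triangle p a b; have := dist_triangle q p b; lra.
Qed.

Lemma btw_trans_r a q b p : btw D a q b -> btw D a p q -> btw D p q b.
Proof.
rewrite /btw => /eqP h1 /eqP h2; apply/eqP.
have := dist_triangle p a b; have := dist_triangle q p b; lra.
Qed.

Lemma btw_order a b p q : btw D a p b -> btw D a q b -> D a p <= D a q ->
  btw D a p q /\ btw D p q b.
Proof.
rewrite /btw => /eqP h1 /eqP h2 h.
have := four_point a b p q; have := dist_triangle p a q.
have := dist_triangle q p b; rewrite (dist_sym b q) (dist_sym b p) => h3 h4 h5.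
by split; apply/eqP; lra.
Qed.

Lemma btw_antisym a p q : btw D a p q -> btw D a q p -> p = q.
Proof.
rewrite /btw => /eqP h1 /eqP h2; apply: dist_eq0.
by have := dist_ge0 p q; have := dist_sym p q; lra.
Qed.

(** If w separates u from t, then a third vertex v cannot be in the branch at w
    of both. By the four-point condition. *)
Lemma branch_trans w u t v : btw D u w t -> btw D u w v \/ btw D v w t.
Proof.
rewrite /btw => /eqP h; have := four_point u t w v.
have := dist_triangle w u v; have := dist_triangle w v t; have := dist_sym t v;
have := dist_sym t w; have := dist_sym v w => s1 s2 s3 t1 t2 [f|f].
  by right; apply/eqP; lra.
by left; apply/eqP; lra.
Qed.

Definition med x y z : V := odflt x [pick m | median_of D x y z m].

Lemma medP x y z : median_of D x y z (med x y z).
Proof.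
rewrite /med; case: pickP => // no.
by have [m] := median_exists x y z; rewrite no.
Qed.

(** Take the vertex between x and y, other than x, that is nearest to x. *)
Lemma neighbour_toward x y : x != y -> exists2 z, e x z & btw D x z y.
Proof.
move=> xy.
case: (@arg_minP _ _ _ y (fun z => (z != x) && btw D x z y) (fun z => D x z)) => [|z].
  by rewrite eq_sym xy btw_r.
move=> /andP[zx bz] zmin; exists z => //; apply/edgeP; rewrite eq_sym; split=> // t bt.
have [tx|tx] := eqVneq t x; [by left | right].
have := zmin t; rewrite tx (btw_trans_l bz bt) => /(_ isT) le.
move: bt; rewrite /btw => /eqP h; apply: dist_eq0.
by have := dist_ge0 t z; lra.
Qed.

Lemma neighbour_side x y z : e x y -> btw D z x y \/ btw D z y x.
Proof.
move=> exy; have [m /and3P[h1 h2 h3]] := median_exists x y z.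
case: (btw_edge exy h1) => E; subst m; [left|right].
  by rewrite btw_sym.
by rewrite btw_sym.
Qed.

Lemma neighbour_uniq x y t t' : e x t -> e x t' -> btw D x t y -> btw D x t' y -> t = t'.
Proof.
move=> et et' b b'.
wlog le : t t' et et' b b' / D x t <= D x t'.
  move=> H; have [le|/ltW le] := leP (D x t) (D x t'); first exact: H.
  by apply/esym/H.
have [h _] := btw_order b b' le.
case: (btw_edge et' h) => // E; move: (edge_neq et); by rewrite E eqxx.
Qed.

(** Otherwise one of them would lie inside the edge from x to the other. *)
Lemma neighbours_btw x t t' : e x t -> e x t' -> t != t' -> btw D t x t'.
Proof.
move=> et et' tt'; case: (neighbour_side t' et) => //; first by rewrite btw_sym.
rewrite btw_sym => h.
by case: (btw_edge et' h) => E; [move: (edge_neq et)|move: tt']; rewrite E eqxx.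
Qed.

Variable W : {set V}.
Hypothesis latent_deg : forall v, (#|[pred u | e v u]| <= 2)%N -> v \in W.

Lemma third_neighbour v (s : seq V) : v \notin W -> (size s <= 2)%N ->
  exists2 t, e v t & t \notin s.
Proof.
move=> vW ss.
have [/existsP[t /andP[et ts]]|/existsPn no] := boolP [exists t, e v t && (t \notin s)].
  by exists t.
case/negP: vW; apply: latent_deg; apply: leq_trans ss; apply: leq_trans (card_size s).
apply/subset_leq_card/fintype.subsetP => t /= et; have := no t.
by rewrite !inE in et *; rewrite et /= negbK.
Qed.

(** Extend the path from u to v as far as possible: its end has at most one
    neighbour, so it is a label. *)
Lemma label_beyond u v : exists2 z, z \in W & btw D u v z.
Proof.
case: (@arg_maxP _ _ _ v (fun z => btw D u v z) (fun z => D u z)) => [|z bz zmax].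
  exact: btw_r.
have [zW|zW] := boolP (z \in W); first by exists z.
have [t0 h0] : exists t0, forall t, e z t -> t != t0 -> btw D u z t.
  have [E|uz] := eqVneq z u.
    by exists z => t _ _; rewrite E btw_l.
  have [t0 et0 b0] := neighbour_toward uz; exists t0 => t et tt0.
  have [//|b] := neighbour_side u et.
  by rewrite btw_sym in b; rewrite (neighbour_uniq et et0 b b0) eqxx in tt0.
have [t et] := third_neighbour zW (isT : size [:: t0] <= 2)%N.
rewrite inE => /(h0 _ et) b.
have : D u t <= D u z := zmax t (btw_trans_l b bz).
move: b; rewrite /btw => /eqP b.
by have := dist_gt0 (edge_neq et); lra.
Qed.

(** A latent vertex has three neighbours at least; follow each of them to a
    label. *)
Lemma latent_branches v : v \notin W ->
  exists a b c, [/\ a \in W, b \in W, c \in W &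
     [/\ btw D a v b, btw D b v c & btw D a v c]].
Proof.
move=> vW.
have [t1 e1 _] := third_neighbour vW (isT : size [::] <= 2)%N.
have [t2 e2 n2] := third_neighbour vW (isT : size [:: t1] <= 2)%N.
have [t3 e3 n3] := third_neighbour vW (isT : size [:: t1; t2] <= 2)%N.
have [a aW ba] := label_beyond v t1.
have [b bW bb] := label_beyond v t2.
have [c cW bc] := label_beyond v t3.
have key t t' a' b' : e v t -> e v t' -> t != t' -> btw D v t a' -> btw D v t' b' ->
    btw D a' v b'.
  move=> et et' tt' h h'; have bt := neighbours_btw et et' tt'.
  have nb s s' : e v s -> btw D v s s' -> ~~ btw D s v s'.
    move=> es /eqP h1; apply/negP => /eqP h2.
    have := dist_gt0 (edge_neq es); have := dist_sym v s; lra.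
  case: (branch_trans a' bt) => [h2|h2]; first by rewrite (negbTE (nb _ _ et h)) in h2.
  case: (branch_trans b' h2) => [//|]; rewrite btw_sym => h3.
  by rewrite (negbTE (nb _ _ et' h')) in h3.
rewrite !inE in n2 n3; move: n3; rewrite negb_or => /andP[n31 n32].
by exists a, b, c; split=> //; split; [apply: (key t1 t2)|apply: (key t2 t3)|
  apply: (key t1 t3)]; rewrite // eq_sym.
Qed.

(** A latent y has three branches that contain labels, and a and w occupy at
    most two of them. So no class formed by BASIC is empty, and each position on
    the path is seen from some label. *)
Lemma label_projecting y a w : btw D w y a ->
  y \in W \/ exists2 z, z \in W & btw D z y w /\ btw D z y a.
Proof.
move=> bwa; have [yW|yW] := boolP (y \in W); [by left|right].
have [z1 [z2 [z3 [W1 W2 W3 [b12 b23 b13]]]]] := latent_branches yW.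
case: (branch_trans w b12); case: (branch_trans a b12);
case: (branch_trans w b23); case: (branch_trans a b23);
case: (branch_trans w b13); case: (branch_trans a b13);
rewrite ?(btw_sym w) ?(btw_sym a) => h1 h2 h3 h4 h5 h6;
by [exists z1 | exists z2 | exists z3].
Qed.

End TreeGeometry.

(** * Uniqueness of the tree carrying a metric *)

Section Uniqueness.
Variables (R : realFieldType) (V V' : finType) (e : rel V) (e' : rel V').
Variables (D : V -> V -> R) (D' : V' -> V' -> R).
Hypothesis tm : tree_metric e D.
Hypothesis tm' : tree_metric e' D'.
Variables (A : {set V}) (L : {set V}) (L' : {set V'}) (f : V -> V').
Hypothesis A_btw : forall x y z, x \in A -> y \in A -> btw D x z y -> z \in A.
Hypothesis LA : L \subset A.
Hypothesis A_ext : forall u v, u \in A -> v \in A -> exists2 z, z \in L & btw D u v z.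
Hypothesis A_med : forall v, v \in A -> exists a b c,
  [/\ a \in L, b \in L, c \in L & [/\ btw D a v b, btw D b v c & btw D a v c]].
Hypothesis V'_ext : forall u v, exists2 z, z \in L' & btw D' u v z.
Hypothesis V'_med : forall v, exists a b c,
  [/\ a \in L', b \in L', c \in L' & [/\ btw D' a v b, btw D' b v c & btw D' a v c]].
Hypothesis f_iso : forall x y, x \in L -> y \in L -> D' (f x) (f y) = D x y.
Hypothesis f_onto : forall y, y \in L' -> exists2 x, x \in L & f x = y.

(** The last two components say that D v z is the largest of the numbers D z a -
    D v a, which only depend on distances to a, b and c: hence a vertex is
    located by its distances to three labels that it separates. *)
Lemma median_dist (U : finType) (eU : rel U) (DU : U -> U -> R) (tU : tree_metric eU DU)
   a b c v z : btw DU a v b -> btw DU b v c -> btw DU a v c ->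
  [/\ DU v a = (DU a b + DU a c - DU b c) / 2,
      DU v b = (DU a b + DU b c - DU a c) / 2,
      DU v c = (DU a c + DU b c - DU a b) / 2,
   [\/ DU v z = DU z a - DU v a, DU v z = DU z b - DU v b | DU v z = DU z c - DU v c] &
   [/\ DU z a - DU v a <= DU v z, DU z b - DU v b <= DU v z & DU z c - DU v c <= DU v z]].
Proof.
move=> h1 h2 h3.
have bz : btw DU z v a \/ btw DU z v b.
  by case: (branch_trans tU z h1); rewrite 1?(btw_sym tU a v z); [left|right].
move: h1 h2 h3 bz; rewrite /btw => /eqP h1 /eqP h2 /eqP h3 bz.
have s1 := dist_sym tU a v; have s2 := dist_sym tU b v; have s3 := dist_sym tU c v.
have s4 := dist_sym tU z v.
have t1 := dist_triangle tU v z a; have t2 := dist_triangle tU v z b.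
have t3 := dist_triangle tU v z c.
split; try lra; last by split; lra.
by case: bz => /eqP h; [apply: Or31|apply: Or32]; lra.
Qed.

(** A vertex is determined by its distances to the labels (being a median of
    three of them), and every pair of vertices lies on a path that reaches a
    label; so an isometry of the labels extends to the vertices. Adjacency is
    then recovered from the metric. Only the part A of the first tree is matched
    with the second one, because a bag only spans a part of the tree. *)
Lemma tree_metric_unique : exists g : V -> V',
  [/\ {in L, g =1 f}, {in A &, forall x y, D' (g x) (g y) = D x y},
      (forall y, exists2 x, x \in A & g x = y) &
      {in A &, forall x y, e x y = e' (g x) (g y)}].
Proof.
have LAi x : x \in L -> x \in A by move/(fintype.subsetP LA).
(* Corresponding vertices have the same distances to the labels. *)
pose ok v v' := [forall z in L, D' v' (f z) == D v z].
have okE v v' z : ok v v' -> z \in L -> D' v' (f z) = D v z.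
  by move=> /forall_inP/(_ z) h zL; apply/eqP/h.
have same a b c a' b' c' v v' z z' :
    btw D a v b -> btw D b v c -> btw D a v c ->
    btw D' a' v' b' -> btw D' b' v' c' -> btw D' a' v' c' ->
    D' a' b' = D a b -> D' b' c' = D b c -> D' a' c' = D a c ->
    D' z' a' = D z a -> D' z' b' = D z b -> D' z' c' = D z c -> D' v' z' = D v z.
  move=> h1 h2 h3 k1 k2 k3 e1 e2 e3 e4 e5 e6.
  have [p1 p2 p3 p4 [p5 p6 p7]] := median_dist tm z h1 h2 h3.
  have [q1 q2 q3 q4 [q5 q6 q7]] := median_dist tm' z' k1 k2 k3.
  by case: p4; case: q4; lra.
have exg v : v \in A -> exists v', ok v v'.
  move=> /A_med[a [b [c [aL bL cL [h1 h2 h3]]]]].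
  have [v' /and3P[k1 k2 k3]] := median_exists tm' (f a) (f b) (f c).
  exists v'; apply/forall_inP => z zL; apply/eqP.
  by apply: (same a b c (f a) (f b) (f c)) => //; exact: f_iso.
have exA v' : exists2 v, v \in A & ok v v'.
  have [a' [b' [c' [aL' bL' cL' [k1 k2 k3]]]]] := V'_med v'.
  have [a aL ?] := f_onto aL'; have [b bL ?] := f_onto bL'; have [c cL ?] := f_onto cL'.
  subst a' b' c'.
  have [v /and3P[h1 h2 h3]] := median_exists tm a b c.
  exists v; first by apply: (A_btw (LAi _ aL) (LAi _ bL) h1).
  apply/forall_inP => z zL; apply/eqP.
  by apply: (same a b c (f a) (f b) (f c)) => //; exact: f_iso.
have iso u v u' v' : u \in A -> v \in A -> ok u u' -> ok v v' -> D' u' v' = D u v.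
  move=> uA vA ou ov; apply/eqP; rewrite eq_le; apply/andP; split.
    have [z' zL'] := V'_ext u' v'; have [z zL ?] := f_onto zL'; subst z'.
    rewrite /btw (okE _ _ _ ou zL) (okE _ _ _ ov zL) => /eqP h.
    by have := dist_triangle tm v u z; lra.
  have [z zL] := A_ext uA vA.
  rewrite /btw -(okE _ _ _ ou zL) -(okE _ _ _ ov zL) => /eqP h.
  by have := dist_triangle tm' v' u' (f z); lra.
pose g v := odflt (f v) [pick v' | ok v v'].
have gok v : v \in A -> ok v (g v).
  by move=> /exg[v' ov]; rewrite /g; case: pickP => //= /(_ v'); rewrite ov.
have gonto y : exists2 x, x \in A & g x = y.
  have [x xA ox] := exA y; exists x => //.
  by apply: (dist_eq0 tm'); rewrite (iso x x) ?gok // (dist_refl tm).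
have giso : {in A &, forall x y, D' (g x) (g y) = D x y}.
  by move=> x y xA yA; rewrite (iso x y) ?gok.
exists g; split=> //.
- move=> x xL; apply: (dist_eq0 tm').
  have := gok _ (LAi _ xL) => /okE /(_ xL) ->; exact: (dist_refl tm).
- move=> x y xA yA.
  have inj u v : u \in A -> v \in A -> g u = g v -> u = v.
    by move=> uA vA E; apply: (dist_eq0 tm); rewrite -giso // E (dist_refl tm').
  apply/idP/idP => [/(edgeP tm)[xy h]|/(edgeP tm')[xy h]];
    [apply/(edgeP tm')|apply/(edgeP tm)]; split.
  + by apply: contra_neq xy; exact: inj.
  + move=> z'; have [z zA <-] := gonto z'; rewrite /btw !giso // => /h[->|->]; by [left|right].
  + by apply: contra_neq xy => ->.
  + move=> z bz; have zA := A_btw xA yA bz.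
    by case: (h (g z)); [rewrite /btw !giso|move/inj; left; auto|move/inj; right; auto].
Qed.

End Uniqueness.

(** * Bags as pieces of the tree *)

Section Refinement.
Variables (R : realType) (n : nat) (V : finType) (e : rel V) (lab : 'I_n -> V).
Variables (D : V -> V -> R) (d : 'I_n -> 'I_n -> R).
Hypothesis lab_inj : injective lab.
Hypothesis tm : tree_metric e D.
Hypothesis dE : forall i j, i != j -> d i j = D (lab i) (lab j).
Let W := [set lab i | i : 'I_n]%SET.

Local Notation cell := (V * {set V})%type.
Implicit Types (phi : V -> node n) (N : {set V}) (p q : cell) (B : bag R n).

(** The vertices in N have names: the label of index i is named inl i, and the
    latent ones have distinct names below k. *)
Record naming phi N (k : nat) : Prop := Naming {
  nam_sub : W \subset N;
  nam_lab : forall i, phi (lab i) = inl i;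
  nam_inj : {in N &, injective phi};
  nam_latent : forall v, v \in N -> v \notin W -> exists2 j, (j < k)%N & phi v = inr j }.

(** Apart from its representative w, the set is a union of branches at w: two
    vertices not separated by w are in the set together. *)
Definition fan p := p.1 \in p.2 /\
  forall v v', v \in p.2 -> v != p.1 -> ~~ btw D v p.1 v' -> v' \in p.2.

(** No latent vertex of the cell but its representative has a name yet: a vertex
    is named when a cut makes it a representative. *)
Definition fresh_cell N p := [/\ fan p, p.1 \in N &
  forall v, v \in p.2 -> v != p.1 -> v \notin W -> v \notin N].

(** The vertices of the cell that the algorithm can see. *)
Definition elements p : pred V := [pred v | (v \in p.2) && ((v == p.1) || (v \in W))].

(** Only a latent representative needs recorded distances, hence the condition
    on p.1. *)
Definition represents phi B p :=
  [/\ exists2 vs, bag_elems B = map phi vs & uniq vs /\ vs =i elements p,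
      bag_rep B = phi p.1 &
      forall i, lab i \in p.2 -> p.1 \notin W -> bag_rdist B i = D (lab i) p.1].

Definition overlap_at_reps p (q : cell) : bool :=
  [forall v, (v \in p.2) ==> (v \in q.2) ==> (v == p.1) && (v == q.1)].

Definition listed phi N (E : seq (edge n)) u v :=
  [/\ u \in N, v \in N & (phi u, phi v) \in E \/ (phi v, phi u) \in E].

Definition edges_sound phi N (E : seq (edge n)) :=
  forall ab, ab \in E -> exists u v, [/\ e u v, u \in N, v \in N & ab = (phi u, phi v)].

(** The cells Ps, represented by the bags Qs, and the list of edges E account
    for every edge of the cell p, while the naming (phi, N, k) has been extended
    to (phi', N', k'). The field ref_overlap keeps the cells edge-disjoint;
    ref_cells makes a cell that contains the old representative inherit it, so
    that a vertex which has become a representative never loses this status. *)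
Record refines phi N k p phi' N' k' Ps (Qs : seq (bag R n)) E : Prop := Refines {
  ref_naming : naming phi' N' k';
  ref_sub : N \subset N';
  ref_le : (k <= k')%N;
  ref_agree : {in N, phi' =1 phi};
  ref_new : forall v, v \in N' -> v \notin N -> v \in p.2;
  ref_bags : all2 (fun B q => `[< represents phi' B q >]) Qs Ps;
  ref_cells : forall q, q \in Ps -> [/\ fresh_cell N' q, q.2 \subset p.2 &
     p.1 \in q.2 -> q.1 = p.1];
  ref_overlap : pairwise overlap_at_reps Ps;
  ref_edges : forall u v, e u v -> u \in p.2 -> v \in p.2 ->
     listed phi' N' E u v \/ exists2 q, q \in Ps & u \in q.2 /\ v \in q.2;
  ref_sound : edges_sound phi' N' E }.

Lemma overlapP p q : reflect (forall v, v \in p.2 -> v \in q.2 -> v = p.1 /\ v = q.1)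
  (overlap_at_reps p q).
Proof.
apply: (iffP forallP) => h v.
  by move=> vp vq; have := h v; rewrite vp vq /= => /andP[/eqP ? /eqP].
apply/implyP => vp; apply/implyP => vq.
by have [<- <-] := h v vp vq; rewrite eqxx.
Qed.

Lemma overlap_sym p q : overlap_at_reps p q = overlap_at_reps q p.
Proof. by apply/overlapP/overlapP => h v vq vp; have [] := h v vp vq. Qed.

Lemma all2_catE (T T' : Type) (r : T -> T' -> bool) s1 s2 t1 t2 :
  size s1 = size t1 -> all2 r (s1 ++ s2) (t1 ++ t2) = all2 r s1 t1 && all2 r s2 t2.
Proof.
by elim: s1 t1 => [|x s1 IH] [|y t1] //= [/IH ->]; rewrite andbA.
Qed.

Lemma all2_eq_size (T T' : Type) (r : T -> T' -> bool) s t : all2 r s t -> size s = size t.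
Proof. by elim: s t => [|x s IH] [|y t] //= /andP[_ /IH ->]. Qed.

Lemma elements_named N p : W \subset N -> p.1 \in N -> {subset elements p <= N}.
Proof. by move=> WN pN v; rewrite inE => /andP[_ /orP[/eqP ->//|/(fintype.subsetP WN)]]. Qed.

Lemma represents_agree phi phi' N B p : W \subset N -> p.1 \in N ->
  {in N, phi' =1 phi} -> represents phi B p -> represents phi' B p.
Proof.
move=> WN pN ag [[vs ev [uv iv]] rv dv]; split.
- exists vs => //; rewrite ev; apply/eq_in_map => v; rewrite iv => /(elements_named WN pN).
  by move=> vN; rewrite ag.
- by rewrite ag.
- exact: dv.
Qed.

Lemma refines_id phi N k k' p B : naming phi N k -> (k <= k')%N -> fresh_cell N p ->
  represents phi B p -> refines phi N k p phi N k' [:: p] [:: B] [::].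
Proof.
move=> [WN pl pi pn] kk fp rp; split=> //.
- split=> // v vN vW; have [j jk ->] := pn v vN vW; exists j => //; exact: leq_trans kk.
- by move=> v ->.
- by rewrite /= andbT; apply/asboolP.
- by move=> q; rewrite inE => /eqP->.
- by move=> u v _ up vp; right; exists p; rewrite ?inE.
Qed.

Lemma naming_fresh phi N k k' : (k <= k')%N -> naming phi N k -> naming phi N k'.
Proof.
move=> kk [WN pl pi pn]; split=> // v vN vW.
by have [j jk ->] := pn v vN vW; exists j => //; exact: leq_trans kk.
Qed.

(** Refinements compose: a cell q among those of a refinement of p can be
    replaced by the cells of a refinement of q. New names only appear inside q,
    so the bags of the other cells are not affected. *)
Lemma refines_step phi N k p phi1 N1 k1 P1 q P2 Q1 B Q2 E1 phi2 N2 k2 Ps Qs E2 :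
  size Q1 = size P1 ->
  refines phi N k p phi1 N1 k1 (P1 ++ q :: P2) (Q1 ++ B :: Q2) E1 ->
  refines phi1 N1 k1 q phi2 N2 k2 Ps Qs E2 ->
  refines phi N k p phi2 N2 k2 (P1 ++ Ps ++ P2) (Q1 ++ Qs ++ Q2) (E1 ++ E2).
Proof.
move=> sz [n1 s1 l1 a1 w1 b1 c1 o1 e1 so1] [n2 s2 l2 a2 w2 b2 c2 o2 e2 so2].
have qin : q \in P1 ++ q :: P2 by rewrite mem_cat inE eqxx orbT.
have [[fq q1N1 fr] qp qw] := c1 q qin.
have ov q' : q' \in P1 ++ P2 -> overlap_at_reps q q'.
  move: o1; rewrite pairwise_cat pairwise_cons allrel_consr => /and3P[].
  move=> /andP[h1 _] _ /andP[h2 _]; rewrite mem_cat => /orP[/(allP h1)|/(allP h2)] //.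
  by rewrite overlap_sym.
have sub q' : q' \in P1 ++ P2 -> q' \in P1 ++ q :: P2.
  by rewrite !mem_cat inE => /orP[->|->]; rewrite ?orbT.
have cold q' : q' \in P1 ++ P2 ->
    [/\ fresh_cell N2 q', q'.2 \subset p.2 & p.1 \in q'.2 -> q'.1 = p.1].
  move=> q'P; have [[fq' q'N fr'] q'p q'w] := c1 q' (sub _ q'P).
  split=> //; split=> //; first exact: (fintype.subsetP s2).
  move=> v vq' vn vW; apply/negP => vN2.
  have vN1 := fr' v vq' vn vW.
  have vq := w2 v vN2 vN1.
  have /overlapP/(_ v vq vq')[_ E] := ov q' q'P.
  by rewrite E eqxx in vn.
split=> //.
- exact: fintype.subset_trans s1 s2.
- exact: leq_trans l1 l2.
- by move=> v vN; rewrite a2 ?a1 // (fintype.subsetP s1).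
- move=> v vN2 vN; have [vN1|vN1] := boolP (v \in N1); first exact: w1.
  exact/(fintype.subsetP qp)/w2.
- move: b1; rewrite all2_catE //= => /and3P[b11 b12 b13].
  have rep2 Qx Px : {subset Px <= P1 ++ q :: P2} ->
      all2 (fun B q => `[< represents phi1 B q >]) Qx Px ->
      all2 (fun B q => `[< represents phi2 B q >]) Qx Px.
    elim: Qx Px => [|Bx Qx IH] [|px Px] //= sPx /andP[/asboolP r1 /IH h].
    apply/andP; split; last by apply: h => x xP; apply: sPx; rewrite inE xP orbT.
    apply/asboolP; apply: (represents_agree (nam_sub n1) _ a2 r1).
    by have [[]] := c1 px (sPx _ (mem_head _ _)).
  rewrite all2_catE // rep2 //=; last by move=> x xP; rewrite mem_cat xP.
  rewrite all2_catE ?b2 /=; last exact: all2_eq_size b2.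
  by apply: rep2 => // x xP; rewrite mem_cat inE xP !orbT.
- move=> r; rewrite !mem_cat orbCA => /orP[rP|]; last by rewrite -mem_cat; exact: cold.
  have [fr2 rq rw] := c2 r rP; split=> //; first exact: fintype.subset_trans rq qp.
  move=> pr; have pq1 := qw (fintype.subsetP rq _ pr).
  by rewrite rw ?pq1.
- have cross r q' : r \in Ps -> q' \in P1 ++ P2 -> overlap_at_reps r q'.
    move=> rP q'P; apply/overlapP => v vr vq'.
    have [_ rq rw] := c2 r rP; have /overlapP/(_ v (fintype.subsetP rq _ vr) vq')[E1' E2'] := ov _ q'P.
    by split=> //; rewrite rw // -E1'.
  move: o1; rewrite !pairwise_cat pairwise_cons allrel_consr => /and3P[/andP[_ h12] h1 /andP[_ h2]].
  rewrite allrel_catr h12 h1 h2 o2 /= !andbT; apply/andP; split.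
    apply/allrelP => x y xP yP; rewrite overlap_sym; apply: cross => //.
    by rewrite mem_cat xP.
  apply/allrelP => x y xP yP; apply: cross => //; by rewrite mem_cat yP orbT.
- move=> u v euv up vp; case: (e1 u v euv up vp) => [[uN vN uv]|[r rP [ur vr]]].
    left; split; rewrite ?(fintype.subsetP s2) //.
    by rewrite !a2 // !mem_cat; case: uv => ->; [left|right].
  move: rP; rewrite mem_cat inE orbCA => /orP[/eqP E|rP]; last first.
    by right; exists r => //; rewrite !mem_cat orbCA rP orbT.
  subst r; case: (e2 u v euv ur vr) => [[uN vN uv]|[r rP uvr]].
    by left; split=> //; rewrite !mem_cat; case: uv => ->; rewrite orbT; [left|right].
  by right; exists r => //; rewrite !mem_cat rP orbT.
- move=> ab; rewrite mem_cat => /orP[/so1[u [v [euv uN vN ->]]]|/so2//].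
  by exists u, v; split; rewrite ?(fintype.subsetP s2) // !a2.
Qed.

Lemma refines_swap phi N k p phi' N' k' Pa Pb Qa Qb E : size Qa = size Pa ->
  refines phi N k p phi' N' k' (Pa ++ Pb) (Qa ++ Qb) E ->
  refines phi N k p phi' N' k' (Pb ++ Pa) (Qb ++ Qa) E.
Proof.
move=> sz [n1 s1 l1 a1 w1 b1 c1 o1 e1 so1]; split=> //.
- move: b1; rewrite all2_catE // => /andP[ba bb].
  by rewrite all2_catE ?bb ?ba //; exact: all2_eq_size bb.
- by move=> q; rewrite mem_cat orbC -mem_cat; exact: c1.
- move: o1; rewrite !pairwise_cat => /and3P[h1 h2 h3]; rewrite h2 h3 !andbT.
  by apply/allrelP => x y xP yP; rewrite overlap_sym; exact: (allrelP h1).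
- move=> u v euv up vp; case: (e1 u v euv up vp) => [|[q qP h]]; first by left.
  by right; exists q => //; rewrite mem_cat orbC -mem_cat.
Qed.

(** A vertex that is a representative wherever it occurs remains so under
    further cutting. *)
Lemma refines_settled phi N k q phi' N' k' Ps Qs E x :
  refines phi N k q phi' N' k' Ps Qs E -> (x \in q.2 -> x = q.1) ->
  forall r, r \in Ps -> x \in r.2 -> x = r.1.
Proof.
move=> [_ _ _ _ _ _ c _ _ _] h r /c[_ rq rw] xr.
by have E' := h (fintype.subsetP rq _ xr); rewrite rw // -E'.
Qed.

(** The oracle, completed by the recorded distances, is the tree metric on what
    is visible. *)
Lemma bag_distE phi N k B p x y : naming phi N k -> p.1 \in N -> represents phi B p ->
  x \in elements p -> y \in elements p -> bag_dist d B (phi x) (phi y) = D x y.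
Proof.
move=> [WN pl pin pn] pN [_ _ rd].
have dlab i j : (if i == j then 0 else d i j) = D (lab i) (lab j).
  by case: eqVneq => [->|/dE//]; rewrite (dist_refl tm).
have cases z : z \in elements p -> (exists i, z = lab i /\ z \in p.2) \/
    [/\ z = p.1, p.1 \notin W & exists j, phi p.1 = inr j].
  rewrite inE => /andP[zp]; have [/imsetP[i _ zi] _|zW] := boolP (z \in W).
    by left; exists i.
  rewrite orbF => /eqP E; right; subst z; split=> //.
  by have [j _ ->] := pn _ pN zW; exists j.
move=> /cases[[i [-> ip]]|[-> pW [j jE]]] /cases[[i' [-> ip']]|[-> pW' [j' jE']]];
  rewrite ?pl ?jE ?jE' /=.
- exact: dlab.
- exact: rd.
- by rewrite rd // (dist_sym tm).
- by rewrite (dist_refl tm).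
Qed.

End Refinement.

(** * Cutting a piece along a path *)

Section ListLemmas.
Lemma zip_iota_map (T : eqType) (T' : Type) (c : T -> T') k (ys : seq T) : uniq ys ->
  zip (iota k (size ys)) (map c ys) = [seq ((k + index y ys)%N, c y) | y <- ys].
Proof.
elim: ys k => //= y ys IH k /andP[yys uys]; rewrite eqxx addn0 IH //.
congr (_ :: _); apply/eq_in_map => z zys.
by case: eqVneq => [E|_]; [rewrite E zys in yys | rewrite addSnnS].
Qed.

Lemma all2_map (T T1 T2 : Type) (r : T1 -> T2 -> bool) (f : T -> T1) (g : T -> T2) s :
  all2 r (map f s) (map g s) = all (fun y => r (f y) (g y)) s.
Proof. by elim: s => //= x s ->. Qed.

Lemma zip_map (T T' : Type) (f : T -> T') (s t : seq T) :
  zip (map f s) (map f t) = [seq (f p.1, f p.2) | p <- zip s t].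
Proof. by elim: s t => [|x s IH] [|y t] //=; rewrite IH. Qed.

Lemma min_in_seq (R : realType) (T : eqType) (F : T -> R) (s : seq T) : s != [::] ->
  exists2 x, x \in s & all (fun y => F x <= F y) s.
Proof.
elim: s => // x [_ _|z s /(_ isT)[y ys ymin] _].
  by exists x; rewrite ?inE //= lexx.
have [le|lt] := leP (F x) (F y).
  exists x; first exact: mem_head.
  rewrite [all _ _]/= lexx /=; move: ymin; rewrite -[_ && _]/(all _ (z :: s)).
  by apply: sub_all => t; exact: le_trans.
exists y; first by rewrite inE ys orbT.
by rewrite -[all _ _]/((F y <= F x) && all _ (z :: s)) ymin (ltW lt).
Qed.

Lemma mem_zip_behead (T : eqType) (x0 : T) (s : seq T) x y :
  (x, y) \in zip s (behead s) <->
  exists i, [/\ (i.+1 < size s)%N, nth x0 s i = x & nth x0 s i.+1 = y].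
Proof.
have sz : size (zip s (behead s)) = (size s).-1.
  by rewrite size_zip size_behead; apply/minn_idPr/leq_pred.
split=> [/(nthP (x0, x0))[i]|[i [lt <- <-]]].
  rewrite sz => lt; rewrite nth_zip_cond sz lt => -[<- <-]; exists i.
  by rewrite nth_behead; case: (s) lt.
apply/(nthP (x0, x0)); exists i; rewrite ?sz; first by case: (s) lt.
rewrite nth_zip_cond sz nth_behead; suff -> : (i < (size s).-1)%N by [].
by case: (s) lt.
Qed.
End ListLemmas.

Section Basic.
Variables (R : realType) (n : nat) (V : finType) (e : rel V) (lab : 'I_n -> V).
Variables (D : V -> V -> R) (d : 'I_n -> 'I_n -> R).
Hypothesis lab_inj : injective lab.
Hypothesis tm : tree_metric e D.
Hypothesis dE : forall i j, i != j -> d i j = D (lab i) (lab j).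
Let W := [set lab i | i : 'I_n]%SET.
Hypothesis latent_deg : forall v, (#|[pred u | e v u]| <= 2)%N -> v \in W.
Variable sel : seq (node n) -> node n.
Hypothesis selP : selector sel.

(** A path between two vertices of the cell cannot leave it, since it would have
    to leave and return through the representative. *)
Lemma fan_convex (p : V * {set V}) x y z : fan D p -> x \in p.2 -> y \in p.2 ->
  btw D x z y -> z \in p.2.
Proof.
move=> [pp fp] xp yp b.
have [->//|zp] := eqVneq z p.1.
have [E|xn] := eqVneq x p.1.
  have [E'|yn] := eqVneq y p.1.
    by move: b; rewrite E E' => /(btw_id tm) F; rewrite F eqxx in zp.
  apply: (fp y) => //; apply/negP => h; rewrite E (btw_sym tm) in b.
  by rewrite (btw_antisym tm h b) eqxx in zp.
have [h|] := boolP (btw D x p.1 z); last exact: fp.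
have [E'|yn] := eqVneq y p.1.
  by move: b h; rewrite E' => b h; rewrite (btw_antisym tm h b) eqxx in zp.
apply: (fp y) => //; apply/negP => h'.
have := dist_gt0 tm zp; have := dist_triangle tm p.1 x y.
move: b h h'; rewrite /btw (dist_sym tm y p.1) (dist_sym tm y z) (dist_sym tm z p.1).
move=> /eqP b /eqP h /eqP h'; lra.
Qed.

Section Step.
Variables (phi : V -> node n) (N : {set V}) (k : nat) (w : V) (A : {set V}).
Variables (B : bag R n) (a : V).
Hypothesis nam : naming lab phi N k.
Hypothesis cell : fresh_cell lab D N (w, A).
Hypothesis rep : represents lab D phi B (w, A).
Hypothesis aA : a \in A.
Hypothesis aW : a \in W.
Hypothesis aw : a != w.

Let pr v := med D w a v.

(** The projection of v on the path from w to a is the median of w, a and v. *)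
Lemma proj_unique v m : btw D w m a -> btw D a m v -> btw D w m v -> m = pr v.
Proof.
move=> h1 h2 h3; have /and3P[k1 k2 k3] := medP tm w a v; rewrite -/(pr v) in k1 k2 k3.
have E : D w m = D w (pr v).
  move: h1 h2 h3 k1 k2 k3; rewrite /btw (dist_sym tm a m) (dist_sym tm a (pr v)).
  by move=> /eqP ? /eqP ? /eqP ? /eqP ? /eqP ? /eqP ?; lra.
have le : D w m <= D w (pr v) by rewrite E.
have [/eqP h _] := btw_order tm h1 k1 le.
by apply: (dist_eq0 tm); lra.
Qed.

Lemma proj_path y : btw D w y a -> pr y = y.
Proof. by move=> h; apply/esym/proj_unique; rewrite ?(btw_r tm). Qed.

Lemma proj_on v : btw D w (pr v) a. Proof. by have /and3P[] := medP tm w a v. Qed.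

(** The quantity by which BASIC partitions the bag is an affine function of the
    position of the projection on the path: equal values mean equal projections. *)
Lemma proj_dist v : D v a - D v w = 2 * D (pr v) a - D w a.
Proof.
have /and3P[] := medP tm w a v; rewrite -/(pr v) /btw.
rewrite (dist_sym tm a (pr v)) (dist_sym tm a v) (dist_sym tm w v).
by move=> /eqP ? /eqP ? /eqP ?; lra.
Qed.

Lemma path_pos_inj y y' : btw D w y a -> btw D w y' a -> D y a = D y' a -> y = y'.
Proof.
move=> h h' E; have le : D w y <= D w y'.
  by move: h h'; rewrite /btw => /eqP ? /eqP ?; lra.
have [/eqP h2 _] := btw_order tm h h' le; apply: (dist_eq0 tm).
by move: h h'; rewrite /btw => /eqP ? /eqP ?; lra.
Qed.

(** The path from a to the representative, ordered as BASIC orders its classes. *)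
Definition spine : seq V :=
  sort (fun x y => D x a <= D y a) (enum [pred y | btw D w y a]).
Let ys := spine.

Lemma mem_spine y : (y \in ys) = btw D w y a.
Proof. by rewrite mem_sort mem_enum inE. Qed.

Lemma spine_uniq : uniq ys. Proof. by rewrite sort_uniq enum_uniq. Qed.

Lemma spine_sorted : sorted (fun x y => D x a < D y a) ys.
Proof.
have s : sorted (fun x y => D x a <= D y a) ys.
  by apply: sort_sorted => x y; exact: le_total.
have m : sorted <%R (map (D^~ a) ys).
  rewrite lt_sorted_uniq_le sorted_map s andbT map_inj_in_uniq ?spine_uniq //.
  by move=> x y; rewrite !mem_spine; exact: path_pos_inj.
by rewrite sorted_map in m.
Qed.

Lemma spine_nth_lt i j : (i < size ys)%N -> (j < size ys)%N ->
  (D (nth w ys i) a < D (nth w ys j) a) = (i < j)%N.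
Proof.
have homo : forall i j, (i < size ys)%N -> (j < size ys)%N -> (i < j)%N ->
    D (nth w ys i) a < D (nth w ys j) a.
  move=> i' j' hi hj ij; have tr : transitive (fun x y => D x a < D y a).
    by move=> y x z; exact: lt_trans.
  exact: (sorted_ltn_nth tr w spine_sorted).
move=> hi hj; apply/idP/idP; last exact: homo.
by apply: contraTT; rewrite -leqNgt leq_eqVlt => /orP[/eqP->|/homo h]; rewrite -leNgt // ltW // h.
Qed.

Lemma spine_order y z : y \in ys -> z \in ys -> D y a <= D z a -> btw D a y z /\ btw D y z w.
Proof.
rewrite !mem_spine ![btw D w _ a](btw_sym tm) => by_ bz le.
by apply: (btw_order tm) by_ bz _; rewrite (dist_sym tm a y) (dist_sym tm a z).
Qed.

Lemma spine_edge u v : e u v -> u \in ys -> v \in ys ->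
  (u, v) \in zip ys (behead ys) \/ (v, u) \in zip ys (behead ys).
Proof.
wlog le : u v / D u a <= D v a.
  move=> H euv us vs; have [le|/ltW le] := leP (D u a) (D v a); first exact: H.
  by have [|//|//||] := H v u le; [rewrite (edge_sym tm)|right|left].
move=> euv us vs; left; apply/(mem_zip_behead w); exists (index u ys).
have hu : (index u ys < size ys)%N by rewrite index_mem.
have hv : (index v ys < size ys)%N by rewrite index_mem.
have lt : (index u ys < index v ys)%N.
  rewrite -spine_nth_lt // !nth_index // lt_neqAle le andbT.
  apply: contra_neq (edge_neq tm euv); apply: path_pos_inj; by rewrite -mem_spine.
have hz := leq_ltn_trans lt hv.
split=> //; first exact: nth_index.
set z := nth w ys (index u ys).+1.
have zs : z \in ys by exact: mem_nth.
have uz : D u a < D z a by rewrite -[u in D u a](nth_index w us) spine_nth_lt.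
have zv : D z a <= D v a.
  by rewrite leNgt -[v in D v a](nth_index w vs) spine_nth_lt // -leqNgt.
have [b1 _] := spine_order us zs (ltW uz).
have [b2 _] := spine_order zs vs zv.
have := btw_trans_r tm b2 b1.
by case/(btw_edge tm euv) => // E; rewrite E ltxx in uz.
Qed.

Lemma spine_edge_conv u v : (u, v) \in zip ys (behead ys) -> [/\ u \in ys, v \in ys & e u v].
Proof.
move=> /(mem_zip_behead w)[i [lt Eu Ev]].
have us : u \in ys by rewrite -Eu mem_nth // ltnW.
have vs : v \in ys by rewrite -Ev mem_nth.
have luv : D u a < D v a by rewrite -Eu -Ev spine_nth_lt // ltnW.
split=> //; apply/(edgeP tm); split; first by apply: contraTneq luv => ->; rewrite ltxx.
move=> z bz.
have [b1 _] := spine_order us vs (ltW luv).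
have baz : btw D a z v by rewrite (btw_sym tm) in b1; rewrite (btw_sym tm) in bz;
  rewrite (btw_sym tm); exact: (btw_trans_l tm b1 bz).
have bau : btw D a u z.
  rewrite (btw_sym tm) in b1; rewrite (btw_sym tm) in bz; rewrite (btw_sym tm).
  exact: (btw_trans_r tm b1 bz).
have zs : z \in ys.
  rewrite mem_spine (btw_sym tm); move: vs; rewrite mem_spine (btw_sym tm) => h.
  exact: (btw_trans_l tm h baz).
have [j hj Ez] : exists2 j, (j < size ys)%N & nth w ys j = z.
  by exists (index z ys); rewrite ?index_mem ?nth_index.
have uz : D u a <= D z a.
  move: bau; rewrite /btw (dist_sym tm a u) (dist_sym tm a z) => /eqP <-.
  by rewrite lerDl (dist_ge0 tm).
have zv : D z a <= D v a.
  move: baz; rewrite /btw (dist_sym tm a v) (dist_sym tm a z) => /eqP <-.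
  by rewrite lerDl (dist_ge0 tm).
rewrite -Eu -Ez leNgt spine_nth_lt // -?leqNgt in uz; last exact: ltnW.
rewrite -Ev -Ez leNgt spine_nth_lt // -leqNgt in zv.
have [E|ne] := eqVneq j i; first by left; rewrite -Ez -Eu E.
right; rewrite -Ez -Ev; congr nth; apply/eqP; rewrite eqn_leq zv /=.
by rewrite ltn_neqAle eq_sym ne.
Qed.

Lemma spine_sub : {subset ys <= A}.
Proof.
move=> y; rewrite mem_spine; have [[wA f] _ _] := cell.
exact: (@fan_convex (w, A) w a y).
Qed.

(** The ends of an edge off the path hang on the same vertex of the path. *)
Lemma proj_edge u v : e u v -> pr u != pr v -> u \in ys /\ v \in ys.
Proof.
wlog le : u v / D (pr u) a <= D (pr v) a.
  move=> H euv ne; have [le|/ltW le] := leP (D (pr u) a) (D (pr v) a); first exact: H.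
  by have [||vs us] := H v u le; rewrite 1?(edge_sym tm) 1?eq_sym.
move=> euv ne.
have lt : D (pr u) a < D (pr v) a.
  rewrite lt_neqAle le andbT; apply: contra_neq ne.
  exact: path_pos_inj (proj_on u) (proj_on v).
have dp := proj_on u; have dq := proj_on v.
have pu : D (pr u) (pr v) + D (pr u) a = D (pr v) a.
  have [/eqP h _] : btw D a (pr u) (pr v) /\ btw D (pr u) (pr v) w.
    by apply: spine_order => //; rewrite mem_spine.
  by move: h; rewrite (dist_sym tm a (pr u)) (dist_sym tm a (pr v)); lra.
have /and3P[_ /eqP u2 /eqP u3] := medP tm w a u; rewrite -/(pr u) in u2 u3.
have /and3P[_ /eqP v2 /eqP v3] := medP tm w a v; rewrite -/(pr v) in v2 v3.
move: (dp) (dq); rewrite /btw => /eqP wp /eqP wq.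
have E : D u (pr u) + D (pr u) (pr v) + D (pr v) v <= D u v.
  have := four_point tm u w v a.
  have := dist_sym tm u (pr u); have := dist_sym tm a (pr u); have := dist_sym tm a (pr v).
  have := dist_sym tm u w; have := dist_sym tm v a; have := dist_sym tm u a; have := dist_sym tm w v.
  have := dist_sym tm v (pr v).
  lra.
have t1 := dist_triangle tm (pr u) u v; have t2 := dist_triangle tm (pr v) (pr u) v.
have t3 := dist_triangle tm (pr v) u v; have t4 := dist_triangle tm (pr u) u (pr v).
have pq := dist_gt0 tm ne.
have b1 : btw D u (pr u) v by apply/eqP; lra.
have b2 : btw D u (pr v) v by apply/eqP; lra.
have prv x : x = pr x -> x \in ys by move=> ->; rewrite mem_spine proj_on.
have prpr x : pr (pr x) = pr x by apply/proj_path/proj_on.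
case: (btw_edge tm euv b1) => F1; last first.
  by have := prpr u; rewrite F1 => F; rewrite F1 F eqxx in ne.
case: (btw_edge tm euv b2) => F2.
  by have := prpr v; rewrite F2 => F; rewrite F F2 eqxx in ne.
by split; apply: prv.
Qed.

(** The latent vertex of the i-th class, if it is new, receives the name k + i. *)
Definition spine_naming v : node n :=
  if (v \in ys) && (v \notin N) then inr (k + index v ys)%N else phi v.
Let phi' := spine_naming.
Let N' := (N :|: [set v in ys])%SET.
(** The part of the cell that hangs on the vertex y of the path; it becomes a
    cell with representative y. *)
Definition fibre y : {set V} := [set v in A | pr v == y]%SET.

Lemma spine_naming_old v : v \in N -> phi' v = phi v.
Proof. by rewrite /phi' /spine_naming => ->; rewrite andbF. Qed.

Lemma spine_naming_new v : v \in ys -> v \notin N -> phi' v = inr (k + index v ys)%N.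
Proof. by rewrite /phi' /spine_naming => -> ->. Qed.

Lemma spine_namingP : naming lab phi' N' (k + size ys).
Proof.
have [WN pl pin pn] := nam.
have old_neq u v : u \in N -> v \in ys -> v \notin N -> phi' u <> phi' v.
  move=> uN vs vN; rewrite spine_naming_old // spine_naming_new //.
  have [/imsetP[i _ ->]|/(pn _ uN)[j jk ->]] := boolP (u \in W); first by rewrite pl.
  by move=> [E]; move: jk; rewrite E ltnNge leq_addr.
have inN' v : v \in N' -> v \in N \/ (v \in ys /\ v \notin N).
  by rewrite !inE; have [|vN] := boolP (v \in N); [left|right].
split.
- by apply: fintype.subset_trans WN _; exact: finset.subsetUl.
- move=> i; rewrite spine_naming_old ?pl //; apply: (fintype.subsetP WN).
  by apply/imsetP; exists i.
- move=> u v /inN'[uN|[us uN]] /inN'[vN|[vs vN]].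
  + by rewrite !spine_naming_old //; exact: pin.
  + by move=> E; case: (old_neq u v uN vs vN).
  + by move=> E; case: (old_neq v u vN us uN).
  + rewrite !spine_naming_new // => -[] /addnI E.
    by rewrite -(nth_index w us) -(nth_index w vs) E.
- move=> v /inN'[vN|[vs vN]] vW.
    have [j jk E] := pn v vN vW; exists j; first by apply: leq_trans jk _; exact: leq_addr.
    by rewrite spine_naming_old.
  exists (k + index v ys)%N; last exact: spine_naming_new.
  by rewrite ltn_add2l index_mem.
Qed.

Lemma fibre_cell y : y \in ys -> fresh_cell lab D N' (y, fibre y).
Proof.
move=> yy; have [[wA f] wN fr] := cell; rewrite /= in wA f wN fr.
have byy : btw D w y a by rewrite -mem_spine.
split.
- split=> /=; first by rewrite inE spine_sub // proj_path ?eqxx.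
  move=> v v'; rewrite !inE => /andP[vA /eqP Ev] vy nb.
  have /and3P[_ h2 h3] := medP tm w a v; rewrite -/(pr v) Ev in h2 h3.
  apply/andP; split.
    have [E|yw] := eqVneq y w.
      by apply: (f v) => //; rewrite -E.
    apply: (f v) => //.
      by apply: contra_neq yw => E; rewrite -Ev E; apply: proj_path; exact: (btw_l tm).
    apply: contra nb => h; apply: (btw_trans_l tm h); by rewrite (btw_sym tm).
  apply/eqP/esym; apply: proj_unique => //.
    by case: (branch_trans tm v' h2) => // h; rewrite (btw_sym tm) (negbTE nb) in h.
  by case: (branch_trans tm v' h3) => // h; rewrite (btw_sym tm) (negbTE nb) in h.
- by rewrite /= !inE yy orbT.
- move=> v /=; rewrite !inE => /andP[vA /eqP Ev] vy vW; rewrite negb_or; apply/andP; split.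
    apply: fr => //; apply: contra_neq vy => E.
    by rewrite -Ev E; apply/esym/proj_path; exact: (btw_l tm).
  by apply: contra vy => vs; rewrite -Ev proj_path // -mem_spine.
Qed.

(** The class of y is nonempty by label_projecting. If y is visible, it is the
    nearest element of the class to a and lies on the path, and BASIC selects
    it; if not, no element of the class lies on the path, and BASIC introduces y
    with its distances from the median formula. *)
Lemma fibre_bag vs y : y \in ys -> bag_elems B = map phi vs -> uniq vs ->
  vs =i elements lab (w, A) ->
  represents lab D phi'
    (basic_bag d sel B (phi a) (inr (k + index y ys)%N) (map phi [seq v <- vs | pr v == y]))
    (y, fibre y).
Proof.
move=> yy Evs uvs ivs; have [_ rB rdB] := rep; rewrite /= in rB rdB.
have [[wA f] wN fr] := cell; rewrite /= in wA f wN fr.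
have WN := nam_sub nam.
have byy : btw D w y a by rewrite -mem_spine.
have yA := spine_sub yy.
set cy := [seq v <- vs | pr v == y].
have ucy : uniq cy by rewrite filter_uniq.
have mcy v : (v \in cy) = [&& pr v == y, v \in A & (v == w) || (v \in W)].
  by rewrite mem_filter ivs inE.
have wel : w \in elements lab (w, A) by rewrite inE /= wA eqxx.
have ael : a \in elements lab (w, A) by rewrite inE /= aA; apply/orP; right.
have cel v : v \in cy -> v \in elements lab (w, A).
  by rewrite mcy inE /= => /and3P[_ -> ->].
have cN v : v \in cy -> v \in N.
  by move=> /cel; apply: (elements_named (p := (w, A))).
have bd x z : x \in elements lab (w, A) -> z \in elements lab (w, A) ->
    bag_dist d B (phi x) (phi z) = D x z.
  by apply: (bag_distE tm dE (p := (w, A)) nam).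
have cyne : cy != [::].
  have [z zcy] : exists z, z \in cy.
    have [E|yw] := eqVneq y w.
      by exists w; rewrite mcy E wA eqxx proj_path ?(btw_l tm) ?eqxx.
    have [yW|[z zW [b1 b2]]] := label_projecting tm latent_deg byy.
      by exists y; rewrite mcy proj_path // eqxx yA yW orbT.
    exists z; rewrite mcy zW orbT andbT; apply/andP; split.
      by apply/eqP/esym/proj_unique => //; rewrite (btw_sym tm).
    apply: (f y) => //; apply/negP => h.
    rewrite (btw_sym tm) in b1; rewrite (btw_sym tm) in h.
    have h' : btw D z w y by [].
    by rewrite (btw_sym tm) in b1; rewrite (btw_antisym tm b1 h') eqxx in yw.
  by apply: contraTneq zcy => ->.
rewrite /basic_bag rB; set mins := [seq v <- _ | _].
have [u0 u0cy [umin Eu]] : exists2 u0, u0 \in cy & all (fun v => D u0 a <= D v a) cy /\ sel mins = phi u0.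
  have : sel mins \in mins.
    apply: selP; have [m mcy' mmin] := min_in_seq (D^~ a) cyne.
    have : phi m \in mins.
      rewrite mem_filter map_f // andbT all_map; apply/allP => v vcy /=.
      by rewrite !bd //; first [exact: cel | exact: (allP mmin _ vcy)].
    by apply: contraTneq => ->.
  rewrite mem_filter => /andP[+ /mapP[u0 u0cy E]]; rewrite E => h; exists u0 => //; split=> //.
  move: h; rewrite all_map => /allP h; apply/allP => v vcy.
  by have := h v vcy; rewrite /= !bd //; exact: cel.
have u0el := cel _ u0cy.
have Epr : pr u0 = y by move: u0cy; rewrite mcy => /and3P[/eqP].
rewrite Eu !bd // -/(btw D w u0 a).
have [yN|yN] := boolP (y \in N).
  have ycy : y \in cy.
    rewrite mcy proj_path // eqxx yA /=; apply: contraT; rewrite negb_or => /andP[yw yW].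
    by rewrite (negbTE (fr y yA yw yW)) in yN.
  have Ey : u0 = y.
    have le := allP umin _ ycy.
    have /and3P[_ /eqP h _] := medP tm w a u0; rewrite -/(pr u0) Epr in h.
    apply/esym/(dist_eq0 tm); have := dist_ge0 tm y u0.
    by rewrite (dist_sym tm a y) (dist_sym tm a u0) in h; lra.
  rewrite Ey byy; split=> /=.
  + exists cy; last split=> // v.
      by apply/eq_in_map => v /cN vN; rewrite spine_naming_old.
    rewrite mcy !inE /= [LHS]andbCA ; case: (v \in A) => //=.
    case: eqP => //= Ev; have [|vW] := boolP (v \in W); first by rewrite !orbT.
    rewrite !orbF; apply/eqP/eqP => E.
      by rewrite -Ev E; apply/esym/proj_path; exact: (btw_l tm).
    by move: ycy; rewrite mcy -E (negbTE vW) orbF => /and3P[_ _ /eqP].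
  + by rewrite spine_naming_old.
  + move=> i; rewrite inE => /andP[iA _] yW; have yw : y = w.
      by apply/eqP; apply: contraT => yw; move: (fr y yA yw yW); rewrite yN.
    by rewrite yw; apply: rdB; rewrite // -yw.
have yw : y != w by apply: contraNneq yN => ->.
have yW : y \notin W by apply: contra yN; exact: (fintype.subsetP WN).
have ifF : btw D w u0 a = false.
  apply: contraNF yN => /proj_path; rewrite Epr => ->; exact: cN.
have ncyw v : pr v = y -> v != w.
  by move=> Ev; apply: contra_neq yw => E; rewrite -Ev E; apply: proj_path; exact: (btw_l tm).
have rd i : lab i \in A -> pr (lab i) = y ->
    (bag_dist d B (inl i) (phi a) + bag_dist d B (inl i) (phi w)
       - D a w) / 2 = D (lab i) y.
  move=> iA Ei; have iel : lab i \in elements lab (w, A).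
    by rewrite inE /= iA; apply/orP; right; apply/imsetP; exists i.
  rewrite -(nam_lab nam) !bd //.
  have /and3P[/eqP h1 /eqP h2 /eqP h3] := medP tm w a (lab i).
  rewrite -/(pr _) Ei in h1 h2 h3.
  have := dist_sym tm (lab i) a; have := dist_sym tm (lab i) w; have := dist_sym tm a w.
  have := dist_sym tm y (lab i); have := dist_sym tm a y.
  by lra.
rewrite ifF; split=> /=.
- exists (y :: cy).
    rewrite /= spine_naming_new //; congr (_ :: _).
    by apply/eq_in_map => v /cN vN; rewrite spine_naming_old.
  split.
    by rewrite /= ucy andbT; apply: contra yN; exact: cN.
  move=> v; rewrite inE mcy !inE /=.
  have [->|vy] := eqVneq v y; first by rewrite yA proj_path // eqxx.
  rewrite /=; case: eqP => Ev; rewrite /= ?andbF // andbT.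
  by rewrite (negbTE (ncyw _ Ev)).
- by rewrite spine_naming_new.
- by move=> i; rewrite inE => /andP[iA /eqP Ei] _; exact: rd.
Qed.
End Step.
End Basic.

(** * Cutting a piece at its representative *)

Section Steps.
Variables (R : realType) (n : nat) (V : finType) (e : rel V) (lab : 'I_n -> V).
Variables (D : V -> V -> R) (d : 'I_n -> 'I_n -> R).
Hypothesis lab_inj : injective lab.
Hypothesis tm : tree_metric e D.
Hypothesis dE : forall i j, i != j -> d i j = D (lab i) (lab j).
Let W := [set lab i | i : 'I_n]%SET.
Hypothesis latent_deg : forall v, (#|[pred u | e v u]| <= 2)%N -> v \in W.
Variable sel : seq (node n) -> node n.
Hypothesis selP : selector sel.

Local Notation cell := (V * {set V})%type.
Local Notation refines := (refines e lab D).
Local Notation represents := (represents lab D).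

(** The cell is the union of the fibres over the path, and an edge is either
    inside a fibre or an edge of the path, which BASIC lists in its skeleton.
    The sampled vertex a is on the path, so it becomes a representative. *)
Lemma basic_refines phi N k p B a : naming lab phi N k -> fresh_cell lab D N p ->
  represents phi B p -> a \in p.2 -> a \in W -> a != p.1 ->
  let: (k', bags, E) := basic d sel k B (phi a) in
  exists phi' N' Ps, [/\ refines phi N k p phi' N' k' Ps bags E,
    forall q, q \in Ps -> a \in q.2 -> a = q.1 &
    forall v, v \in p.2 -> exists2 q, q \in Ps & v \in q.2].
Proof.
case: p => w A nam cell rep aA aW aw; rewrite /= in aA aw.
rewrite /basic.
have [[vs Evs [uvs ivs]] rB rdB] := rep; rewrite /= in rB rdB.
have [[wA f] wN fr] := cell; rewrite /= in wA f wN fr.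
pose ys := spine D w a; pose pr := med D w a.
have ys_u : uniq ys := spine_uniq D w a.
have ysE y : (y \in ys) = btw D w y a := mem_spine D w a y.
have wel : w \in elements lab (w, A) by rewrite inE /= wA eqxx.
have ael : a \in elements lab (w, A) by rewrite inE /= aA; apply/orP; right.
have bd x z : x \in elements lab (w, A) -> z \in elements lab (w, A) ->
    bag_dist d B (phi x) (phi z) = D x z.
  by apply: (bag_distE tm dE (p := (w, A)) nam).
pose F (x : V) := 2 * D x a - D w a.
set Dm := fun v : node n => _ - _.
have DmE v : v \in vs -> Dm (phi v) = F (pr v).
  by rewrite ivs => vel; rewrite /Dm rB !bd // (proj_dist tm).
have Finj : {in ys &, injective F}.
  move=> x y xs ys'; rewrite /F => E; apply: (path_pos_inj tm (w := w) (a := a)).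
  - by rewrite -ysE.
  - by rewrite -ysE.
  - by lra.
have pr_ys v : pr v \in ys by rewrite ysE; exact: (proj_on tm).
have hit y : y \in ys -> exists2 v, v \in vs & pr v = y.
  move=> yy; have byy : btw D w y a by rewrite -ysE.
  have yA := spine_sub tm cell aA yy.
  have [E|yw] := eqVneq y w.
    by exists w; rewrite ?ivs // E /pr (proj_path tm) // (btw_l tm).
  have [yW|[z zW [b1 b2]]] := label_projecting tm latent_deg byy.
    by exists y; rewrite ?ivs ?inE /= ?yA ?yW ?orbT // /pr (proj_path tm).
  exists z.
    rewrite ivs inE /= -/W zW orbT andbT.
    apply: (f y) => //; apply/negP => h.
    rewrite (btw_sym tm) in b1; rewrite (btw_sym tm) in h.
    have h' : btw D z w y by [].
    by rewrite (btw_sym tm) in b1; rewrite (btw_antisym tm b1 h') eqxx in yw.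
  by apply/esym/(proj_unique tm) => //; rewrite (btw_sym tm).
have -> : sort <=%R (undup [seq Dm v | v <- bag_elems B]) = map F ys.
  apply: lt_sorted_eq.
  - by rewrite sort_lt_sorted undup_uniq.
  - rewrite sorted_map; apply: sub_sorted (spine_sorted tm w a).
    by move=> x y /=; rewrite /F; lra.
  - move=> x; rewrite mem_sort mem_undup Evs -map_comp; apply/mapP/mapP.
      by move=> [v vvs ->]; exists (pr v) => //=; exact: DmE.
    by move=> [y /hit[v vvs <-] ->]; exists v => //=; rewrite DmE.
have Ecl : [seq [seq v <- bag_elems B | Dm v == x] | x <- map F ys] =
    [seq map phi [seq v <- vs | pr v == y] | y <- ys].
  rewrite -map_comp; apply/eq_in_map => y yy /=; rewrite Evs filter_map; congr map.
  apply: eq_in_filter => v vvs /=; rewrite DmE //.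
  by apply/eqP/eqP => [/Finj->|->].
rewrite Ecl size_map zip_iota_map // -map_comp.
have reps : forall y, y \in ys -> represents (spine_naming D phi N k w a)
    (basic_bag d sel B (phi a) (inr (k + index y ys)%N) (map phi [seq v <- vs | pr v == y]))
    (y, fibre D w A a y).
  move=> y yy; exact: (fibre_bag tm dE latent_deg selP nam cell rep aA aW yy Evs uvs ivs).
pose Ps := [seq (y, fibre D w A a y) | y <- ys].
exists (spine_naming D phi N k w a), (N :|: [set v in ys])%SET, Ps.
have ev y v : (v \in fibre D w A a y) = (v \in A) && (pr v == y) by rewrite inE.
set bags := map _ ys.
have Erep : map (@bag_rep R n) bags = map (spine_naming D phi N k w a) ys.
  rewrite -map_comp; apply/eq_in_map => y yy /=.
  by have [_ -> _] := reps y yy.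
have inzip x y : ((x, y) \in zip ys (behead ys)) ->
    (spine_naming D phi N k w a x, spine_naming D phi N k w a y) \in
    zip (map (@bag_rep R n) bags) (behead (map (@bag_rep R n) bags)).
  move=> h; rewrite Erep behead_map zip_map.
  by apply/mapP; exists (x, y).
split; last first.
- move=> v vA; exists (pr v, fibre D w A a (pr v)); last by rewrite ev vA eqxx.
  by apply/mapP; exists (pr v).
- move=> q /mapP[y yy ->] /=; rewrite ev => /andP[_ /eqP <-].
  by apply/esym/(proj_path tm); exact: (btw_r tm).
split=> //.
- exact: spine_namingP.
- exact: finset.subsetUl.
- exact: leq_addr.
- by move=> v vN; exact: spine_naming_old.
- move=> v; rewrite !inE => /orP[->//|vs' _]; exact: (spine_sub tm cell aA).
- rewrite /bags /Ps all2_map; apply/allP => y yy; apply/asboolP; exact: reps.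
- move=> q /mapP[y yy ->]; split.
  + exact: (fibre_cell tm cell aA).
  + by apply/fintype.subsetP => v; rewrite ev => /andP[].
  + by rewrite /= ev => /andP[_ /eqP <-]; apply: (proj_path tm); exact: (btw_l tm).
- rewrite pairwise_map; move: ys_u; rewrite uniq_pairwise; apply: sub_pairwise.
  move=> x y /= xy; apply/overlapP => v; rewrite !ev.
  by move=> /andP[_ /eqP E] /andP[_ /eqP E']; rewrite -E -E' eqxx in xy.
- move=> u v euv uA vA; have [E|ne] := eqVneq (pr u) (pr v).
    right; exists (pr u, fibre D w A a (pr u)); last by rewrite !ev uA vA E eqxx.
    by apply/mapP; exists (pr u).
  have [us vs'] := proj_edge tm euv ne.
  left; split; rewrite ?inE ?us ?vs' ?orbT //.
  by case: (spine_edge tm euv us vs') => /inzip; [left|right].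
- move=> ab; rewrite Erep behead_map zip_map => /mapP[[x y] /(spine_edge_conv tm)[xs ys' exy] ->].
  by exists x, y; split=> //; rewrite !inE ?xs ?ys' orbT.
Qed.

Lemma bind_ret (A B : Type) (c : A) (f : A -> Defs.comp R B) : bind (ret R c) f = f c.
Proof.
rewrite /bind /ret /= cats0 -[RHS]map_id; apply: eq_map => -[x y] /=; by rewrite mul1r.
Qed.

(** What EXPLODE outputs: the representative and one branch at it. *)
Definition single_branch (p : cell) :=
  (exists2 v, v \in p.2 & v != p.1) /\
  forall v v', v \in p.2 -> v' \in p.2 -> v != p.1 -> v' != p.1 -> ~~ btw D v p.1 v'.

Lemma bag_size_elements phi B p : represents phi B p ->
  bag_size B = #|[set v | v \in elements lab p]%SET|.
Proof.
move=> [[vs E [u i]] _ _]; rewrite /bag_size E size_map -(card_uniqP u).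
by apply: eq_card => v; rewrite inE i.
Qed.

Lemma bag_nonrepE phi N k (B : bag R n) p vs : naming lab phi N k -> fresh_cell lab D N p ->
  bag_elems B = map phi vs -> vs =i elements lab p -> bag_rep B = phi p.1 ->
  bag_nonrep B = map phi [seq v <- vs | v != p.1].
Proof.
move=> nam [_ pN _] Evs ivs rB; rewrite /bag_nonrep Evs filter_map; congr map.
apply: eq_in_filter => v vvs /=; rewrite rB; congr (~~ _); apply/eqP/eqP => [|->//].
apply: (nam_inj nam) => //; apply: (elements_named (p := p) (nam_sub nam) pN).
by rewrite -ivs.
Qed.

(** Each branch of a cell contains a label, so that no branch is invisible to
    the algorithm. *)
Lemma label_in_cell N p v : fresh_cell lab D N p -> v \in p.2 -> v != p.1 ->
  exists z, [/\ z \in p.2, z \in W, z != p.1 & btw D p.1 v z].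
Proof.
move=> [[pp f] pN fr] vp vn; have [z zW b] := label_beyond tm latent_deg p.1 v.
exists z; split=> //; last first.
  by apply: contraNneq vn => E; move: b; rewrite E => /(btw_id tm) ->.
apply: (f v) => //; apply/negP => h.
have := dist_gt0 tm vn; have := dist_sym tm v p.1.
by move: b h; rewrite /btw => /eqP ? /eqP ?; lra.
Qed.

(** A cell with a single visible vertex has no other vertex, hence no edge to
    account for. *)
Lemma trivial_bag phi N k B p : naming lab phi N k -> fresh_cell lab D N p ->
  represents phi B p -> (bag_size B <= 1)%N -> forall v, v \in p.2 -> v = p.1.
Proof.
move=> nam cell rep s1 v vp; apply/eqP; apply: contraT => vn.
have [z [zp zW zn _]] := label_in_cell cell vp vn.
have [[pp _] _ _] := cell.
move: s1; rewrite (bag_size_elements rep) leqNgt; case/negP.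
apply: leq_trans (_ : #|[set p.1; z]%SET| <= _)%N; first by rewrite cards2 eq_sym zn.
apply/subset_leq_card/fintype.subsetP => t; rewrite !inE => /orP[]/eqP->.
  by rewrite pp eqxx.
by rewrite zp; apply/orP; right.
Qed.

Lemma refines_trivial phi N k (p : cell) : naming lab phi N k ->
  (forall v, v \in p.2 -> v = p.1) -> refines phi N k p phi N k [::] [::] [::].
Proof.
move=> nam triv; split=> //.
- by move=> v ->.
- by move=> u v euv /triv E /triv E'; have := edge_neq tm euv; rewrite E E' eqxx.
Qed.

Section Split.
Variables (phi : V -> node n) (N : {set V}) (k : nat) (w : V) (A : {set V}).
Variables (B : bag R n) (u0 : V).
Hypothesis nam : naming lab phi N k.
Hypothesis cell : fresh_cell lab D N (w, A).
Hypothesis rep : represents phi B (w, A).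

(** The branch at w containing u0: EXPLODE finds its labels by the strict
    triangle inequality at w. *)
Definition branch := [set v in A | (v != w) && ~~ btw D u0 w v]%SET.
Let K := branch.

Lemma branch_cells : fresh_cell lab D N (w, w |: K)%SET /\ fresh_cell lab D N (w, A :\: K)%SET.
Proof.
have [[wA f] wN fr] := cell; rewrite /= in wA f wN fr.
split; split=> //=.
- split=> /=; first by rewrite !inE eqxx.
  move=> v v'; rewrite !inE => /orP[->//|/and3P[vA vw nb] _ nb'].
  have [//|v'w] := eqVneq v' w; rewrite /= (f v v') //=.
  by apply/negP => /(branch_trans tm v)[h|h]; [move: nb|move: nb']; rewrite h.
- move=> v; rewrite !inE => /orP[->//|/and3P[vA vw _]]; exact: fr.
- split=> /=; first by rewrite !inE eqxx /= andbF.
  move=> v v'; rewrite !inE => /andP[nK vA] vw nb; rewrite (f v v') // andbT /=.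
  move: nK; rewrite vA vw /= negbK => b; rewrite negb_and negbK.
  have [//|v'w] := eqVneq v' w; rewrite /= negbK.
  by case: (branch_trans tm v' b) => // h; rewrite (btw_sym tm) (negbTE nb) in h.
- move=> v; rewrite !inE => /andP[_ vA]; exact: fr.
Qed.

(** No edge joins two different branches at w, so cutting at w needs no new
    edge. *)
Lemma branch_refines B1 B2 : represents phi B1 (w, w |: K)%SET ->
  represents phi B2 (w, A :\: K)%SET ->
  refines phi N k (w, A) phi N k [:: (w, w |: K)%SET; (w, A :\: K)%SET] [:: B1; B2] [::].
Proof.
move=> r1 r2; have [c1 c2] := branch_cells.
have [[wA f] wN fr] := cell; rewrite /= in wA f wN fr.
split=> //.
- by move=> v ->.
- by rewrite /= andbT; apply/andP; split; apply/asboolP.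
- move=> q; rewrite !inE => /orP[]/eqP->; split=> //.
    by apply/fintype.subsetP => v; rewrite !inE => /orP[/eqP->|/and3P[]].
  by apply/fintype.subsetP => v; rewrite inE => /andP[].
- rewrite /= !andbT; apply/overlapP => v; rewrite /= finset.in_setU1 finset.in_setD.
  by move=> /orP[/eqP ->//|->].
- move=> u v euv uA vA; right; rewrite /= in uA vA.
  have cross x y : e x y -> x \in K -> y \in A -> y \notin K -> y = w.
    move=> exy; rewrite !inE => /and3P[xA xw nb] -> /=.
    rewrite negb_and !negbK => /orP[/eqP//|b].
    case: (branch_trans tm x b) => h; first by rewrite (negbTE nb) in h.
    by case: (btw_edge tm exy h) => // E; rewrite E eqxx in xw.
  have in1 x : x \in K -> x \in (w |: K)%SET by rewrite finset.in_setU1 orbC => ->.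
  have w1 : w \in (w |: K)%SET by rewrite finset.in_setU1 eqxx.
  have [uK|uK] := boolP (u \in K); have [vK|vK] := boolP (v \in K).
  + by exists (w, w |: K)%SET; [rewrite !inE eqxx|split; exact: in1].
  + exists (w, w |: K)%SET; [by rewrite !inE eqxx|]; split; first exact: in1.
    by rewrite /= (cross u v).
  + exists (w, w |: K)%SET; [by rewrite !inE eqxx|]; split; last exact: in1.
    by rewrite /= (cross v u) // (edge_sym tm).
  + exists (w, A :\: K)%SET; first by rewrite !inE eqxx orbT.
    by rewrite /= !finset.in_setD uK vK.
Qed.
End Split.

(** Each round removes one branch; a bag of size s has at most s - 1 of them,
    which bounds the fuel. *)
Lemma explode_refines phi N k p B fuel : naming lab phi N k -> fresh_cell lab D N p ->
  represents phi B p ->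
  (explode d sel fuel B = [::] \/
   exists C Ps, [/\ explode d sel fuel B = ret R C,
     refines phi N k p phi N k Ps C [::] &
     forall q, q \in Ps -> q.1 = p.1 /\ single_branch q]) /\
  ((bag_size B <= fuel.+1)%N -> explode d sel fuel B <> [::]).
Proof.
have small B' p' : naming lab phi N k -> fresh_cell lab D N p' -> represents phi B' p' ->
    (bag_size B' <= 1)%N -> exists C Ps, [/\ ret R [::] = ret R C,
     refines phi N k p' phi N k Ps C [::] &
     forall q, q \in Ps -> q.1 = p'.1 /\ single_branch q].
  move=> nam cell rep s1; exists [::], [::]; split=> //.
  by apply: refines_trivial => //; exact: (trivial_bag nam cell rep s1).
elim: fuel p B => [|fuel IH] [w A] B nam cell rep.
  rewrite /=; case: leqP => [s1|//]; last by split; [left|].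
  by split=> //; right; exact: (small _ _ nam cell rep s1).
rewrite /=; case: leqP => [s1|s1]; first by split=> //; right; exact: (small _ _ nam cell rep s1).
have [[vs Evs [uvs ivs]] rB rdB] := rep.
rewrite (bag_nonrepE nam cell Evs ivs rB) rB.
rewrite /= in rB rdB; have [[wA f] wN fr] := cell; rewrite /= in wA f wN fr.
have WN := nam_sub nam.
set vs' := [seq v <- vs | v != _].
have ivs' v : (v \in vs') = [&& v != w, v \in A & v \in W].
  rewrite mem_filter ivs inE /=; case: eqP => //= _.
have vs'e v : v \in vs' -> v \in elements lab (w, A).
  by rewrite ivs' inE /= => /and3P[_ -> h]; apply/orP; right.
have wel : w \in elements lab (w, A) by rewrite inE /= wA eqxx.
have bd x z : x \in elements lab (w, A) -> z \in elements lab (w, A) ->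
    bag_dist d B (phi x) (phi z) = D x z.
  by apply: (bag_distE tm dE (p := (w, A)) nam).
have inj : {in elements lab (w, A) &, injective phi}.
  move=> x y xe ye; apply: (nam_inj nam);
    by apply: (elements_named (p := (w, A)) WN wN).
have svs : size vs = (size vs').+1.
  have h : perm_eq vs (w :: vs').
    apply: uniq_perm => //.
      by rewrite /= filter_uniq // andbT ivs' eqxx.
    move=> v; rewrite inE ivs' ivs inE /=; case: eqP => [->|//]; by rewrite wA.
  by rewrite (perm_size h).
have [u0 u0vs Eu] : exists2 u0, u0 \in vs' & sel (map phi vs') = phi u0.
  have : sel (map phi vs') \in map phi vs'.
    apply: selP; rewrite -size_eq0 size_map; move: s1.
    by rewrite /bag_size Evs size_map svs ltnS lt0n.
  by move=> /mapP[u0 ? ?]; exists u0.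
rewrite Eu; set K := branch w A u0.
have tri v : v \in vs' -> (bag_dist d B (phi u0) (phi v) <
    bag_dist d B (phi u0) (phi w) + bag_dist d B (phi v) (phi w)) = (v \in K).
  move=> vvs; have vse := vs'e _ vvs; have ue := vs'e _ u0vs.
  rewrite !bd // inE /btw.
  move: (vvs); rewrite ivs' => /and3P[-> -> _] /=.
  by rewrite (dist_sym tm v w) lt_neqAle (dist_triangle tm) andbT eq_sym.
have -> : [seq v <- map phi vs' | bag_dist d B (phi u0) v <
      bag_dist d B (phi u0) (phi w) + bag_dist d B v (phi w)] =
    map phi [seq v <- vs' | v \in K].
  by rewrite filter_map; congr map; apply: eq_in_filter => v /tri.
have -> : [seq v <- map phi vs' | v \notin map phi [seq v <- vs' | v \in K]] =
    map phi [seq v <- vs' | v \notin K].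
  rewrite filter_map; congr map; apply: eq_in_filter => v vvs /=; congr (~~ _).
  apply/mapP/idP => [[x]|vK].
    by rewrite mem_filter => /andP[xK xvs] /inj -> //; exact: vs'e.
  by exists v; rewrite // mem_filter vK.
set B2 := Bag _ _ _; set B1 := Bag _ _ _.
have [c1 c2] := branch_cells u0 cell.
have wK : w \notin K by rewrite inE eqxx /= andbF.
have r1 : represents phi B1 (w, w |: K)%SET.
  split=> //=.
  - exists (w :: [seq v <- vs' | v \in K]) => //; split.
      by rewrite /= mem_filter (negbTE wK) /= filter_uniq // filter_uniq.
    move=> v; have -> : (v \in elements lab (w, w |: K)%SET) =
        ((v == w) || (v \in K)) && ((v == w) || (v \in W)).
      by rewrite [in LHS]inE /= finset.in_setU1.
    rewrite in_cons mem_filter ivs'; have [//|vw] := eqVneq v w; rewrite /=.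
    by have [|//] := boolP (v \in K); rewrite inE => /and3P[->].
  - move=> i; rewrite finset.in_setU1 => /orP[/eqP E|].
      by case/negP; rewrite -E; apply/imsetP; exists i.
    by rewrite inE => /andP[iA _]; exact: rdB.
have r2 : represents phi B2 (w, A :\: K)%SET.
  split=> //=.
  - exists (w :: [seq v <- vs' | v \notin K]) => //; split.
      by rewrite /= mem_filter ivs' eqxx /= andbF /= filter_uniq // filter_uniq.
    move=> v; have -> : (v \in elements lab (w, A :\: K)%SET) =
        [&& v \notin K, v \in A & (v == w) || (v \in W)].
      by rewrite [in LHS]inE /= finset.in_setD -andbA.
    rewrite in_cons mem_filter ivs'.
    by have [->|vw] := eqVneq v w; rewrite //= wK wA.
  - by move=> i; rewrite finset.in_setD => /andP[_ iA]; exact: rdB.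
have rf := branch_refines nam cell r1 r2.
have [out tot] := IH (w, A :\: K)%SET B2 nam c2 r2.
have sb1 : single_branch (w, w |: K)%SET.
  have u0K : u0 \in K.
    move: u0vs; rewrite ivs' => /and3P[h1 h2 _]; rewrite inE h1 h2 /=.
    by apply/negP => /(btw_id tm) E; rewrite E eqxx in h1.
  split=> /=.
    exists u0; first by rewrite finset.in_setU1 u0K orbT.
    by apply: contraNneq wK => <-.
  move=> v v'; rewrite !finset.in_setU1 => /orP[/eqP->|vK]; first by rewrite eqxx.
  move=> /orP[/eqP->|v'K]; first by rewrite eqxx.
  move: vK v'K; rewrite !inE => /and3P[_ _ nb] /and3P[_ _ nb'] _ _.
  by apply/negP => /(branch_trans tm u0)[]; rewrite 1?(btw_sym tm v) ?(negbTE nb) ?(negbTE nb').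
split.
  case: out => [->|[C [Ps [-> rf2 sb]]]]; first by left.
  right; exists (B1 :: C), ((w, w |: K)%SET :: Ps); split.
  - by rewrite bind_ret.
  - have := refines_step (P1 := [:: (w, w |: K)%SET]) (Q1 := [:: B1]) (P2 := [::]) (Q2 := [::])
      erefl rf rf2; by rewrite /= !cats0.
  - move=> q; rewrite inE => /orP[/eqP->|/sb[]] //.
move=> sz; have : (bag_size B2 <= fuel.+1)%N.
  move: sz; rewrite /bag_size Evs /= !size_map svs !ltnS => sz.
  rewrite -ltnS; apply: leq_trans sz; rewrite size_filter -(count_predC (fun v => v \in K) vs').
  rewrite addnC -addn1 leq_add2l -has_count; apply/hasP; exists u0 => //.
  have [_ h] := sb1; move: u0vs; rewrite ivs' => /and3P[h1 h2 _]; rewrite inE h1 h2 /=.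
  by apply/negP => /(btw_id tm) E; rewrite E eqxx in h1.
move=> /tot; case: out => [->//|[C [Ps [-> _ _]]]] _.
by rewrite bind_ret.
Qed.

End Steps.

(** * Solving a small bag *)

Section PathLength.
Variables (R : realType) (V : finType) (e : rel V) (D : V -> V -> R).
Hypothesis tm : tree_metric e D.

Lemma path_btw x z q : path e x (z :: q) -> uniq (x :: z :: q) -> btw D x z (last z q).
Proof.
elim: q x z => [|t q IH] x z; first by move=> _ _; exact: (btw_r tm).
rewrite /= => /and3P[exz ezt pq] /and3P[]; rewrite !inE !negb_or => /and3P[xz xt xq] zq uq.
have b : btw D z t (last t q) by apply: IH; rewrite /= ?ezt ?pq // inE negb_or zq uq.
have h : btw D x z t by apply: (neighbours_btw tm) => //; rewrite (edge_sym tm).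
case: (branch_trans tm (last t q) h) => // h2.
rewrite (btw_sym tm) in b; move: zq.
by rewrite (btw_antisym tm b h2) eqxx.
Qed.

(** Distances along a simple path add up since each of its vertices lies between
    the previous ones and the following ones. *)
Lemma path_dist x q : path e x q -> uniq (x :: q) ->
  D x (last x q) = \sum_(l <- pairmap D x q) l.
Proof.
elim: q x => [|z q IH] x p u; first by rewrite /= big_nil (dist_refl tm).
rewrite /= big_cons -(eqP (path_btw p u)) IH //; first by case/andP: p.
by move: u; rewrite cons_uniq => /andP[].
Qed.

End PathLength.

Lemma simple_path (V : finType) (e : rel V) x y : connect e x y ->
  exists q, [/\ path e x q, uniq (x :: q) & last x q = y].
Proof. by case/connectP => q /shortenP[q' pq' uq' _] ->; exists q'. Qed.

Section Solve.
Variables (R : realType) (n : nat) (V : finType) (e : rel V) (lab : 'I_n -> V).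
Variables (D : V -> V -> R) (d : 'I_n -> 'I_n -> R).
Hypothesis lab_inj : injective lab.
Hypothesis treeT : is_tree e.
Hypothesis tm : tree_metric e D.
Hypothesis dE : forall i j, i != j -> d i j = D (lab i) (lab j).
Let W := [set lab i | i : 'I_n]%SET.
Hypothesis latent_deg : forall v, (#|[pred u | e v u]| <= 2)%N -> v \in W.

Local Notation cell := (V * {set V})%type.
Local Notation refines := (refines e lab D).
Local Notation represents := (represents lab D).

Section Realization.
Variables (phi : V -> node n) (N : {set V}) (k : nat) (w : V) (A : {set V}).
Variable (B : bag R n).
Hypothesis nam : naming lab phi N k.
Hypothesis cell : fresh_cell lab D N (w, A).
Hypothesis rep : represents phi B (w, A).

Let VB : finType := {v : V | v \in A}.
Let eB : rel VB := fun x y => e (val x) (val y).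
Let phiB (x : VB) : node n :=
  if val x \in N then phi (val x) else inr (k + enum_rank (val x))%N.
Let WB : {set VB} := [set x | val x \in elements lab (w, A)]%SET.
Let EB := [seq (phiB x.1, phiB x.2) | x in [pred x : VB * VB | eB x.1 x.2]].

Lemma element_named v : v \in elements lab (w, A) -> v \in N.
Proof.
by have [_ wN _] := cell; apply: (elements_named (p := (w, A)) (nam_sub nam) wN).
Qed.

Lemma bag_elemsE v : v \in N -> (phi v \in bag_elems B) = (v \in elements lab (w, A)).
Proof.
have [[vs -> [_ ivs]] _ _] := rep; move=> vN; rewrite -ivs; apply/mapP/idP => [[x xvs]|vvs].
  move/(nam_inj nam) => -> //; apply: element_named; by rewrite -ivs.
by exists v.
Qed.

(** A latent vertex of the cell other than the representative has all of its
    neighbours in the cell, hence still three at least. *)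
Lemma subtree_semi_labeled : semi_labeled eB WB.
Proof.
have [[wA f] wN fr] := cell; rewrite /= in wA f wN fr.
have [_ es ei ec ea] := treeT.
have conv x y z : x \in A -> y \in A -> btw D x z y -> z \in A.
  exact: (@fan_convex _ _ _ _ tm (w, A)).
split; first split.
- by apply/card_gt0P; exists (Sub w wA).
- by move=> x y; rewrite /eB es.
- by move=> x; rewrite /eB ei.
- move=> x y.
  case: (@arg_minP _ _ _ x (connect eB x) (fun z => D (val z) (val y))) => [|z cz zmin].
    exact: connect0.
  have [<-//|zy] := eqVneq z y.
  have vzy : val z != val y by apply: contra_neq zy; exact: val_inj.
  have [t et bt] := neighbour_toward tm vzy.
  have tA := conv _ _ _ (valP z) (valP y) bt.
  have := zmin (Sub t tA) (connect_trans cz (connect1 (et : eB z (Sub t tA)))).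
  move: bt; rewrite /btw SubK => /eqP bt; have := dist_gt0 tm (edge_neq tm et); lra.
- move=> c cc uc; rewrite -(size_map val); apply: ea; last by rewrite map_inj_uniq //; exact: val_inj.
  by move: cc; case: (c) => //= x s; rewrite -map_rcons path_map.
move=> v dv; apply: contraT => vW.
have vA := valP v.
have /andP[vw vW'] : (val v != w) && (val v \notin W).
  by move: vW; rewrite inE inE /= vA /= negb_or.
case/negP: vW'; apply: latent_deg; apply: leq_trans dv.
have sub : {subset [pred u | e (val v) u] <= [seq val x | x in [pred x | eB v x]]}.
  move=> u; rewrite inE => evu; have uA : u \in A.
    have [h|] := boolP (btw D (val v) w u); last exact: f.
    by case: (btw_edge tm evu h) => E; [rewrite E eqxx in vw|rewrite -E].
  by apply/mapP; exists (Sub u uA); rewrite // mem_enum inE.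
apply: leq_trans (leq_image_card val _).
exact/subset_leq_card/fintype.subsetP.
Qed.

(** The subtree of the cell itself realizes the distances of the bag, so the
    solver has something to find. *)
Lemma realization : exists k' E, realizes d k B k' E.
Proof.
have [[wA f] wN fr] := cell; rewrite /= in wA f wN fr.
exists (k + #|V|)%N, EB; split; first exact: leq_addr.
have phiBN x : val x \in N -> phiB x = phi (val x) by rewrite /phiB => ->.
have phiBn x : val x \notin N -> phiB x = inr (k + enum_rank (val x))%N.
  by rewrite /phiB => /negbTE->.
have mix x y : val x \in N -> val y \notin N -> phiB x <> phiB y.
  move=> xN yN; rewrite phiBN // phiBn //.
  have [/imsetP[i _ ->]|xW] := boolP (val x \in W); first by rewrite (nam_lab nam).
  by have [j jk ->] := nam_latent nam xN xW; move=> [E]; move: jk; rewrite E ltnNge leq_addr.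
exists VB, eB, WB, (fun x y => D (val x) (val y)), phiB; split; last split.
- exact: subtree_semi_labeled.
- move=> x y; have [xN|xN] := boolP (val x \in N); have [yN|yN] := boolP (val y \in N).
  + by rewrite !phiBN // => /(nam_inj nam) E; apply/val_inj/E.
  + by move=> E; case: (mix x y).
  + by move=> E; case: (mix y x).
  + by rewrite !phiBn // => -[] /addnI /val_inj /enum_rank_inj /val_inj.
- move=> a b; split.
    move=> [] /mapP[[x y]]; rewrite mem_enum inE /= => exy [-> ->].
      by exists x, y.
    by exists y, x; split=> //; rewrite /eB (edge_sym tm).
  by move=> [x [y [exy <- <-]]]; left; apply/mapP; exists (x, y); rewrite // mem_enum inE.
- move=> a; split.
    have [[vs Evs [_ ivs]] _ _] := rep; rewrite Evs => /mapP[v].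
    rewrite ivs => vel ->; have vA : v \in A by move: vel; rewrite inE => /andP[].
    exists (Sub v vA); first by rewrite inE SubK.
    by rewrite phiBN // SubK; exact: element_named.
  move=> [x]; rewrite inE => xel <-; have xN := element_named xel.
  by rewrite phiBN // bag_elemsE.
- move=> x xW; have xN : val x \notin N.
    move: xW; rewrite inE inE /= (valP x) /= negb_or => /andP[xw xW].
    by apply: fr => //; exact: valP.
  exists (k + enum_rank (val x))%N; last exact: phiBn.
  by rewrite leq_addr ltn_add2l ltn_ord.
- by move=> x y; exact: (dist_sym tm).
- by move=> x y /(edge_neq tm)/(dist_gt0 tm).
- move=> x q pq uq xW lW; rewrite !inE in xW lW.
  have xel : val x \in elements lab (w, A) by [].
  have lel : val (last x q) \in elements lab (w, A) by [].
  have xN := element_named xel; have lN := element_named lel.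
  rewrite !phiBN // (bag_distE tm dE nam (p := (w, A))) //.
  have -> : pairmap (fun x y => D (val x) (val y)) x q = pairmap D (val x) (map val q).
    by elim: (q) (x) => //= z s IH y; rewrite IH.
  rewrite -(path_dist tm) ?last_map //.
    by rewrite path_map.
  by rewrite -map_cons map_inj_uniq //; exact: val_inj.
Qed.

(** Any tree found by the solver is isometric to the subtree of the cell, by
    uniqueness; reading its names through the isometry extends the naming, and
    its edges are those of the cell. *)
Lemma solved_refines k1 E1 : realizes d k B k1 E1 ->
  exists phi' N', refines phi N k (w, A) phi' N' k1 [::] [::] E1.
Proof.
move=> [kk1 [V' [e' [W' [len [psi [semi psi_inj lists [elE latE len_sym len_pos distE]]]]]]]].
have [tree' deg'] := semi.
have [V'0 es ei ec ea] := tree'.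
have [D' [tm' D'len]] := tree_metric_exists len_pos len_sym es ei ea ec V'0.
have [[wA f] wN fr] := cell; rewrite /= in wA f wN fr.
have conv x y z : x \in A -> y \in A -> btw D x z y -> z \in A.
  exact: (@fan_convex _ _ _ _ tm (w, A)).
have bd x z : x \in elements lab (w, A) -> z \in elements lab (w, A) ->
    bag_dist d B (phi x) (phi z) = D x z.
  by apply: (bag_distE tm dE (p := (w, A)) nam).
have bd' x y : x \in W' -> y \in W' -> bag_dist d B (psi x) (psi y) = D' x y.
  move=> xW yW; have [q [pq uq ly]] := simple_path (ec x y).
  rewrite -ly distE ?ly // -[in RHS]ly (path_dist tm') //; congr (\sum_(l <- _) l).
  move: pq {uq ly}; elim: q x {xW} => //= z q IH x /andP[exz pq].
  by rewrite IH // D'len.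
pose L := [set v | v \in elements lab (w, A)]%SET.
have LE v : (v \in L) = (v \in elements lab (w, A)) by rewrite inE.
have wL : w \in L by rewrite LE inE /= wA eqxx.
have LA : L \subset A by apply/fintype.subsetP => v; rewrite LE inE => /andP[].
have labL z : z \in A -> z \in W -> z \in L.
  by move=> zA zW; rewrite LE inE /= zA; apply/orP; right.
have out v z : v \in A -> v != w -> z \notin A -> btw D v w z.
  by move=> vA vw; apply: contraNT; exact: f.
have [y0 _] := card_gt0P V'0.
pose g0 v : V' := odflt y0 [pick y | (y \in W') && (psi y == phi v)].
have g0P v : v \in L -> g0 v \in W' /\ psi (g0 v) = phi v.
  rewrite LE => vel; have vN := element_named vel.
  have /elE[y yW E] : phi v \in bag_elems B by rewrite bag_elemsE.
  rewrite /g0; case: pickP => [z /andP[zW /eqP]|/(_ y)]; first by [].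
  by rewrite yW E eqxx.
have g0onto y : y \in W' -> exists2 x, x \in L & g0 x = y.
  move=> yW; have : psi y \in bag_elems B by apply/elE; exists y.
  have [[vs Evs [_ ivs]] _ _] := rep; rewrite Evs => /mapP[v]; rewrite ivs -LE => vL E.
  exists v => //; apply: psi_inj; by have [_ ->] := g0P v vL.
have [g [gL giso gonto gedge]] : exists g : V -> V',
  [/\ {in L, g =1 g0}, {in A &, forall x y, D' (g x) (g y) = D x y},
      (forall y, exists2 x, x \in A & g x = y) &
      {in A &, forall x y, e x y = e' (g x) (g y)}].
  apply: (tree_metric_unique (L' := W') tm tm' conv LA).
  - move=> u v uA vA; have [->|vw] := eqVneq v w.
      by exists w => //; exact: (btw_r tm).
    have [z zW b] := label_beyond tm latent_deg u v.
    have [zA|zA] := boolP (z \in A); first by exists z => //; exact: labL.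
    exists w => //; have := out v z vA vw zA.
    rewrite (btw_sym tm) in b; rewrite (btw_sym tm) => h; rewrite (btw_sym tm).
    exact: (btw_trans_r tm b h).
  - move=> v vA; have [vL|vL] := boolP (v \in L).
      by exists v, v, v; split=> //; split; exact: (btw_r tm).
    have [vw vW] : v != w /\ v \notin W.
      by move: vL; rewrite LE inE /= vA negb_or => /andP[].
    have [a [b [c [aW bW cW [h1 h2 h3]]]]] := latent_branches tm latent_deg vW.
    (* Labels outside the cell are seen from inside through the representative. *)
    pose r z := if z \in A then z else w.
    have rL z : z \in W -> r z \in L.
      by move=> zW; rewrite /r; case: ifP => // zA; exact: labL.
    have pull1 x y : btw D x v y -> btw D (r x) v y.
      rewrite /r; case: ifPn => // xA b1; have := out v x vA vw xA.
      by rewrite (btw_sym tm) => b2; exact: (btw_trans_r tm b1 b2).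
    have pull x y : btw D x v y -> btw D (r x) v (r y).
      by move/pull1; rewrite (btw_sym tm) => /pull1; rewrite (btw_sym tm).
    by exists (r a), (r b), (r c); split; rewrite ?rL //; split; exact: pull.
  - by move=> u v; exact: (label_beyond tm' deg').
  - move=> v; have [vW|vW] := boolP (v \in W'); last exact: (latent_branches tm' deg').
    by exists v, v, v; split=> //; split; exact: (btw_r tm').
  - move=> x y xL yL; have [xW Ex] := g0P x xL; have [yW Ey] := g0P y yL.
    by rewrite -bd' // Ex Ey bd // -LE.
  - exact: g0onto.
have ginj : {in A &, injective g}.
  by move=> x y xA yA E; apply: (dist_eq0 tm); rewrite -giso // E (dist_refl tm').
pose phi' v := if v \in A then psi (g v) else phi v.
have LN v : v \in L -> v \in N by rewrite LE => /element_named.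
have NAL v : v \in N -> v \in A -> v \in L.
  move=> vN vA; rewrite LE inE /= vA /=; apply: contraT; rewrite negb_or => /andP[vw vW].
  by have := fr v vA vw vW; rewrite vN.
have agree : {in N, phi' =1 phi}.
  move=> v vN; rewrite /phi'; case: ifP => // vA.
  by have vL := NAL v vN vA; rewrite gL //; have [] := g0P v vL.
have newlat v : v \in A -> v \notin N -> exists2 j, (k <= j < k1)%N & phi' v = inr j.
  move=> vA vN; have gW : g v \notin W'.
    apply: contra vN => /g0onto[x xL]; rewrite -gL // => /ginj <-; [exact: LN| |by []].
    exact: (fintype.subsetP LA).
  by have [j jk E] := latE _ gW; exists j => //; rewrite /phi' vA.
have mix x y : x \in N -> y \in A -> y \notin N -> phi' x <> phi' y.
  move=> xN yA yN; have [j /andP[kj _] ->] := newlat y yA yN; rewrite agree //.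
  have [/imsetP[i _ ->]|xW] := boolP (x \in W); first by rewrite (nam_lab nam).
  have [j' jk ->] := nam_latent nam xN xW; move=> [E]; move: jk; rewrite E ltnNge.
  by rewrite kj.
have inN' v : v \in (N :|: A)%SET -> v \in N \/ (v \in A /\ v \notin N).
  by rewrite inE; have [|vN] := boolP (v \in N); [left|right].
have [WN pl pin pn] := nam.
exists phi', (N :|: A)%SET; split=> //.
- split.
  + by apply: fintype.subset_trans WN _; exact: finset.subsetUl.
  + move=> i; rewrite agree ?pl //; apply: (fintype.subsetP WN).
    by apply/imsetP; exists i.
  + move=> x y /inN'[xN|[xA xN]] /inN'[yN|[yA yN]].
    * by rewrite !agree //; exact: pin.
    * by move=> E; case: (mix x y).
    * by move=> E; case: (mix y x).
    * by rewrite /phi' xA yA => /psi_inj /ginj; exact.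
  + move=> v /inN'[vN|[vA vN]] vW.
      by have [j jk E] := pn v vN vW; exists j; rewrite ?agree //; exact: leq_trans kk1.
    by have [j /andP[_ jk] E] := newlat v vA vN; exists j.
- exact: finset.subsetUl.
- by move=> v; rewrite inE => /orP[->|].
- move=> u v euv uA vA; left; rewrite /= in uA vA.
  rewrite gedge // in euv; split; rewrite ?inE ?uA ?vA ?orbT // /phi' uA vA.
  by apply/lists; exists (g u), (g v).
- move=> [a b] abE; have /lists[u' [v' [euv <- <-]]] : (a, b) \in E1 \/ (b, a) \in E1 by left.
  have [u uA ?] := gonto u'; have [v vA ?] := gonto v'; subst u' v'.
  exists u, v; rewrite gedge // !inE uA vA !orbT; split=> //.
  by rewrite /phi' uA vA.
Qed.

End Realization.

Lemma solve_refines solve phi N k p B : exact_solver d solve ->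
  naming lab phi N k -> fresh_cell lab D N p -> represents phi B p ->
  exists phi' N', refines phi N k p phi' N' (solve k B).1 [::] [::] (solve k B).2.
Proof.
case: p => w A solveP nam cell rep; apply: (solved_refines nam cell rep).
exact/solveP/(realization nam cell rep).
Qed.

End Solve.

(** * Weighted computations *)

Section Computations.
Variable R : realType.
Local Notation comp := (Defs.comp R).

(** The probability of returning. *)
Definition mass (A : Type) (c : comp A) : R := \sum_(x <- c) x.1.
Definition always (A : Type) (c : comp A) (Q : A -> Prop) : bool :=
  all (fun x => `[< Q x.2 >]) c.
Definition subprob (A : Type) (c : comp A) : Prop :=
  all (fun x => 0 <= x.1) c /\ mass c <= 1.

Lemma prob_returns_always A (c : comp A) Q : always c Q -> prob_returns c Q = mass c.
Proof.
rewrite /prob_returns /mass => /all_filterP E.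
by rewrite -[in RHS]E big_filter.
Qed.

Lemma mass_ret A (a : A) : mass (ret R a) = 1.
Proof. by rewrite /mass /ret big_seq1. Qed.

Lemma subprob_ret A (a : A) : subprob (ret R a).
Proof. by rewrite /subprob mass_ret /= ler01. Qed.

Lemma subprob_diverge A : subprob (diverge R A).
Proof. by rewrite /subprob /mass big_nil /= ler01. Qed.

Lemma mass_ge0 A (c : comp A) : all (fun x => 0 <= x.1) c -> 0 <= mass c.
Proof.
rewrite /mass; elim: c => [|x c IH] /=; first by rewrite big_nil.
by move=> /andP[x0 /IH h]; rewrite big_cons addr_ge0.
Qed.

Lemma mass_bind A B (c : comp A) (f : A -> comp B) :
  mass (bind c f) = \sum_(x <- c) x.1 * mass (f x.2).
Proof.
rewrite /mass /bind big_flatten big_map; apply: eq_bigr => x _.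
by rewrite big_map mulr_sumr.
Qed.

Lemma always_bind A B (c : comp A) (f : A -> comp B) Q Q' :
  always c Q -> (forall a, Q a -> always (f a) Q') -> always (bind c f) Q'.
Proof.
move=> + h; rewrite /bind; elim: c => //= x c IH /andP[/asboolP Qx /IH].
rewrite /always all_cat => ->; rewrite andbT all_map.
by have := h _ Qx.
Qed.

Lemma subprob_bind A B (c : comp A) (f : A -> comp B) :
  subprob c -> (forall a, subprob (f a)) -> subprob (bind c f).
Proof.
move=> [c0 c1] h; split.
  rewrite /bind; elim: c c0 {c1} => //= x c IH /andP[x0 /IH].
  rewrite all_cat => ->; rewrite andbT all_map.
  have [+ _] := h x.2; by apply: sub_all => y y0 /=; rewrite mulr_ge0.
rewrite mass_bind; apply: le_trans c1; rewrite /mass.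
elim: c c0 => [|x c IH] /=; first by rewrite !big_nil.
move=> /andP[x0 /IH h']; rewrite !big_cons lerD //.
by rewrite ler_piMr //; have [] := h x.2.
Qed.

Lemma mass_bind_ge A B (c : comp A) (f : A -> comp B) Q b :
  all (fun x => 0 <= x.1) c -> always c Q ->
  (forall a, Q a -> b <= mass (f a)) -> mass c * b <= mass (bind c f).
Proof.
move=> c0 cQ h; rewrite mass_bind /mass mulr_suml.
elim: c c0 cQ => [|x c IH] /=; first by rewrite !big_nil.
move=> /andP[x0 /IH c0] /andP[/asboolP Qx /c0 cQ]; rewrite !big_cons lerD //.
by rewrite ler_wpM2l // h.
Qed.

(** One more trial: either the first computation returns the good value a0, and
    the second one returns for sure, or it returns another value, and the second
    one returns with probability at least L. *)
Lemma mass_bind_hit (A : eqType) B (c : comp A) (f : A -> comp B) Q L p a0 :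
  all (fun x => 0 <= x.1) c -> always c Q -> mass c = 1 -> L <= 1 ->
  p <= prob_returns c (fun a => a = a0) ->
  (forall a, Q a -> L <= mass (f a)) -> (Q a0 -> 1 <= mass (f a0)) ->
  L + p * (1 - L) <= mass (bind c f).
Proof.
move=> c0 cQ c1 L1 pc h h0; rewrite mass_bind.
have [L0 E] : 0 <= 1 - L /\ L + p * (1 - L) = 1 * L + p * (1 - L) by split; lra.
rewrite E -[X in X * L + _]c1; apply: le_trans (_ : mass c * L + prob_returns c (fun a => a = a0) * (1 - L) <= _).
  by rewrite lerD2l ler_wpM2r.
rewrite /mass /prob_returns [X in _ + X * _]big_mkcond !mulr_suml -big_split /=.
elim: c c0 cQ {c1 pc} => [|x c IH] /=; first by rewrite !big_nil.
move=> /andP[x0 /IH c0] /andP[/asboolP Qx /c0 cQ]; rewrite !big_cons lerD //.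
case: asboolP => Ex; last by rewrite mul0r addr0 ler_wpM2l // h.
rewrite -mulrDr addrC subrK ler_wpM2l // Ex h0 //; by rewrite -Ex.
Qed.

Section Sampling.
Variable A : eqType.
Implicit Types s us : seq A.

Lemma mass_uniform s : (0 < size s)%N -> mass (Defs.uniform R s) = 1.
Proof.
move=> s0; rewrite /mass /Defs.uniform big_map big_const_seq count_predT.
rewrite iter_addr_0 -[X in X *+ _]mul1r -mulrnAr mul1r -mulr_natr mulVf //.
by rewrite pnatr_eq0 -lt0n.
Qed.

Lemma weights_uniform s : all (fun x => 0 <= x.1) (Defs.uniform R s).
Proof. by rewrite /Defs.uniform all_map; apply/allP => x _ /=; rewrite invr_ge0 ler0n. Qed.

Lemma always_uniform s : always (Defs.uniform R s) (fun x => x \in s).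
Proof. by rewrite /always /Defs.uniform all_map; apply/allP => x xs /=; apply/asboolP. Qed.

Lemma subprob_uniform s : subprob (Defs.uniform R s).
Proof.
split; first exact: weights_uniform.
by case: s => [|x s]; [rewrite /mass big_nil ler01 | rewrite mass_uniform].
Qed.

Lemma subprob_sample m s : subprob (sample_without_replacement R m s).
Proof.
elim: m s => [|m IH] s /=; first exact: subprob_ret.
apply: subprob_bind => [|x]; first exact: subprob_uniform.
apply: subprob_bind => // t; exact: subprob_ret.
Qed.

Lemma always_sample m s : always (sample_without_replacement R m s)
  (fun us => size us = m /\ {subset us <= s}).
Proof.
elim: m s => [|m IH] s /=.
  by rewrite /always /= andbT; apply/asboolP.
apply: always_bind (always_uniform s) _ => x xs.
apply: always_bind (IH _) _ => t [<- ts].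
rewrite /always /= andbT; apply/asboolP; split=> // y; rewrite inE => /orP[/eqP->//|].
by move=> /ts /mem_rem.
Qed.

Lemma mass_sample m s : (m <= size s)%N -> mass (sample_without_replacement R m s) = 1.
Proof.
elim: m s => [|m IH] s ms /=; first exact: mass_ret.
apply/eqP; rewrite eq_le; apply/andP; split.
  have [] // := subprob_sample m.+1 s.
rewrite -[leLHS]mulr1 -[X in X * _](@mass_uniform s); last exact: leq_ltn_trans ms.
apply: mass_bind_ge (weights_uniform s) (always_uniform s) _ => x xs.
rewrite -(IH (rem x s)) ?size_rem //; last by case: (s) ms.
have [c0 _] := subprob_sample m (rem x s).
rewrite -[leLHS]mulr1; apply: mass_bind_ge c0 (always_sample _ _) _ => t _.
by rewrite mass_ret.
Qed.

Lemma prob_returns_bind_ge B C (c : comp B) (f : B -> comp C) Q Q' p q :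
  all (fun x => 0 <= x.1) c -> (forall b, subprob (f b)) -> 0 <= q ->
  p <= prob_returns c Q -> (forall b, Q b -> q <= prob_returns (f b) Q') ->
  p * q <= prob_returns (bind c f) Q'.
Proof.
move=> c0 f0 q0 pc h; apply: le_trans (ler_wpM2r q0 pc) _.
rewrite /prob_returns /bind big_flatten big_map /= mulr_suml.
elim: c c0 {pc} => [|x c IH] /=; first by rewrite !big_nil.
move=> /andP[x0 /IH c0]; rewrite !big_cons big_map /=.
have E : \sum_(j <- f x.2 | `[< Q' j.2 >]) (x.1 * j.1) = x.1 * prob_returns (f x.2) Q'.
  by rewrite /prob_returns mulr_sumr.
have nn : 0 <= prob_returns (f x.2) Q'.
  rewrite /prob_returns; have [+ _] := f0 x.2; elim: (f x.2) => [|y s IH2] /=; first by rewrite big_nil.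
  by move=> /andP[y0 /IH2 ?]; rewrite big_cons; case: ifP => // _; rewrite addr_ge0.
case: asboolP => Qx; rewrite E.
  by rewrite lerD // ler_wpM2l // h.
by rewrite -[leLHS]add0r lerD // mulr_ge0.
Qed.

(** Each of the draws succeeds with probability at least 1 / b. *)
Lemma prob_sample us s b : uniq us -> {subset us <= s} -> (size s <= b)%N ->
  b%:R^-1 ^+ size us <= prob_returns (sample_without_replacement R (size us) s) (fun t => t = us).
Proof.
elim: us s => [|x us IH] s /=.
  by move=> *; rewrite expr0 /prob_returns /ret big_cons big_nil asboolT // addr0.
move=> /andP[xus uus] sub sb; rewrite exprS.
have xs : x \in s by apply: sub; rewrite mem_head.
have s0 : (0 < size s)%N by case: (s) xs.
have b0 : (0 < b)%N by apply: leq_trans sb.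
apply: (@prob_returns_bind_ge _ _ _ _ (fun y => y = x)).
- exact: weights_uniform.
- by move=> y; apply: subprob_bind => [|t]; [exact: subprob_sample|exact: subprob_ret].
- by rewrite exprn_ge0 // invr_ge0 ler0n.
- apply: le_trans (_ : (size s)%:R^-1 <= _).
    by rewrite lef_pV2 ?posrE ?ltr0n // ler_nat.
  rewrite /prob_returns /Defs.uniform big_map /=.
  rewrite (perm_big _ (perm_to_rem xs)) /= big_cons asboolT //.
  by rewrite lerDl sumr_ge0 // => *; rewrite invr_ge0 ler0n.
move=> y ->; rewrite -[leLHS]mulr1.
have [c0 _] := subprob_sample (size us) (rem x s).
apply: (@prob_returns_bind_ge _ _ _ _ (fun t => t = us)) => //.
- by move=> t; exact: subprob_ret.
- apply: IH => //; last by apply: leq_trans sb; rewrite size_rem // leq_pred.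
  move=> z zus; have zs : z \in s by apply: sub; rewrite inE zus orbT.
  have zx : z != x by apply: contraNneq xus => <-.
  by move: zs; rewrite (perm_mem (perm_to_rem xs)) inE (negbTE zx).
- by move=> t ->; rewrite /prob_returns /ret big_cons big_nil asboolT // addr0.
Qed.

End Sampling.
End Computations.

(** * One pass of BIGSPLIT *)

Lemma all2_nth (T T' : Type) (r : T -> T' -> bool) s t x0 y0 i :
  all2 r s t -> (i < size s)%N -> r (nth x0 s i) (nth y0 t i).
Proof. by elim: s t i => [|x s IH] [|y t] [|i] //= /andP[rxy] // /IH h /h. Qed.

Lemma split_nth (T : Type) (x0 : T) s i : (i < size s)%N ->
  s = take i s ++ nth x0 s i :: drop i.+1 s.
Proof. by move=> h; rewrite -drop_nth // cat_take_drop. Qed.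

Section Pass.
Variables (R : realType) (n : nat) (V : finType) (e : rel V) (lab : 'I_n -> V).
Variables (D : V -> V -> R) (d : 'I_n -> 'I_n -> R).
Hypothesis lab_inj : injective lab.
Hypothesis tm : tree_metric e D.
Hypothesis dE : forall i j, i != j -> d i j = D (lab i) (lab j).
Let W := [set lab i | i : 'I_n]%SET.
Hypothesis latent_deg : forall v, (#|[pred u | e v u]| <= 2)%N -> v \in W.
Variables sel_arg sel_exp : seq (node n) -> node n.
Hypothesis sel_argP : selector sel_arg.
Hypothesis sel_expP : selector sel_exp.

Local Notation cell := (V * {set V})%type.
Local Notation refines := (refines e lab D).
Local Notation represents := (represents lab D).
Local Notation pnode := (fun i : 'I_n => inl i : node n).

(** The vertex v is a representative wherever it occurs, so that it is never an
    inner vertex of a remaining cell. *)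
Definition settled (Ps : seq cell) v := forall q, q \in Ps -> v \in q.2 -> v = q.1.
Definition covers (Ps : seq cell) (p : cell) := forall v, v \in p.2 -> exists2 q, q \in Ps & v \in q.2.

Lemma overlap_in (Ps : seq cell) q q' : pairwise (@overlap_at_reps V) Ps ->
  q \in Ps -> q' \in Ps -> q != q' -> overlap_at_reps q q'.
Proof.
elim: Ps => //= p Ps IH /andP[/allP h /IH {}IH]; rewrite !inE.
move=> /orP[/eqP->|qP] /orP[/eqP->|q'P]; rewrite ?eqxx // => ne.
- exact: h.
- by rewrite overlap_sym; exact: h.
- exact: IH.
Qed.

Lemma label_named i : lab i \in W. Proof. by apply/imsetP; exists i. Qed.

Lemma settled_refine phi N k (q : cell) phi' N' k' Ps Qs E Pa Pb x :
  refines phi N k q phi' N' k' Ps Qs E ->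
  settled (Pa ++ q :: Pb) x -> settled (Pa ++ Ps ++ Pb) x.
Proof.
move=> rf st r; rewrite !mem_cat => /or3P[rP|rP|rP].
- by apply: st; rewrite mem_cat rP.
- by apply: (refines_settled rf) => //; apply: st; rewrite mem_cat mem_head orbT.
- by apply: st; rewrite mem_cat inE rP !orbT.
Qed.

(** The bag looked up by the pass may contain the sampled label as its
    representative, in which case nothing needs to be done: by the overlap
    condition the label is then settled. *)
Lemma pass_step_refines phi0 N0 k0 p phi N k Ps Bs E B0 i :
  refines phi0 N0 k0 p phi N k Ps Bs E -> covers Ps p -> lab i \in p.2 ->
  let: (k', Bs', E') := pass_step d sel_arg B0 (k, Bs, E) (inl i) in
  exists phi' N' Ps', [/\ refines phi0 N0 k0 p phi' N' k' Ps' Bs' E', covers Ps' p,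
    settled Ps' (lab i) & forall x, settled Ps x -> settled Ps' x].
Proof.
move=> rf cov ip; rewrite /pass_step.
have nam := ref_naming rf; have all2B := ref_bags rf.
have szE := all2_eq_size all2B.
set a := fun B : bag R n => _ \in _; set j := find a Bs.
have aE q B : q \in Ps -> represents phi B q -> a B = (lab i \in q.2).
  move=> qP rep; have [cq _ _] := ref_cells rf qP; case: q qP rep cq => w A qP rep cq.
  rewrite /a -(nam_lab nam) (bag_elemsE nam cq rep).
    by rewrite inE label_named orbT andbT.
  exact/(fintype.subsetP (nam_sub nam))/label_named.
have hasB : has a Bs.
  have [q qP iq] := cov _ ip.
  have hj : (index q Ps < size Bs)%N by rewrite szE index_mem.
  have := all2_nth B0 p all2B hj; rewrite nth_index // => /asboolP rep.
  apply/(has_nthP B0); exists (index q Ps) => //.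
  by rewrite (aE q).
have hj : (j < size Bs)%N by rewrite -has_find.
have hj' : (j < size Ps)%N by rewrite -szE.
set B := nth B0 Bs j; pose q := nth p Ps j.
have qP : q \in Ps by exact: mem_nth.
have rep : represents phi B q by apply/asboolP; exact: (all2_nth B0 p all2B).
have iq : lab i \in q.2 by rewrite -(aE q B) //; exact: nth_find.
have [cq qp qw] := ref_cells rf qP.
have iN : lab i \in N by exact/(fintype.subsetP (nam_sub nam))/label_named.
have qN : q.1 \in N by case: cq.
have repq : bag_rep B = phi q.1 by case: rep.
case: ifP => [/eqP ui|ui].
  exists phi, N, Ps; split=> // q' q'P iq'.
  have Eq : lab i = q.1.
    by apply: (nam_inj nam) => //; rewrite -repq -ui (nam_lab nam).
  have [->//|ne] := eqVneq q' q.
  by have /overlapP/(_ _ iq' iq)[] := overlap_in (ref_overlap rf) q'P qP ne.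
have iq1 : lab i != q.1.
  by apply: contraFneq ui => E'; rewrite repq -E' (nam_lab nam) eqxx.
have := basic_refines tm dE latent_deg sel_argP nam cq rep iq (label_named i) iq1.
rewrite (nam_lab nam); case: (basic d sel_arg k B (inl i)) => [[k' bags] E'].
move=> [phi' [N' [Qs [rf2 stl cov2]]]].
have sPs := split_nth p hj'; have sBs := split_nth B0 hj.
rewrite -/B in sBs; rewrite -/q in sPs.
exists phi', N', (take j Ps ++ Qs ++ drop j.+1 Ps); split.
- have sz : size (take j Bs) = size (take j Ps) by rewrite !size_take szE.
  by apply: (refines_step (B := B) sz _ rf2); rewrite -sPs -sBs.
- move=> v vp; have [q' q'P vq'] := cov v vp.
  move: q'P; rewrite {1}sPs mem_cat inE orbCA => /orP[/eqP E1|q'P].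
    have [r rQ vr] : exists2 r, r \in Qs & v \in r.2 by apply: cov2; rewrite -E1.
    by exists r => //; rewrite !mem_cat rQ orbT.
  by exists q' => //; rewrite !mem_cat orbCA q'P orbT.
- move=> r; rewrite !mem_cat orbCA => /orP[/stl//|rP].
  move=> ir; have [E1|ne] := eqVneq r q; last first.
    have rP' : r \in Ps by rewrite sPs mem_cat inE orbCA rP orbT.
    have /overlapP/(_ _ ir iq)[] := overlap_in (ref_overlap rf) rP' qP ne.
    by [].
  (* the same cell twice would overlap with itself *)
  have := ref_overlap rf; rewrite sPs pairwise_cat pairwise_cons allrel_consr.
  move=> /and3P[/andP[h1 _] _ /andP[h2 _]]; subst r.
  have : overlap_at_reps q q by case/orP: rP => [/(allP h1)|/(allP h2)].
  by move=> /overlapP/(_ _ iq iq)[].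
- move=> x st; apply: settled_refine rf2 _; by rewrite -sPs.
Qed.

(** Every sampled label ends up settled, since settled vertices remain so. *)
Lemma pass_refines phi0 N0 k0 p phi N k Ps Bs E B0 (is_ : seq 'I_n) :
  refines phi0 N0 k0 p phi N k Ps Bs E -> covers Ps p ->
  (forall i, i \in is_ -> lab i \in p.2) ->
  let: (k', Bs', E') := foldl (pass_step d sel_arg B0) (k, Bs, E) (map pnode is_) in
  exists phi' N' Ps', [/\ refines phi0 N0 k0 p phi' N' k' Ps' Bs' E',
    forall i, i \in is_ -> settled Ps' (lab i) & forall x, settled Ps x -> settled Ps' x].
Proof.
elim: is_ phi N k Ps Bs E => [|i is_ IH] phi N k Ps Bs E rf cov ip.
  by exists phi, N, Ps.
rewrite -[foldl _ _ _]/(foldl (pass_step d sel_arg B0)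
   (pass_step d sel_arg B0 (k, Bs, E) (inl i)) (map pnode is_)).
have := pass_step_refines B0 rf cov (ip i (mem_head _ _)).
case: (pass_step _ _ _ _ _) => [[k1 Bs1] E1] [phi1 [N1 [Ps1 [rf1 cov1 st1 pres1]]]].
have ip' j : j \in is_ -> lab j \in p.2 by move=> h; apply: ip; rewrite inE h orbT.
have := IH _ _ _ _ _ _ rf1 cov1 ip'.
case: (foldl _ _ _) => [[k2 Bs2] E2] [phi2 [N2 [Ps2 [rf2 st2 pres2]]]].
exists phi2, N2, Ps2; split=> //.
- by move=> j; rewrite inE => /orP[/eqP->|/st2//]; exact: pres2.
- by move=> x /pres1/pres2.
Qed.

Lemma bag_size_bound phi B p : represents phi B p -> (bag_size B <= n.+1)%N.
Proof.
move=> /bag_size_elements ->; apply: leq_trans (_ : #|p.1 |: W|%SET <= _)%N.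
  by apply/subset_leq_card/fintype.subsetP => v; rewrite !inE => /andP[_].
apply: leq_trans (_ : 1 + #|W| <= _)%N; first by rewrite cardsU1 leq_add2r leq_b1.
by rewrite add1n ltnS; apply: leq_trans (leq_imset_card _ _) _; rewrite card_ord.
Qed.

Lemma explode_all_refines phi0 N0 k0 p phi N k Pd Pr Qd Qr E fuel :
  size Qd = size Pd ->
  refines phi0 N0 k0 p phi N k (Pd ++ Pr) (Qd ++ Qr) E ->
  (explode_all d sel_exp fuel Qr = [::] \/
   exists C Pc, [/\ explode_all d sel_exp fuel Qr = ret R C,
     refines phi0 N0 k0 p phi N k (Pd ++ Pc) (Qd ++ C) E,
     forall r, r \in Pc -> single_branch D r &
     forall x, settled Pr x -> settled Pc x]) /\
  ((n <= fuel)%N -> explode_all d sel_exp fuel Qr <> [::]).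
Proof.
elim: Qr Pr Pd Qd => [|B Qr IH] Pr Pd Qd sz rf.
  have := all2_eq_size (ref_bags rf); rewrite cats0 size_cat sz.
  rewrite -{1}[size Pd]addn0 => /addnI/esym/eqP/nilP E1; subst Pr.
  split=> //; right; exists [::], [::]; rewrite !cats0 in rf *; split=> //.
case: Pr rf => [|q Pr] rf.
  by have := all2_eq_size (ref_bags rf); rewrite !size_cat sz => /addnI.
have nam := ref_naming rf.
have qP : q \in Pd ++ q :: Pr by rewrite mem_cat mem_head orbT.
have [cq _ _] := ref_cells rf qP.
have rep : represents phi B q.
  by have := ref_bags rf; rewrite all2_catE //= => /and3P[_ /asboolP].
have [out tot] := explode_refines tm dE latent_deg sel_expP fuel nam cq rep.
have totf : (n <= fuel)%N -> explode d sel_exp fuel B <> [::].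
  by move=> nf; apply: tot; apply: leq_trans (bag_size_bound rep) _.
rewrite [explode_all _ _ _ _]/=.
case: out totf => [-> totf|[C1 [Ps1 [-> rf1 sb1]]] _].
  by split; [left | move=> /totf].
rewrite bind_ret -/(explode_all d sel_exp fuel Qr).
have rf2 := refines_step sz rf rf1.
rewrite cats0 !catA in rf2.
have sz2 : size (Qd ++ C1) = size (Pd ++ Ps1).
  by rewrite !size_cat sz (all2_eq_size (ref_bags rf1)).
have [out2 tot2] := IH Pr (Pd ++ Ps1) (Qd ++ C1) sz2 rf2.
split.
  case: out2 => [->|[C2 [Pc2 [-> rf3 sb2 st2]]]]; first by left.
  right; exists (C1 ++ C2), (Ps1 ++ Pc2); split.
  - by rewrite bind_ret.
  - by rewrite !catA.
  - by move=> r; rewrite mem_cat => /orP[/sb1[]|/sb2].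
  - move=> x st r; rewrite mem_cat => /orP[rP|rP].
      by apply: (refines_settled rf1 _ rP); apply: st; rewrite mem_head.
    by apply: st2 rP => q' q'P; apply: st; rewrite inE q'P orbT.
move=> /tot2; case: out2 => [->//|[C2 [Pc2 [-> _ _ _]]]] _.
by rewrite bind_ret.
Qed.

Lemma bag_nonrepP phi N k B p : naming lab phi N k -> fresh_cell lab D N p ->
  represents phi B p ->
  [/\ forall x, x \in bag_nonrep B <-> exists2 i, x = inl i & lab i \in p.2 /\ lab i != p.1,
      uniq (bag_nonrep B) & (size (bag_nonrep B)).+1 = bag_size B].
Proof.
move=> nam cell [[vs Evs [uvs ivs]] rB _].
have [[pp _] pN _] := cell.
have E := bag_nonrepE nam cell Evs ivs rB; rewrite E.
have inj : {in vs &, injective phi}.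
  move=> x y xv yv; apply: (nam_inj nam); apply: (elements_named (p := p) (nam_sub nam) pN);
  by rewrite -ivs.
split.
- move=> x; split.
    move=> /mapP[v]; rewrite mem_filter ivs inE => /and3P[vp vA].
    rewrite (negbTE vp) /= => /imsetP[i _ vi] ->; exists i; rewrite -?vi //.
    by rewrite vi (nam_lab nam).
  move=> [i -> [ip ip1]]; apply/mapP; exists (lab i); last by rewrite (nam_lab nam).
  by rewrite mem_filter ip1 ivs inE ip label_named orbT.
- rewrite map_inj_in_uniq ?filter_uniq // => x y; rewrite !mem_filter.
  by move=> /andP[_ xv] /andP[_ yv]; exact: inj.
- rewrite /bag_size Evs !size_map.
  have h : perm_eq vs (p.1 :: [seq v <- vs | v != p.1]).
    apply: uniq_perm => //.
      by rewrite /= filter_uniq // andbT mem_filter eqxx.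
    move=> v; rewrite inE mem_filter; case: eqP => [->|//].
    by rewrite ivs inE pp eqxx.
  by rewrite (perm_size h).
Qed.

(** Cutting at the sampled labels and exploding gives cells with a single branch
    each, in which no sampled label is an inner vertex. *)
Lemma one_pass_refines phi N k p B us fuel : naming lab phi N k -> fresh_cell lab D N p ->
  represents phi B p -> {subset us <= bag_nonrep B} ->
  let: (k', Bs, E) := foldl (pass_step d sel_arg B) (k, [:: B], [::]) us in
  (k <= k')%N /\
  (explode_all d sel_exp fuel Bs = [::] \/
   exists C Pc phi' N', [/\ explode_all d sel_exp fuel Bs = ret R C,
     refines phi N k p phi' N' k' Pc C E,
     forall r, r \in Pc -> single_branch D r &
     forall i, inl i \in us -> settled Pc (lab i)]) /\
  ((n <= fuel)%N -> explode_all d sel_exp fuel Bs <> [::]).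
Proof.
move=> nam cell rep sub.
have [nonP _ _] := bag_nonrepP nam cell rep.
pose is_ := pmap (fun x : node n => if x is inl i then Some i else None) us.
have Eus : us = map pnode is_.
  rewrite /is_; elim: us sub {is_} => //= x us IH sub.
  have /nonP[i -> _] := sub x (mem_head _ _); rewrite /= -IH // => y ys.
  by apply: sub; rewrite inE ys orbT.
have isP i : (inl i \in us) = (i \in is_).
  by rewrite Eus mem_map // => x y [].
have ip i : i \in is_ -> lab i \in p.2.
  by rewrite -isP => /sub/nonP[j [<-] []].
have rf0 := refines_id e nam (leqnn k) cell rep.
have cov0 : covers [:: p] p by move=> v vp; exists p; rewrite ?inE.
have := pass_refines B rf0 cov0 ip; rewrite -Eus.
case: (foldl _ _ _) => [[k' Bs] E] [phi' [N' [Ps [rf st _]]]].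
split; first exact: ref_le rf.
have [out tot] := explode_all_refines (Pd := [::]) (Qd := [::]) fuel erefl rf.
split=> //; case: out => [->|[C [Pc [-> rf2 sb st2]]]]; first by left.
right; exists C, Pc, phi', N'; split=> // i; rewrite isP => ii; exact/st2/st.
Qed.

End Pass.

(** * Termination with probability one *)

(** With N the size of a bag, q is the threshold: bags of size at most q are
    accepted by BIGSPLIT, and Delta + 1 disjoint sets of q labels would need
    more labels than the N - 1 available ones. *)
Lemma truncn_bound (R : realType) (N Delta : nat) (q := Num.truncn (N%:R / Num.sqrt Delta%:R : R)) :
  (0 < Delta)%N -> (Delta < N)%N ->
  [/\ (0 < q)%N, q%:R <= N%:R / Num.sqrt Delta%:R :> R & (N <= q * Delta.+1)%N].
Proof.
move=> D0 DN; set s : R := Num.sqrt Delta%:R; set x := N%:R / s.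
have s2 : s ^+ 2 = Delta%:R by rewrite sqr_sqrtr // ler0n.
have s0 : 0 < s by rewrite sqrtr_gt0 ltr0n.
have s1 : 1 <= s.
  by rewrite -[leLHS]sqrtr1 ler_wsqrtr // ler1n.
have xs : x * s = N%:R by rewrite divfK // gt_eqF.
have NS : s ^+ 2 + 1 <= N%:R by rewrite s2 natr1 ler_nat.
have x2 : 2 <= x.
  rewrite -(ler_pM2r s0) xs; apply: le_trans NS; have := sqr_ge0 (s - 1).
  rewrite sqrrB1; lra.
have /truncn_itv/andP[] : 0 <= x by lra.
rewrite -/q => qx xq.
have q1 : x - 1 < q%:R by rewrite -natr1 in xq; lra.
have q0 : 1 < q%:R :> R by lra.
split=> //; first by rewrite -(ltr_nat R); lra.
rewrite -(ler_nat R) natrM -natr1 -s2 -xs.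
have h : x / 2 <= q%:R by lra.
have h2 : 2 * s <= s ^+ 2 + 1 by have := sqr_ge0 (s - 1); rewrite sqrrB1; lra.
have -> : x * s = (x / 2) * (2 * s) by field.
by apply: ler_pM => //; lra.
Qed.

Section Termination.
Variables (R : realType) (n : nat) (V : finType) (e : rel V) (lab : 'I_n -> V).
Variables (D : V -> V -> R) (d : 'I_n -> 'I_n -> R).
Hypothesis lab_inj : injective lab.
Hypothesis treeT : is_tree e.
Hypothesis tm : tree_metric e D.
Hypothesis dE : forall i j, i != j -> d i j = D (lab i) (lab j).
Let W := [set lab i | i : 'I_n]%SET.
Hypothesis latent_deg : forall v, (#|[pred u | e v u]| <= 2)%N -> v \in W.
Variables sel_arg sel_exp : seq (node n) -> node n.
Hypothesis sel_argP : selector sel_arg.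
Hypothesis sel_expP : selector sel_exp.
Variable solve : nat -> bag R n -> nat * seq (edge n).
Hypothesis solveP : exact_solver d solve.

Local Notation cell := (V * {set V})%type.
Local Notation refines := (refines e lab D).
Local Notation represents := (represents lab D).

(** The part of the cell that lies behind x, seen from the representative. *)
Definition descendants (p : cell) x : {set V} := [set v in p.2 | btw D p.1 x v]%SET.

(** Greedy choice: take x in X farthest from the representative, pick one
    element z of S behind x, and discard every member of X that z serves. A
    remaining member y has no element of S behind x among its own, for otherwise
    x, being farther, would lie behind y and z too. So the picked elements use
    up disjoint sets of at least q elements of S. *)
Lemma hitting_set p q (S L X : {set V}) : (0 < q)%N ->
  (forall x, x \in X -> descendants p x :&: S \subset L /\
     (q <= #|descendants p x :&: S|%SET)%N) ->
  exists hs, [/\ uniq hs, {subset hs <= L}, (size hs * q <= #|L|)%N &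
    forall x, x \in X -> exists2 h, h \in hs & h \in descendants p x].
Proof.
move=> q0; have [k] := ubnP #|X|; elim: k L X => // k IH L X Xk HX.
have [->|[x0 x0X]] := set_0Vmem X.
  by exists [::]; split=> // x; rewrite inE.
case: (@arg_maxP _ _ _ x0 (mem X) (fun x => D p.1 x)) => //= x xX' xmax; have xX : x \in X := xX'.
have [dL dq] := HX x xX.
have [z] : exists z, z \in (descendants p x :&: S)%SET.
  by apply/card_gt0P; apply: leq_trans dq.
rewrite inE => /andP[zx zS].
pose X' := [set y in X | z \notin descendants p y]%SET.
pose L' := (L :\: descendants p x)%SET.
have X'X : (#|X'| < #|X|)%N.
  apply: proper_card; apply/properP; split.
    by apply/fintype.subsetP => y; rewrite inE => /andP[].
  by exists x; rewrite // inE xX negbK.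
have [|hs [uhs hsL szhs hit]] := IH L' X' (leq_trans X'X Xk).
  move=> y; rewrite inE => /andP[yX zy]; have [dyL dyq] := HX y yX; split=> //.
  apply/fintype.subsetP => v vd; have vL := fintype.subsetP dyL _ vd.
  rewrite inE vL andbT; apply: contra zy => vx.
  move: vd vx zx; rewrite !inE => /andP[/andP[_ by_] _] /andP[_ bx] /andP[zA bz].
  have le : D p.1 y <= D p.1 x := xmax y yX.
  by have [h _] := btw_order tm by_ bx le; rewrite zA (btw_trans_l tm bz h).
exists (z :: hs); split.
- rewrite /= uhs andbT; apply/negP => /hsL; by rewrite inE zx.
- move=> y; rewrite inE => /orP[/eqP->|/hsL].
    by apply: (fintype.subsetP dL); rewrite inE zx.
  by rewrite inE => /andP[].
- rewrite /= mulSn -(cardsID (descendants p x) L) leq_add //.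
  apply: leq_trans dq _; apply: subset_leq_card; apply/fintype.subsetP => v vd.
  by rewrite inE (fintype.subsetP dL) //; move: vd; rewrite inE => /andP[].
- move=> y yX; have [zy|zy] := boolP (z \in descendants p y).
    by exists z; rewrite ?mem_head.
  have [|h hhs hd] := hit y; first by rewrite inE yX.
  by exists h; rewrite // inE hhs orbT.
Qed.

Definition inner_labels (p : cell) : {set V} := [set v in p.2 | (v \in W) && (v != p.1)]%SET.

Lemma bag_size_labels phi N B p : fresh_cell lab D N p -> represents phi B p ->
  bag_size B = #|inner_labels p|.+1.
Proof.
move=> [[pp _] _ _] rep; rewrite (bag_size_elements rep).
have -> : [set v | v \in elements lab p]%SET = (p.1 |: inner_labels p)%SET.
  apply/finset.setP => v; rewrite !inE; have [->|_] := eqVneq v p.1; first by rewrite pp.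
  by rewrite /= andbT.
by rewrite cardsU1 inE eqxx !andbF.
Qed.

(** A cell produced by a pass consists of its representative and the vertices
    behind its first vertex x. If it had q labels, then some settled sampled
    label would be among them and be an inner vertex of the cell. *)
Lemma small_branch phi N k p phi' N' k' Ps Qs E r (hs : seq V) q :
  refines phi N k p phi' N' k' Ps Qs E -> r \in Ps -> fan D p -> single_branch D r ->
  (forall v, v \in hs -> settled Ps v) ->
  (forall x, x \in p.2 -> x != p.1 -> (q <= #|descendants p x :&: inner_labels p|%SET)%N ->
     exists2 h, h \in hs & h \in descendants p x) ->
  (#|inner_labels r| < q)%N.
Proof.
move=> rf rP fp [[v0 v0r v0n] sb] st hit; rewrite ltnNge; apply/negP => qle.
have [[[rr fr] _ _] rp rw] := ref_cells rf rP.
have toward v : v \in r.2 -> v != r.1 -> btw D p.1 r.1 v /\ v != p.1.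
  move=> vr vn.
  have pr : p.1 \in r.2 -> r.1 = p.1 by [].
  split; last by apply: contra_neq vn => E1; rewrite E1 in vr *; rewrite pr.
  have [h|] := boolP (btw D v r.1 p.1); first by rewrite (btw_sym tm).
  move=> h; have h2 := fr v p.1 vr vn h.
  by rewrite -(pr h2) (btw_r tm) in h.
have [x ex bx] : exists2 x, e r.1 x & btw D r.1 x v0.
  by apply: (neighbour_toward tm); rewrite eq_sym.
have xn : x != r.1 by rewrite eq_sym (edge_neq tm).
have nb : ~~ btw D v0 r.1 x.
  apply/negP => h; have := dist_gt0 tm xn; have := dist_sym tm x r.1.
  move: bx h; rewrite /btw (dist_sym tm v0 r.1) (dist_sym tm v0 x).
  by move=> /eqP ? /eqP ?; lra.
have xr : x \in r.2 by exact: (fr v0).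
have [bxp xp] := toward x xr xn.
have r1p : r.1 \in p.2 by exact: (fintype.subsetP rp).
have desc v : (v \in descendants p x) = (v \in r.2) && (v != r.1).
  rewrite inE; apply/andP/andP => [[vp b]|[vr vn]].
    have vn : v != r.1.
      apply: contraNneq xn => E1; rewrite E1 in b; apply/eqP.
      by apply/esym; exact: (btw_antisym tm bxp b).
    split=> //; apply: (fr x) => //; apply/negP => h.
    have := dist_gt0 tm xn; have := dist_triangle tm r.1 p.1 v.
    move: bxp b h; rewrite /btw (dist_sym tm r.1 x) => /eqP ? /eqP ? /eqP ?; lra.
  split; first exact: (fintype.subsetP rp).
  have [bv vp] := toward v vr vn.
  have nb' := sb x v xr vr xn vn.
  have [h|h] := neighbour_side tm v ex.
    by case/negP: nb'; rewrite (btw_sym tm).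
  rewrite (btw_sym tm) in h.
  have := btw_trans_r tm bv; move: bv h bxp; rewrite /btw => /eqP h1 /eqP h2 /eqP h3 _.
  by apply/eqP; lra.
have : (q <= #|descendants p x :&: inner_labels p|%SET)%N.
  apply: leq_trans qle _; apply: subset_leq_card; apply/fintype.subsetP => v.
  rewrite inE => /and3P[vr vW vn].
  have [_ vp] := toward v vr vn.
  rewrite inE desc vr vn inE vW vp !andbT; exact: (fintype.subsetP rp).
move=> /(hit x (fintype.subsetP rp _ xr) xp)[h hhs].
rewrite desc => /andP[hr hn]; have := st h hhs r rP hr.
by move=> E1; rewrite E1 eqxx in hn.
Qed.

Definition max_bag_size (C : seq (bag R n)) : nat := \max_(B <- C) bag_size B.

(** The hitting set for the subtrees with at least q labels has at most Delta
    elements; it is completed arbitrarily to Delta labels. *)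
Lemma good_sample phi N k B p Delta : naming lab phi N k -> fresh_cell lab D N p ->
  represents phi B p -> (0 < Delta)%N -> (Delta < bag_size B)%N ->
  exists us, [/\ uniq us, {subset us <= bag_nonrep B}, size us = Delta &
   forall phi' N' k' Pc C E, refines phi N k p phi' N' k' Pc C E ->
     (forall r, r \in Pc -> single_branch D r) ->
     (forall i, inl i \in us -> settled Pc (lab i)) ->
     (max_bag_size C)%:R <= (bag_size B)%:R / Num.sqrt Delta%:R :> R].
Proof.
move=> nam cell rep D0 DB.
have [q0 qx qN] := truncn_bound R D0 DB; set q := Num.truncn _ in q0 qx qN.
set S := inner_labels p.
have szB : bag_size B = #|S|.+1 := bag_size_labels cell rep.
(* The subtrees that would be too large for a bag of an accepted pass. *)
pose X := [set x in p.2 | (x != p.1) && (q <= #|descendants p x :&: S|%SET)%N]%SET.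
have [|hs [uhs hsS szhs hit]] := @hitting_set p q S S X q0.
  move=> x; rewrite inE => /and3P[_ _ ->]; split=> //; exact: finset.subsetIr.
have hsD : (size hs <= Delta)%N.
  rewrite leqNgt; apply/negP => h.
  have : (#|S|.+1 <= size hs * q)%N.
    by rewrite -szB; apply: leq_trans qN _; rewrite mulnC leq_mul2r h orbT.
  by move=> /leq_trans/(_ szhs); rewrite ltnn.
have DS : (Delta <= #|S|)%N by rewrite szB in DB.
pose vs := hs ++ take (Delta - size hs) [seq v <- enum S | v \notin hs].
have uvs : uniq vs.
  rewrite cat_uniq uhs /=; apply/andP; split; last by rewrite take_uniq // filter_uniq ?enum_uniq.
  by apply/hasPn => v /mem_take; rewrite mem_filter => /andP[].
have vsS : {subset vs <= S}.
  move=> v; rewrite mem_cat => /orP[/hsS//|/mem_take].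
  by rewrite mem_filter mem_enum => /andP[].
have vsz : size vs = Delta.
  rewrite size_cat size_take.
  have -> : size [seq v <- enum S | v \notin hs] = (#|S| - size hs)%N.
    have pe : perm_eq (enum S) (hs ++ [seq v <- enum S | v \notin hs]).
      apply: uniq_perm; rewrite ?enum_uniq //.
        rewrite cat_uniq uhs filter_uniq ?enum_uniq // andbT /=.
        by apply/hasPn => v; rewrite mem_filter => /andP[].
      move=> v; rewrite mem_cat mem_filter mem_enum.
      by case: (boolP (v \in hs)) => // /hsS ->.
    by rewrite cardE (perm_size pe) size_cat addKn.
  case: ltnP => h; first by rewrite subnKC.
  have : (#|S| <= Delta)%N.
    by rewrite -(leq_sub2rE (p := size hs)) // (leq_trans _ DS).
  by rewrite subnKC ?(leq_trans hsD) // => h2; apply/eqP; rewrite eqn_leq h2.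
have vN v : v \in vs -> v \in N.
  move=> /vsS; rewrite inE => /and3P[_ vW _].
  exact: (fintype.subsetP (nam_sub nam)).
have [nonP _ _] := bag_nonrepP nam cell rep.
exists (map phi vs); split.
- by rewrite map_inj_in_uniq // => x y /vN xN /vN yN; exact: (nam_inj nam).
- move=> x /mapP[v vvs ->]; apply/nonP; have := vsS _ vvs.
  rewrite inE => /and3P[vp /imsetP[i _ E] vn]; subst v; exists i => //.
  by rewrite (nam_lab nam).
- by rewrite size_map.
move=> phi' N' k' Pc C E rf sb st.
apply: le_trans qx; rewrite ler_nat.
have st' v : v \in hs -> settled Pc v.
  move=> vhs; have := hsS _ vhs; rewrite inE => /and3P[_ /imsetP[i _ Ei] _]; subst v.
  by apply: st; rewrite -(nam_lab nam); apply: map_f; rewrite mem_cat vhs.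
have small r : r \in Pc -> (#|inner_labels r| < q)%N.
  move=> rP; apply: (small_branch rf rP _ (sb r rP) st'); first by case: cell.
  move=> x xp xn qd; apply: hit; by rewrite inE xp xn.
have := ref_bags rf; have := ref_cells rf; move: small; rewrite /max_bag_size.
elim: C Pc {rf sb st st'} => [|B1 C IH] [|r Pc] //= small cells; first by rewrite big_nil.
move=> /andP[/asboolP rep1 h]; rewrite big_cons geq_max; apply/andP; split.
  have [cr _ _] := cells r (mem_head _ _).
  rewrite (bag_size_labels cr rep1); apply: small; exact: mem_head.
by apply: IH h => r' r'P; [apply: small|apply: cells]; rewrite inE r'P orbT.
Qed.

(** The last component, an inner vertex that has become a representative, is
    what makes the main loop progress. *)
Definition split_outcome phi N k p (r : nat * seq (bag R n) * seq (edge n)) :=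
  exists phi' N' Pc, [/\ refines phi N k p phi' N' r.1.1 Pc r.1.2 r.2,
    forall q, q \in Pc -> single_branch D q &
    exists2 a, (a \in p.2) && (a != p.1) & settled Pc a].

Lemma refines_le phi N k k1 p phi' N' k' Ps Qs E : (k <= k1)%N ->
  refines phi N k1 p phi' N' k' Ps Qs E -> refines phi N k p phi' N' k' Ps Qs E.
Proof. by move=> kk [? ? ? ? ? ? ? ? ? ?]; split=> //; exact: leq_trans kk _. Qed.

(** Whatever their sizes, the cells of a pass are single branches in which every
    sampled label is settled. *)
Lemma bigsplit_always phi N k p B Delta m fuel : naming lab phi N k ->
  fresh_cell lab D N p -> represents phi B p -> (0 < m)%N ->
  always (bigsplit d sel_arg sel_exp Delta m fuel k B) (split_outcome phi N k p).
Proof.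
elim: fuel k => [//|fuel IH] k nam cell rep m0 /=.
apply: always_bind (always_sample _ _ _) _ => us [szu sub].
have := one_pass_refines tm dE latent_deg sel_argP sel_expP fuel nam cell rep sub.
case: (foldl _ _ _) => [[k' Bs] E] [kk' [out _]].
case: out => [->//|[C [Pc [phi' [N' [-> rf sb st]]]]]].
rewrite bind_ret; case: ifP => _; last first.
  have := IH k' (naming_fresh kk' nam) cell rep m0.
  apply: sub_all => x /asboolP[f [M [Ps [h1 h2 h3]]]]; apply/asboolP.
  by exists f, M, Ps; split=> //; exact: refines_le h1.
rewrite /always /= andbT; apply/asboolP; exists phi', N', Pc; split=> //.
have [nonP _ _] := bag_nonrepP nam cell rep.
case: us szu sub st => [|x us] szu sub st; first by rewrite -szu in m0.
have /nonP[i Ei [ip ipn]] := sub x (mem_head _ _).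
exists (lab i); first by rewrite ip.
by apply: st; rewrite -Ei mem_head.
Qed.

Lemma subprob_explode fuel B : subprob (explode d sel_exp fuel B).
Proof.
elim: fuel B => [|fuel IH] B /=; case: ifP => _; try exact: subprob_ret.
  exact: subprob_diverge.
by apply: subprob_bind => // C; exact: subprob_ret.
Qed.

Lemma subprob_explode_all fuel Bs : subprob (explode_all d sel_exp fuel Bs).
Proof.
elim: Bs => [|B Bs IH]; first exact: subprob_ret.
apply: subprob_bind => [|C]; first exact: subprob_explode.
apply: subprob_bind => // C'; exact: subprob_ret.
Qed.

Lemma subprob_bigsplit Delta m fuel k B :
  subprob (bigsplit d sel_arg sel_exp Delta m fuel k B).
Proof.
elim: fuel k => [|fuel IH] k /=; first exact: subprob_diverge.
apply: subprob_bind => [|us]; first exact: subprob_sample.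
case: (foldl _ _ _) => [[k' Bs] E].
apply: subprob_bind => [|C]; first exact: subprob_explode_all.
by case: ifP => _; [exact: subprob_ret|exact: IH].
Qed.

Lemma subprob_tree_loop Delta m fuel k Q E :
  subprob (tree_loop d sel_arg sel_exp solve Delta m fuel k Q E).
Proof.
elim: fuel k Q E => [|fuel IH] k [|B Q] E /=; try exact: subprob_ret.
  exact: subprob_diverge.
case: ifP => _; first by case: (solve k B) => [k' E'].
apply: subprob_bind => [|[[k' C] E']]; first exact: subprob_bigsplit.
exact: IH.
Qed.

(** A lower bound for the probability of a given sample of size m from a bag,
    which has n + 1 elements at most. *)
Definition sample_prob (m : nat) : R := (n.+1)%:R^-1 ^+ m.

Lemma sample_prob_itv m : 0 < sample_prob m <= 1.
Proof.
rewrite /sample_prob exprn_gt0 ?invr_gt0 ?ltr0n //= exprn_ile1 ?invr_ge0 ?ler0n //.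
by rewrite invf_le1 ?ltr0n // ler1n.
Qed.

(** A pass fails with probability at most 1 - sample_prob. The fuel n is what
    EXPLODE needs. *)
Lemma bigsplit_mass phi N k p B Delta t : naming lab phi N k ->
  fresh_cell lab D N p -> represents phi B p -> (0 < Delta)%N -> (Delta < bag_size B)%N ->
  1 - (1 - sample_prob Delta) ^+ t <=
    mass (bigsplit d sel_arg sel_exp Delta Delta (n + t) k B).
Proof.
move=> + cell rep D0 DB; elim: t k => [|t IH] k nam.
  rewrite expr0 subrr; apply: mass_ge0; have [h _] := subprob_bigsplit Delta Delta (n + 0) k B.
  exact: h.
have /andP[h0 h1] := sample_prob_itv Delta.
rewrite addnS /=; set F := fun us => _.
have [us0 [uu0 sub0 sz0 good]] := good_sample nam cell rep D0 DB.
have [nonP unon sznon] := bag_nonrepP nam cell rep.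
set L := 1 - (1 - sample_prob Delta) ^+ t in IH.
have p01 : 0 <= 1 - sample_prob Delta <= 1 by apply/andP; split; lra.
have Lt : 0 <= (1 - sample_prob Delta) ^+ t.
  by rewrite exprn_ge0 //; case/andP: p01.
have -> : 1 - (1 - sample_prob Delta) ^+ t.+1 = L + sample_prob Delta * (1 - L).
  by rewrite exprS /L; ring.
have [w0 _] := subprob_sample R Delta (bag_nonrep B).
apply: (mass_bind_hit (a0 := us0) w0 (always_sample R Delta (bag_nonrep B))).
- by apply: mass_sample; rewrite -ltnS sznon.
- by rewrite /L; lra.
- rewrite -sz0; apply: prob_sample => //.
  by rewrite -ltnS sznon (leq_trans (bag_size_bound rep)).
- move=> us [szu sub]; rewrite /F.
  have := one_pass_refines tm dE latent_deg sel_argP sel_expP (n + t) nam cell rep sub.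
  case: (foldl _ _ _) => [[k' Bs] E] [kk' [out tot]].
  case: out tot => [->|]; first by move=> /(_ (leq_addr _ _)).
  move=> [C [Pc [phi' [N' [-> rf sb st]]]]] _; rewrite bind_ret; case: ifP => _.
    by rewrite mass_ret /L; lra.
  by apply: IH; exact: naming_fresh kk' nam.
- move=> [_ sub]; rewrite /F.
  have := one_pass_refines tm dE latent_deg sel_argP sel_expP (n + t) nam cell rep sub.
  case: (foldl _ _ _) => [[k' Bs] E] [kk' [out tot]].
  case: out tot => [->|]; first by move=> /(_ (leq_addr _ _)).
  move=> [C [Pc [phi' [N' [-> rf sb st]]]]] _; rewrite bind_ret.
  have := good _ _ _ _ _ _ rf sb st; rewrite /max_bag_size => ->.
  by rewrite mass_ret.
Qed.

Definition nontrivial (p : cell) := exists2 v, v \in p.2 & v != p.1.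

Definition open_vertices (Ps : seq cell) : nat :=
  #|[set v | has (fun q : cell => (v \in q.2) && (v != q.1)) Ps]%SET|.

(** Cutting does not create inner vertices, and the sampled vertex a stops being
    one: by the overlap condition it is an inner vertex of no other cell. *)
Lemma open_vertices_decrease phi0 N0 k0 p phi N k q Ps Qs E phi' N' k' Rs Cs E' a :
  refines phi0 N0 k0 p phi N k (q :: Ps) Qs E ->
  refines phi N k q phi' N' k' Rs Cs E' ->
  a \in q.2 -> a != q.1 -> settled Rs a ->
  (open_vertices (Ps ++ Rs) < open_vertices (q :: Ps))%N.
Proof.
move=> rf rf' aq aqn st; apply: proper_card; apply/properP; split.
  apply/fintype.subsetP => v; rewrite !inE has_cat /= => /orP[->|/hasP[r rR /andP[vr vn]]].
    by rewrite orbT.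
  have [_ rq rw] := ref_cells rf' rR.
  rewrite (fintype.subsetP rq) //=; apply/orP; left.
  by apply: contra_neq vn => E1; rewrite E1 rw // -E1.
exists a; first by rewrite inE /= aq aqn.
rewrite inE; apply/hasPn => r; rewrite mem_cat => /orP[rP|/st h]; last first.
  by apply/negP => /andP[/h ->]; rewrite eqxx.
apply/negP => /andP[ar _]; have := ref_overlap rf; rewrite /= => /andP[/allP/(_ r rP)].
by move=> /overlapP/(_ a aq ar)[E1 _]; rewrite E1 eqxx in aqn.
Qed.

Variable u0 : 'I_n.
Let root : cell := (lab u0, [set: V]%SET).
Variables (phi0 : V -> node n).
Local Notation state := (refines phi0 W 0 root).

(** With no cell left every edge is listed. A latent vertex has a neighbour,
    hence is the end of a listed edge and has a name. *)
Lemma finished phi N k E : state phi N k [::] [::] E -> recovers e lab E.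
Proof.
move=> rf; have nam := ref_naming rf.
have inT v : v \in root.2 by rewrite inE.
have allN v : v \in N.
  have [vW|vW] := boolP (v \in W); first exact: (fintype.subsetP (nam_sub nam)).
  have [t et _] := third_neighbour latent_deg vW (isT : size [::] <= 2)%N.
  by have [[]|[]] := ref_edges rf et (inT _) (inT _).
exists phi; split.
- by move=> x y; exact: (nam_inj nam).
- exact: nam_lab nam.
move=> a b; split.
  have sd x y : (x, y) \in E -> exists u v, [/\ e u v, phi u = x & phi v = y].
    by move=> /(ref_sound rf)[u [v [euv _ _ [-> ->]]]]; exists u, v.
  move=> [/sd//|/sd[u [v [euv <- <-]]]]; exists v, u; split=> //.
  by rewrite (edge_sym tm).
move=> [u [v [euv <- <-]]].
by have [[]|[]] := ref_edges rf euv (inT _) (inT _).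
Qed.

Lemma solved_state phi N k q Ps B Q E :
  state phi N k (q :: Ps) (B :: Q) E ->
  exists phi' N', refines phi N k q phi' N' (solve k B).1 [::] [::] (solve k B).2 /\
   state phi' N' (solve k B).1 Ps Q (E ++ (solve k B).2).
Proof.
move=> rf; have nam := ref_naming rf.
have [cq _ _] := ref_cells rf (mem_head _ _).
have rep : represents phi B q by have := ref_bags rf; rewrite /= => /andP[/asboolP].
have [phi' [N' rf2]] := solve_refines treeT tm dE latent_deg solveP nam cq rep.
exists phi', N'; split=> //.
exact: (refines_step (P1 := [::]) (Q1 := [::]) erefl rf rf2).
Qed.

(** The pieces of the first cell are placed at the rear of the queue, which is a
    permutation of the cells. *)
Lemma split_state phi N k q Ps B Q E r :
  state phi N k (q :: Ps) (B :: Q) E -> split_outcome phi N k q r ->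
  exists phi' N' Pc, [/\ refines phi N k q phi' N' r.1.1 Pc r.1.2 r.2,
   state phi' N' r.1.1 (Ps ++ Pc) (Q ++ r.1.2) (E ++ r.2),
   forall x, x \in Pc -> single_branch D x &
   exists2 a, (a \in q.2) && (a != q.1) & settled Pc a].
Proof.
move=> rf [phi' [N' [Pc [rf2 sb st]]]]; exists phi', N', Pc; split=> //.
have := refines_step (P1 := [::]) (Q1 := [::]) erefl rf rf2.
rewrite !cat0s; apply: refines_swap; exact: (all2_eq_size (ref_bags rf2)).
Qed.

(** Since the invariant holds at every round, the outcome is right for any
    amount of fuel. *)
Lemma tree_loop_always phi N k Ps Q E Delta fuel : (0 < Delta)%N ->
  state phi N k Ps Q E ->
  always (tree_loop d sel_arg sel_exp solve Delta Delta fuel k Q E) (recovers e lab).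
Proof.
move=> D0; elim: fuel phi N k Ps Q E => [|fuel IH] phi N k [|q Ps] [|B Q] E rf;
  try by have := ref_bags rf.
- by rewrite /always /= andbT; apply/asboolP/(finished rf).
- by rewrite /always /= andbT; apply/asboolP/(finished rf).
rewrite /=; case: ifP => _.
  have [phi' [N' [_]]] := solved_state rf.
  by case: (solve k B) => [k' E'] rf'; exact: IH rf'.
have [cq _ _] := ref_cells rf (mem_head _ _).
have rep : represents phi B q by have := ref_bags rf; rewrite /= => /andP[/asboolP].
apply: always_bind (bigsplit_always _ _ (ref_naming rf) cq rep D0) _ => r ro.
have [phi' [N' [Pc [_ rf' _ _]]]] := split_state rf ro.
by move: rf'; case: (r) => [[k' C] E'] rf'; exact: IH rf'.
Qed.

(** Each round lowers the number of open vertices, so at most mu rounds are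
    left; each of them is given enough fuel to return with probability close to
    one. *)
Lemma tree_loop_mass Delta mu (eps : R) : (0 < Delta)%N -> 0 < eps -> eps < 1 ->
  exists F, forall fuel phi N k Ps Q E, (F <= fuel)%N -> state phi N k Ps Q E ->
    (forall q, q \in Ps -> nontrivial q) -> (open_vertices Ps <= mu)%N ->
    1 - eps <= mass (tree_loop d sel_arg sel_exp solve Delta Delta fuel k Q E).
Proof.
move=> D0; elim: mu eps => [|mu IH] eps e0 e1.
  exists 0%N => fuel phi N k [|q Ps] [|B Q] E _ rf nt mle; try by have := ref_bags rf.
    by case: fuel => [|fuel]; rewrite /= mass_ret; lra.
  have [v vq vn] := nt q (mem_head _ _).
  move: mle; rewrite leqn0 cards_eq0 => /eqP/finset.setP/(_ v).
  by rewrite !inE /= vq vn.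
have [||F1 HF1] := IH (eps / 2); [lra|lra|].
have /andP[h0 h1] := sample_prob_itv Delta.
have [t Ht] : exists t, (1 - sample_prob Delta) ^+ t <= eps / 2.
  have : ((fun t => (1 - sample_prob Delta) ^+ t) @ \oo --> (0 : R))%classic.
    by apply: cvg_expr; rewrite ger0_norm; lra.
  move=> /cvgrPdist_le/(_ (eps / 2))[|t _ Ht]; first by lra.
  exists t; have := Ht t (leqnn _); rewrite /= sub0r normrN ger0_norm //.
  by rewrite exprn_ge0 //; lra.
exists (maxn F1 (n + t)).+1 => fuel phi N k Ps Q E; case: fuel => // fuel.
rewrite ltnS geq_max => /andP[fF1 fnt].
case: Ps Q => [|q Ps] [|B Q] rf nt mle; try by have := ref_bags rf.
  by rewrite /= mass_ret; lra.
have nt' x : x \in Ps -> nontrivial x by move=> xP; apply: nt; rewrite inE xP orbT.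
have [v vq vn] := nt q (mem_head _ _).
rewrite /=; case: ifPn => sz.
  have [phi' [N' [rf2]]] := solved_state rf.
  case: (solve k B) rf2 => [k' E'] rf2 rf'.
  apply: le_trans (_ : 1 - eps / 2 <= _); first by lra.
  apply: HF1 rf' _ _ => //; rewrite -ltnS; apply: leq_trans mle.
  by have := open_vertices_decrease (a := v) rf rf2 vq vn; rewrite cats0; apply.
rewrite -ltnNge in sz.
have [cq _ _] := ref_cells rf (mem_head _ _).
have rep : represents phi B q by have := ref_bags rf; rewrite /= => /andP[/asboolP].
have nam := ref_naming rf.
have [t' Et] : exists t', fuel = (n + t')%N /\ (t <= t')%N.
  by exists (fuel - n)%N; rewrite subnKC ?(leq_trans (leq_addr _ _) fnt) // leq_subRL // (leq_trans (leq_addr _ _) fnt).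
have bm : 1 - eps / 2 <= mass (bigsplit d sel_arg sel_exp Delta Delta fuel k B).
  have [-> tt'] := Et; apply: le_trans (bigsplit_mass t' nam cq rep D0 sz).
  rewrite lerD2l lerN2; apply: le_trans Ht; apply: ler_wiXn2l => //; lra.
have [w0 _] := subprob_bigsplit Delta Delta fuel k B.
apply: le_trans (_ : mass (bigsplit d sel_arg sel_exp Delta Delta fuel k B) * (1 - eps / 2) <= _).
  (* Half of the allowed failure is spent on this split, half on the rest. *)
  apply: le_trans (_ : (1 - eps / 2) * (1 - eps / 2) <= _); last by rewrite ler_wpM2r //; lra.
  have := sqr_ge0 (eps / 2); rewrite expr2; nra.
apply: mass_bind_ge w0 (bigsplit_always _ _ nam cq rep D0) _ => r ro.
have [phi' [N' [Pc [rf2 rf' sb [a /andP[aq aqn] st]]]]] := split_state rf ro.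
have ms := open_vertices_decrease rf rf2 aq aqn st.
move: rf' rf2 ms; case: (r) => [[k' C] E'] rf' rf2 ms; apply: HF1 rf' _ _ => //.
  by move=> x; rewrite mem_cat => /orP[/nt'|/sb[]].
by rewrite -ltnS; apply: leq_trans mle.
Qed.

End Termination.

Local Open Scope classical_set_scope.
Local Open Scope ring_scope.

(** * Convergence of TREE *)

Section Convergence.
Variables (R : realType) (n : nat) (V : finType) (e : rel V) (lab : 'I_n -> V).
Variables (D : V -> V -> R) (d : 'I_n -> 'I_n -> R).
Hypothesis lab_inj : injective lab.
Hypothesis tm : tree_metric e D.
Hypothesis treeT : semi_labeled e [set lab i | i : 'I_n]%SET.
Hypothesis dE : forall i j, i != j -> d i j = D (lab i) (lab j).
Variables sel_arg sel_exp : seq (node n) -> node n.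
Hypothesis sel_argP : selector sel_arg.
Hypothesis sel_expP : selector sel_exp.
Variable solve : nat -> bag R n -> nat * seq (edge n).
Hypothesis solveP : exact_solver d solve.
Variable u : 'I_n.

Let W := [set lab i | i : 'I_n]%SET.
Let W0 : bag R n := Bag [seq inl i | i <- enum 'I_n] (inl u) (fun _ => 0).

(** A tree without edges is a separate case: with Delta = 0 the bag is not
    small, and an empty sample has to be accepted. *)
Lemma TREE_trivial fuel : max_degree e = 0%N ->
  exists2 E, TREE d sel_arg sel_exp solve (max_degree e) u fuel.+2 = ret R E &
             recovers e lab E.
Proof.
move=> D0; have [[_ _ _ ec _] _] := treeT.
have noe x y : e x y = false.
  apply/negP => exy; have : (degree e x <= max_degree e)%N.
    exact: (@leq_bigmax _ (degree e) x).
  rewrite D0 leqn0 /degree => /eqP/card0_eq/(_ y); by rewrite inE exy.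
have one x : x = lab u.
  by have /connectP[[|y p] /=] := ec x (lab u); rewrite ?noe.
exists [::]; last first.
  exists (fun _ => inl u); split.
  - by move=> x y _; rewrite (one x) (one y).
  - by move=> i; congr inl; apply: lab_inj; rewrite (one (lab i)).
  - by move=> a b; split=> [[]//|[x [y []]]]; rewrite noe.
have s1 : bag_size W0 = 1%N.
  rewrite /bag_size size_map size_enum_ord.
  have : (#|'I_n| <= 1)%N.
    by apply/card_le1_eqP => i j _ _; apply: lab_inj; rewrite (one (lab i)) (one (lab j)).
  rewrite card_ord; by case: (n) u => [[]|[|]].
rewrite /TREE D0 /= -/W0 s1 /= bind_ret /=.
have ex : explode d sel_exp fuel W0 = ret R [::] by case: (fuel) => [|f] /=; rewrite s1.
rewrite ex !bind_ret /= big_nil divr_ge0 ?ler0n ?sqrtr_ge0 //.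
by rewrite bind_ret.
Qed.

(** The outcome is right whenever there is one, so its probability is the mass
    of the computation. *)
Theorem TREE_converges :
  (fun fuel : nat =>
     prob_returns (TREE d sel_arg sel_exp solve (max_degree e) u fuel)
                  (recovers e lab)) @ \oo --> (1 : R).
Proof.
have [isT' deg] := treeT; have [_ _ ei _ _] := isT'.
have latent_deg v : (#|[pred u | e v u]| <= 2)%N -> v \in W by exact: deg.
have [D0|D0] := posnP (max_degree e).
  apply/cvgrPdist_le => eps eps0; exists 2%N => // [[|[|fuel]]] //= _.
  have [E -> rE] := TREE_trivial fuel D0.
  by rewrite /prob_returns /ret big_cons big_nil asboolT // addr0 subrr normr0 ltW.
(* Labels only are named at the start. *)
pose phi0 v : node n := if [pick i | lab i == v] is Some i then inl i else inr 0%N.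
have phi0lab i : phi0 (lab i) = inl i.
  rewrite /phi0; case: pickP => [j /eqP/lab_inj->//|/(_ i)]; by rewrite eqxx.
have nam : naming lab phi0 W 0.
  split=> //.
  - move=> x y /imsetP[i _ ->] /imsetP[j _ ->]; by rewrite !phi0lab => -[->].
  - by move=> v ->.
pose root := (lab u, [set: V]%SET).
have cell : fresh_cell lab D W root.
  split=> /=; first by split=> //=.
  - by apply/imsetP; exists u.
  - by [].
have rep : represents lab D phi0 W0 root.
  split=> //=.
  - exists (map lab (enum 'I_n)).
      by rewrite -map_comp; apply: eq_map => i /=; rewrite phi0lab.
    split; first by rewrite map_inj_uniq // enum_uniq.
    move=> v; rewrite inE /= inE /=; apply/mapP/orP => [[i _ ->]|].
      by right; apply/imsetP; exists i.
    by case=> [/eqP->|/imsetP[i _ ->]]; [exists u|exists i]; rewrite ?mem_enum.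
  - by move=> i _ /negP[]; apply/imsetP; exists u.
have rf := refines_id e nam (leqnn 0) cell rep.
have nt : nontrivial root.
  have [v dv] : exists v, (0 < degree e v)%N.
    apply/existsP; apply: contraTT D0 => /existsPn no; rewrite -leqNgt.
    by apply/bigmax_leqP => v _; rewrite leqNgt no.
  have [w] : exists w, w \in [pred w | e v w] by apply/card_gt0P.
  rewrite inE => evw; have vw : v != w by apply: contraTneq evw => ->; rewrite ei.
  have [E|ne] := eqVneq v (lab u); last by exists v.
  by exists w; rewrite //= -E eq_sym.
have ntP q : q \in [:: root] -> nontrivial q by rewrite inE => /eqP->.
apply/cvgrPdist_le => eps eps0.
pose eps' := Num.min eps (1 / 2).
have e'0 : 0 < eps' by rewrite lt_min eps0; lra.
have e'1 : eps' < 1 by rewrite gt_min; apply/orP; right; lra.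
have [F HF] := tree_loop_mass isT' tm dE latent_deg sel_argP sel_expP solveP
   u phi0 (open_vertices [:: root]) D0 e'0 e'1.
exists F => // fuel /= Ffuel.
have al := tree_loop_always isT' tm dE latent_deg sel_argP sel_expP solveP fuel D0 rf.
rewrite /TREE (prob_returns_always al).
have lb := HF fuel _ _ _ _ _ _ Ffuel rf ntP (leqnn _).
have [_ ub] := subprob_tree_loop d sel_arg sel_exp solve (max_degree e) (max_degree e) fuel 0 [:: W0] [::].
have le : eps' <= eps by rewrite ge_min lexx.
by rewrite ger0_norm; lra.
Qed.

End Convergence.

(** * Densities and the Lebesgue measure *)

Section DensitiesAndLebesgue.
Local Open Scope ereal_scope.

Section Density.
Context d (T : measurableType d) (R : realType).
Variables (mu nu : {measure set T -> \bar R}) (w : T -> R).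
Hypothesis mw : measurable_fun setT w.
Hypothesis w0 : forall x, (0 <= w x)%R.
Hypothesis nuE : forall A, measurable A -> nu A = \int[mu]_x (\1_A x * w x)%:E.

Import HBNNSimple.

(** Approximation by simple functions; a density is assumed on measurable sets
    only. *)
Lemma ge0_integral_density (f : T -> \bar R) : measurable_fun [set: T] f ->
  (forall x, 0 <= f x) -> \int[nu]_x f x = \int[mu]_x (f x * (w x)%:E).
Proof.
move=> mf f0; pose h := nnsfun_approx measurableT mf.
have mh k : measurable_fun setT (h k) by exact/measurable_funP.
have -> : \int[nu]_x f x = lim (\int[nu]_x (EFin \o h n) x @[n --> \oo]).
  have fE x : f x = lim ((EFin \o h n) x @[n --> \oo]).
    by apply/esym/cvg_lim => //; exact: cvg_nnsfun_approx.
  under eq_integral => x _ do rewrite fE.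
  apply: monotone_convergence => //.
  - by move=> n; exact/measurable_EFinP.
  - by move=> n x _ //=; rewrite lee_fin.
  - by move=> x _ a b ab; rewrite lee_fin; exact/lefP/nd_nnsfun_approx.
have -> : \int[mu]_x (f x * (w x)%:E) =
    lim (\int[mu]_x ((EFin \o h n) x * (w x)%:E) @[n --> \oo]).
  have fg x : f x * (w x)%:E = lim (((EFin \o h n) x * (w x)%:E) @[n --> \oo]).
    by apply/esym/cvg_lim => //; apply: cvgeZr => //; exact: cvg_nnsfun_approx.
  under eq_integral => x _ do rewrite fg.
  apply: monotone_convergence => //.
  - move=> n; apply/emeasurable_funM; exact/measurable_EFinP.
  - by move=> n x _ /=; rewrite mule_ge0 ?lee_fin.
  - by move=> x _ a b ab/=; rewrite lee_wpmul2r ?lee_fin//; exact/lefP/nd_nnsfun_approx.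
suff suf n : \int[nu]_x (EFin \o h n) x = \int[mu]_x ((EFin \o h n) x * (w x)%:E).
  by under eq_fun do rewrite suf.
have indich r : measurable_fun setT (fun x => (r * \1_(h n @^-1` [set r]) x)%:E).
  by apply/measurable_EFinP; exact: measurable_funM.
transitivity (\int[nu]_x (\sum_(y \in range (h n)) (y * \1_(h n @^-1` [set y]) x)%:E)).
  by apply: eq_integral => t _; rewrite /= fimfunE -fsumEFin.
rewrite ge0_integral_fsum//; last by move=> m y _; exact: nnfun_muleindic_ge0.
transitivity (\int[mu]_x (\sum_(y \in range (h n)) (y * \1_(h n @^-1` [set y]) x)%:E * (w x)%:E));
  last first.
  apply: eq_integral => t _; rewrite [in RHS]/= fimfunE -fsumEFin// ge0_mule_fsuml //.
  by move=> y; exact: nnfun_muleindic_ge0.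
rewrite ge0_integral_fsum//; last 2 first.
- by move=> y; apply/emeasurable_funM => //; exact/measurable_EFinP.
- by move=> y x _; rewrite mule_ge0 ?lee_fin //; exact: nnfun_muleindic_ge0.
apply: eq_fsbigr => r /[!inE] -[t _ <-].
have r0 : (0 <= h n t)%R by [].
set A := h n @^-1` [set h n t].
have mA : measurable A by rewrite -[A]setTI; exact: (mh n).
have mi : measurable_fun [set: T] (\1_A : T -> R) by exact: measurable_indic.
under eq_integral do rewrite EFinM.
rewrite (@ge0_integralZl_EFin _ _ _ nu setT measurableT _ _ _ _ r0) //; last first.
  exact/measurable_EFinP.
rewrite integral_indic // setIT nuE //.
transitivity (\int[mu]_x ((h n t)%:E * (\1_A x * w x)%:E)); last first.
  by apply: eq_integral => x _; rewrite !EFinM muleA.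
rewrite (@ge0_integralZl_EFin _ _ _ mu setT measurableT _ _ _ _ r0) //.
  by move=> x _; rewrite lee_fin mulr_ge0.
by apply/measurable_EFinP; exact: measurable_funM.
Qed.

End Density.

Section Lebesgue1.
Variable R : realType.
Local Notation leb := (@lebesgue_measure R).

Lemma measurable_addr (c : R) : measurable_fun setT (fun x : R => (x + c)%R).
Proof. by apply: measurable_funD. Qed.

Lemma measurable_mulr (a : R) : measurable_fun setT (fun x : R => (a * x)%R).
Proof. by apply: measurable_funM. Qed.

(** The translated measure has the right values on intervals, which determine
    the Lebesgue measure. *)
Lemma lebesgue_shift (c : R) (A : set R) : measurable A ->
  leb ((fun x : R => (x + c)%R) @^-1` A) = leb A.
Proof.
pose f : measurableTypeR R -> measurableTypeR R := fun x : R => (x + c)%R.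
have mf : measurable_fun [set: measurableTypeR R] f := measurable_addr c.
pose F : {mfun measurableTypeR R >-> measurableTypeR R} :=
  HB.pack f (isMeasurableFun.Build _ _ _ _ f mf).
move=> mA; rewrite -[LHS]/(pushforward leb F A).
apply/esym/lebesgue_measure_unique => //= _ [[a b]] _ <-.
rewrite /pushforward /=.
have -> : F @^-1` `]a, b] = `](a - c)%R, (b - c)%R]%classic.
  by apply/seteqP; split=> x /=; rewrite !in_itv /= /f ltrBlDr lerBrDr.
by rewrite !lebesgue_measure_itv /= !lte_fin ltrD2r; case: ifP => // _; rewrite -!EFinB; congr EFin; ring.
Qed.

Lemma lebesgue_scale (a : R) (A : set R) : (0 < a)%R -> measurable A ->
  a%:E * leb ((fun x : R => (a * x)%R) @^-1` A) = leb A.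
Proof.
move=> a0; have a0' : (0 <= a)%R := ltW a0.
pose f : measurableTypeR R -> measurableTypeR R := fun x : R => (a * x)%R.
have mf : measurable_fun [set: measurableTypeR R] f := measurable_mulr a.
pose F : {mfun measurableTypeR R >-> measurableTypeR R} :=
  HB.pack f (isMeasurableFun.Build _ _ _ _ f mf).
have mF : measurable_fun [set: measurableTypeR R] F := mf.
pose m1 : {measure set (measurableTypeR R) -> \bar R} := pushforward leb F.
pose k : {nonneg R} := NngNum a0'.
pose m : {measure set (measurableTypeR R) -> \bar R} := mscale k (m1 mF).
move=> mA; transitivity (m A) => //.
apply/esym/lebesgue_measure_unique => //= _ [[x y]] _ <-.
rewrite /m /= /mscale /m1 /= /pushforward.
have -> : F @^-1` `]x, y] = `](x / a)%R, (y / a)%R]%classic.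
  apply/seteqP; split=> z /=; rewrite !in_itv /= /f ltr_pdivrMr // ler_pdivlMr //;
    by rewrite mulrC.
rewrite !lebesgue_measure_itv /= !lte_fin ltr_pM2r ?invr_gt0 //.
case: ifP => // _; last by rewrite mule0.
by rewrite -!EFinB -EFinM; congr EFin; field; rewrite gt_eqF.
Qed.

Lemma ge0_integral_shift (c : R) (f : R -> \bar R) : measurable_fun [set: R] f ->
  (forall x, 0 <= f x) -> \int[leb]_x f (x + c)%R = \int[leb]_x f x.
Proof.
move=> mf f0.
rewrite -[LHS](@ge0_integral_pushforward _ _ (measurableTypeR R) (measurableTypeR R) R _ (measurable_addr c) leb setT f) //.
by apply: eq_measure_integral => [|mA' A mA _]; [exact: measurable_addr|exact: lebesgue_shift].
Qed.

Lemma ge0_integral_scale (a : R) (f : R -> \bar R) : (a != 0)%R -> measurable_fun [set: R] f ->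
  (forall x, 0 <= f x) -> `|a|%:E * \int[leb]_x f (a * x)%R = \int[leb]_x f x.
Proof.
move=> a0 mf f0.
have pos b (g : R -> \bar R) : (0 < b)%R -> measurable_fun [set: R] g -> (forall x, 0 <= g x) ->
    b%:E * \int[leb]_x g (b * x)%R = \int[leb]_x g x.
  move=> b0 mg g0; have b0' : (0 <= b)%R := ltW b0.
  rewrite -[X in _ * X](@ge0_integral_pushforward _ _ (measurableTypeR R) (measurableTypeR R) R _ (measurable_mulr b) leb setT g) //.
  pose f' : measurableTypeR R -> measurableTypeR R := fun x : R => (b * x)%R.
  have mf' : measurable_fun [set: measurableTypeR R] f' := measurable_mulr b.
  pose F : {mfun measurableTypeR R >-> measurableTypeR R} :=
    HB.pack f' (isMeasurableFun.Build _ _ _ _ f' mf').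
  have mF : measurable_fun [set: measurableTypeR R] F := measurable_mulr b.
  pose m1 : {measure set (measurableTypeR R) -> \bar R} := pushforward leb F.
  pose k : {nonneg R} := NngNum b0'.
  rewrite -[LHS](@ge0_integral_mscale _ _ _ (m1 mF) setT measurableT k) //.
  apply: eq_measure_integral => A mA _ /=; exact: lebesgue_scale.
have [a1|a1] : (0 < a \/ a < 0)%R by move: a0; rewrite neq_lt => /orP[]; auto.
  by rewrite gtr0_norm //; exact: pos.
rewrite ltr0_norm // -[RHS](pos (- a)%R) ?oppr_gt0 //; congr (_ * _).
have mN : measurable_fun [set: R] (fun x : R => f (a * x)%R).
  by apply: (measurableT_comp mf); exact: measurable_mulr.
have mo : measurable_fun [set: R] (-%R : R -> R) by exact: oppr_measurable.
transitivity (\int[leb]_x f (a * - x)%R).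
  rewrite -[RHS](@ge0_integral_pushforward _ _ (measurableTypeR R) (measurableTypeR R) R _ mo leb setT (fun x => f (a * x)%R)) //.
  by apply: eq_measure_integral => A mA _; exact/esym/lebesgue_measureN.
by apply: eq_integral => x _; rewrite mulrN mulNr.
Qed.

End Lebesgue1.

End DensitiesAndLebesgue.

(** * Iterated integrals over tuples *)

Section IntegralsOverTuples.
Local Open Scope ereal_scope.

Lemma comp_measurable d1 d2 d3 (T1 : measurableType d1) (T2 : measurableType d2)
  (T3 : measurableType d3) (f : T2 -> T3) (g : T1 -> T2) :
  measurable_fun [set: T2] f -> measurable_fun [set: T1] g ->
  measurable_fun [set: T1] (fun x => f (g x)).
Proof. exact: measurableT_comp. Qed.

Section TupleIntegral.
Variable R : realType.
Local Notation leb := (@lebesgue_measure R).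
Local Notation lti := lebesgue_tuple_integral.

Lemma lti_ge0 n (g : n.-tuple R -> \bar R) : (forall t, 0 <= g t) -> 0 <= lti g.
Proof.
elim: n g => [|n IH] g g0 /=; first exact: g0.
by apply: integral_ge0 => x _; exact: IH.
Qed.

Lemma lti_ext n (g h : n.-tuple R -> \bar R) : (forall t, g t = h t) -> lti g = lti h.
Proof. by move=> gh; congr lti; apply/funext. Qed.

Lemma measurable_cons_tuple n d (T : measurableType d) (f : T -> R) (g : T -> n.-tuple R) :
  measurable_fun [set: T] f -> measurable_fun [set: T] g ->
  measurable_fun [set: T] (fun x => cons_tuple (f x) (g x)).
Proof. exact: measurable_cons. Qed.

Lemma measurable_lti n d (T : measurableType d) (g : T -> n.-tuple R -> \bar R) :
  measurable_fun [set: T * n.-tuple R] (fun p => g p.1 p.2) ->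
  (forall p t, 0 <= g p t) -> measurable_fun [set: T] (fun p => lti (g p)).
Proof.
elim: n d T g => [|n IH] d T g mg g0 /=.
  apply: (comp_measurable mg (g := fun p => (p, [tuple]))).
  by apply: measurable_fun_pair => //; exact: measurable_cst.
pose F (q : T * measurableTypeR R) := lti (fun t => g q.1 (cons_tuple (q.2 : R) t)).
have mF : measurable_fun [set: T * measurableTypeR R] F.
  apply: (IH _ (T * measurableTypeR R)%type (fun q t => g q.1 (cons_tuple (q.2 : R) t))) => //.
  apply: (comp_measurable mg (g := fun p : (T * measurableTypeR R) * n.-tuple R =>
    (p.1.1, cons_tuple (p.1.2 : R) p.2))).
  apply: measurable_fun_pair; first exact: (measurableT_comp measurable_fst).
  apply: measurable_cons_tuple => //.
  exact: (measurableT_comp measurable_snd).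
have F0 q : 0 <= F q by apply: lti_ge0 => t.
exact: (@measurable_fun_fubini_tonelli_F _ _ T (measurableTypeR R) R leb F mF F0).
Qed.

Lemma measurable_lti_head n (g : n.+1.-tuple R -> \bar R) : measurable_fun [set: n.+1.-tuple R] g ->
  (forall t, 0 <= g t) ->
  measurable_fun [set: R] (fun x => lti (fun t => g (cons_tuple x t))).
Proof.
move=> mg g0; apply: measurable_lti => //.
apply: (comp_measurable mg (g := fun p : R * n.-tuple R => cons_tuple p.1 p.2)).
exact: measurable_cons_tuple.
Qed.

Lemma measurable_cons_section n (g : n.+1.-tuple R -> \bar R) x :
  measurable_fun [set: n.+1.-tuple R] g ->
  measurable_fun [set: n.-tuple R] (fun t => g (cons_tuple x t)).
Proof.
move=> mg; apply: (comp_measurable mg (g := fun t => cons_tuple x t)).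
by apply: measurable_cons_tuple => //; exact: measurable_cst.
Qed.

Lemma ltiD n (g h : n.-tuple R -> \bar R) :
  measurable_fun [set: n.-tuple R] g -> measurable_fun [set: n.-tuple R] h ->
  (forall t, 0 <= g t) -> (forall t, 0 <= h t) ->
  lti (fun t => g t + h t) = lti g + lti h.
Proof.
elim: n g h => [//|n IH] g h mg mh g0 h0 /=.
rewrite -ge0_integralD //; first last.
- exact: measurable_lti_head.
- by move=> x _; exact: lti_ge0.
- exact: measurable_lti_head.
- by move=> x _; exact: lti_ge0.
apply: eq_integral => x _; apply: IH => //; exact: measurable_cons_section.
Qed.

Lemma ltiZ n (k : \bar R) (g : n.-tuple R -> \bar R) :
  measurable_fun [set: n.-tuple R] g -> (forall t, 0 <= g t) -> 0 <= k ->
  lti (fun t => k * g t) = k * lti g.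
Proof.
elim: n g => [//|n IH] g mg g0 k0 /=.
rewrite -ge0_integralZl //; first last.
- by move=> x _; exact: lti_ge0.
- exact: measurable_lti_head.
apply: eq_integral => x _; apply: IH => //; exact: measurable_cons_section.
Qed.

Definition tuple_shift n (c t : n.-tuple R) : n.-tuple R :=
  [tuple (tnth t i + tnth c i)%R | i < n].

Lemma measurable_tuple_shift n (c : n.-tuple R) :
  measurable_fun [set: n.-tuple R] (tuple_shift c).
Proof.
apply/measurable_fun_tnthP => i.
rewrite (_ : _ \o _ = fun t => (tnth t i + tnth c i)%R); last first.
  by apply/funext => t /=; rewrite tnth_mktuple.
apply: measurable_funD; [exact: measurable_tnth | exact: measurable_cst].
Qed.

Lemma lti_shift n (c : n.-tuple R) (g : n.-tuple R -> \bar R) :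
  measurable_fun [set: n.-tuple R] g -> (forall t, 0 <= g t) ->
  lti (fun t => g (tuple_shift c t)) = lti g.
Proof.
elim: n c g => [|n IH] c g mg g0; first by rewrite /= [tuple_shift _ _]tuple0.
rewrite /= -[RHS](ge0_integral_shift (thead c)); first last.
- by move=> x; exact: lti_ge0.
- exact: measurable_lti_head.
apply: eq_integral => x _.
rewrite -[RHS](IH [tuple of behead c]) //; last exact: measurable_cons_section.
apply: lti_ext => t; congr g; apply: eq_from_tnth => i.
rewrite tnth_mktuple; case: (unliftP ord0 i) => [j ->|->].
  by rewrite !tnthS tnth_mktuple tnth_behead; congr (_ + tnth c _)%R; apply: val_inj; rewrite /= inordK ?ltnS // ltn_ord.
by rewrite !tnth0.
Qed.

(** The iterated integral of a nonnegative function vanishes only with the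
    function almost everywhere, coordinate by coordinate. *)
Lemma lti_eq0 n (g h : n.-tuple R -> \bar R) :
  measurable_fun [set: n.-tuple R] g -> measurable_fun [set: n.-tuple R] h ->
  (forall t, 0 <= g t) -> (forall t, 0 <= h t) ->
  (forall t, g t = 0 -> h t = 0) -> lti g = 0 -> lti h = 0.
Proof.
elim: n g h => [|n IH] g h mg mh g0 h0 gh /=; first exact: gh.
have mG := measurable_lti_head mg g0; have mH := measurable_lti_head mh h0.
set G := fun x => lti (fun t => g (cons_tuple x t)) in mG *.
set H := fun x => lti (fun t => h (cons_tuple x t)) in mH *.
have G0 x : 0 <= G x by apply: lti_ge0.
have H0 x : 0 <= H x by apply: lti_ge0.
move=> iG.
have aeG : ae_eq leb setT G (cst 0).
  apply: (proj1 (@ae_eq_integral_abs _ (measurableTypeR R) R leb setT measurableT G mG)).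
  by rewrite -[RHS]iG; apply: eq_integral => x _; rewrite gee0_abs.
transitivity (\int[leb]_x cst (0 : \bar R) x); last exact: integral0.
apply: ge0_ae_eq_integral => //; first by move=> x _; exact: H0.
case: aeG => M [mM M0 sub]; exists M; split=> // x /= nH; apply: sub => /= Gx.
apply: nH => _; apply: (IH (fun t => g (cons_tuple x t))) => //; try exact: measurable_cons_section.
  by move=> t; exact: gh.
exact: Gx.
Qed.

(** By Tonelli, one coordinate can be integrated first, wherever it sits in the
    tuple; ins inserts it. *)
Lemma lti_split n (a : 'I_n) : exists m (ins : R -> m.-tuple R -> n.-tuple R),
  [/\ forall x t, tnth (ins x t) a = x,
      forall c, c != a -> exists c', forall x t, tnth (ins x t) c = tnth t c',
      forall z, exists t, z = ins (tnth z a) t,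
      measurable_fun [set: R * m.-tuple R] (fun p => ins p.1 p.2) &
      forall g : n.-tuple R -> \bar R, measurable_fun [set: n.-tuple R] g ->
        (forall t, 0 <= g t) -> lti g = \int[leb]_x lti (fun t => g (ins x t))].
Proof.
elim: n a => [[]//|n IH] a; case: (unliftP ord0 a) => [a'|] ->; last first.
  exists n, (fun x t => cons_tuple x t); split=> //.
  - move=> c; case: (unliftP ord0 c) => [c' ->|->]; last by rewrite eqxx.
    by move=> _; exists c' => x t; exact: tnthS.
  - move=> z; exists [tuple of behead z]; apply: val_inj => /=.
    by rewrite [in LHS](tuple_eta z).
  - exact: measurable_cons_tuple.
have [m [ins [h1 h2 h3 h4 h5]]] := IH a'.
pose ins' x (t : m.+1.-tuple R) := cons_tuple (thead t) (ins x [tuple of behead t]).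
have mb : measurable_fun [set: m.+1.-tuple R] (fun t => [tuple of behead t] : m.-tuple R).
  exact: measurable_behead.
have mh : measurable_fun [set: m.+1.-tuple R] (fun t : m.+1.-tuple R => thead t).
  exact: measurable_tnth.
have mins' : measurable_fun [set: R * m.+1.-tuple R] (fun p => ins' p.1 p.2).
  apply: measurable_cons_tuple; first exact: (measurableT_comp mh).
  apply: (comp_measurable h4 (g := fun p : R * m.+1.-tuple R => (p.1, [tuple of behead p.2]))).
  apply: measurable_fun_pair => //; exact: (measurableT_comp mb).
exists m.+1, ins'; split=> //.
- by move=> x t; rewrite /ins' tnthS.
- move=> c; case: (unliftP ord0 c) => [c' ->|->] ca.
    have [|c'' hc] := h2 c'; first by apply: contra_neq ca => ->.
    exists (lift ord0 c'') => x t; rewrite /ins' tnthS hc tnth_behead.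
    by congr tnth; apply: val_inj; rewrite /= inordK ?ltnS // ltn_ord.
  by exists ord0 => x t; rewrite /ins' tnth0.
- move=> z; have [t ht] := h3 [tuple of behead z].
  exists (cons_tuple (thead z) t); rewrite /ins' theadE.
  have -> : [tuple of behead (cons_tuple (thead z) t)] = t by exact: val_inj.
  have -> : tnth z (lift ord0 a') = tnth [tuple of behead z] a'.
    by rewrite tnth_behead; congr tnth; apply: val_inj; rewrite /= inordK ?ltnS // ltn_ord.
  by rewrite -ht; apply: val_inj; rewrite [in LHS](tuple_eta z).
- move=> g mg g0 /=.
  transitivity (\int[leb]_x1 \int[leb]_x lti (fun t => g (cons_tuple x1 (ins x t)))).
    apply: eq_integral => x1 _; apply: h5 => //; exact: measurable_cons_section.
  pose F (q : measurableTypeR R * measurableTypeR R) :=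
    lti (fun t => g (cons_tuple (q.1 : R) (ins (q.2 : R) t))).
  have mF : measurable_fun [set: measurableTypeR R * measurableTypeR R] F.
    apply: (@measurable_lti _ _ (measurableTypeR R * measurableTypeR R)%type
      (fun q t => g (cons_tuple (q.1 : R) (ins (q.2 : R) t)))) => //.
    apply: (comp_measurable mg (g := fun p : (measurableTypeR R * measurableTypeR R) * m.-tuple R =>
      cons_tuple (p.1.1 : R) (ins (p.1.2 : R) p.2))).
    apply: measurable_cons_tuple; first exact: (measurableT_comp measurable_fst).
    apply: (comp_measurable h4 (g := fun p : (measurableTypeR R * measurableTypeR R) * m.-tuple R =>
      ((p.1.2 : R), p.2))).
    apply: measurable_fun_pair => //; exact: (measurableT_comp measurable_snd).
  have F0 q : 0 <= F q by apply: lti_ge0.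
  rewrite (@fubini_tonelli _ _ _ _ R leb leb F mF F0).
  apply: eq_integral => x _; apply: eq_integral => x1 _; apply: lti_ext => t.
  rewrite /ins' theadE; congr (g (cons_tuple _ (ins _ _))); exact: val_inj.
Qed.

End TupleIntegral.

End IntegralsOverTuples.

(** * Positive definite forms *)

Section PositiveDefinite.
Variables (R : realType) (n : nat) (Sigma : 'M[R]_n).
Hypothesis pd : positive_definite Sigma.
Let K := invmx Sigma.

Definition bform (M : 'M[R]_n) (x y : 'rV[R]_n) : R := (x *m M *m y^T) 0 0.

Lemma bformDl M x y z : bform M (x + y) z = bform M x z + bform M y z.
Proof. by rewrite /bform !mulmxDl mxE. Qed.

Lemma bformDr M x y z : bform M z (x + y) = bform M z x + bform M z y.
Proof. by rewrite /bform linearD /= mulmxDr mxE. Qed.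

Lemma bformZl M a x y : bform M (a *: x) y = a * bform M x y.
Proof. by rewrite /bform -!scalemxAl mxE. Qed.

Lemma bform_delta M i j : bform M (delta_mx 0 i) (delta_mx 0 j) = M i j.
Proof. by rewrite /bform -rowE trmx_delta -colE !mxE. Qed.

Lemma pd_sym i j : Sigma i j = Sigma j i.
Proof. by case: pd => E _; rewrite -[in LHS]E mxE. Qed.

Lemma pd_unit : Sigma \in unitmx.
Proof.
rewrite unitmxE unitfE; apply/negP => /det0P[x x0 xS].
by case: pd => _ /(_ x x0); rewrite xS mul0mx mxE ltxx.
Qed.

Lemma inv_sym : K^T = K.
Proof. by rewrite /K trmx_inv; case: pd => ->. Qed.

Lemma bform_sym x y : bform K x y = bform K y x.
Proof.
have E : (x *m K *m y^T)^T = y *m K *m x^T by rewrite !trmx_mul trmxK inv_sym mulmxA.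
by rewrite /bform -E [RHS]mxE.
Qed.

Lemma bform_inv_gt0 x : x != 0 -> 0 < bform K x x.
Proof.
move=> x0; pose y := x *m K.
have xy : x = y *m Sigma by rewrite /y mulmxKV // pd_unit.
have y0 : y != 0 by apply: contra_neq x0 => E; rewrite xy E mul0mx.
case: pd => Es /(_ y y0); rewrite /bform -/y xy => h.
by rewrite trmx_mul Es mulmxA.
Qed.

(** Evaluate the form at S_jj e_i - S_ij e_j. *)
Lemma pd_minor i j : i != j -> 0 < Sigma i i * Sigma j j - Sigma i j ^+ 2.
Proof.
move=> ij; have dg k : 0 < Sigma k k.
  have k0 : delta_mx 0 k != 0 :> 'rV[R]_n.
    apply/eqP => /matrixP/(_ 0 k); rewrite !mxE !eqxx /= => /eqP; by rewrite oner_eq0.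
  by case: pd => _ /(_ _ k0); rewrite -/(bform _ _ _) bform_delta.
pose x := Sigma j j *: delta_mx 0 i - Sigma i j *: delta_mx 0 j : 'rV[R]_n.
have x0 : x != 0.
  apply/eqP => /matrixP/(_ 0 i); rewrite !mxE !eqxx /= (negbTE ij) mulr0 subr0 mulr1.
  by move=> E; have := dg j; rewrite E ltxx.
case: pd => _ /(_ _ x0); rewrite -/(bform _ _ _) /x.
rewrite -scaleNr bformDl !bformDr !bformZl.
have bZr a u v : bform Sigma u (a *: v) = a * bform Sigma u v.
  by rewrite /bform linearZ /= -scalemxAr mxE.
rewrite !bZr !bform_delta (pd_sym j i) => h.
rewrite -(pmulr_rgt0 _ (dg j)); move: h; congr (0 < _); ring.
Qed.

Lemma pd_diag i : 0 < Sigma i i.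
Proof.
have k0 : delta_mx 0 i != 0 :> 'rV[R]_n.
  apply/eqP => /matrixP/(_ 0 i); rewrite !mxE !eqxx /= => /eqP; by rewrite oner_eq0.
by case: pd => _ /(_ _ k0); rewrite -/(bform _ _ _) bform_delta.
Qed.

(** The vector z is the conditional mean given the coordinates i and j. As a
    combination of two rows of the covariance matrix, it is orthogonal for the
    inverse form to every vector that vanishes at i and j, so the square splits. *)
Lemma pair_conditional_square i j (x y : R) (del : 'rV[R]_n) : i != j ->
  del 0 i = 0 -> del 0 j = 0 ->
  let dt := Sigma i i * Sigma j j - Sigma i j ^+ 2 in
  let p := (Sigma j j * x - Sigma i j * y) / dt in
  let r := (Sigma i i * y - Sigma i j * x) / dt in
  let z := p *: row i Sigma + r *: row j Sigma in
  [/\ z 0 i = x, z 0 j = y &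
   bform K (z + del) (z + del) = p * x + r * y + bform K del del].
Proof.
move=> ij di dj dt p r z; have dt0 : dt != 0 by rewrite gt_eqF // pd_minor.
have zi : z 0 i = x.
  by rewrite !mxE /p /r (pd_sym j i) /dt; field; rewrite /dt in dt0.
have zj : z 0 j = y.
  by rewrite !mxE /p /r /dt; field; rewrite /dt in dt0.
split=> //.
have zK : z *m K = p *: delta_mx 0 i + r *: delta_mx 0 j.
  by rewrite mulmxDl -!scalemxAl -!row_mul mulmxV ?pd_unit // !row1.
have bz (v : 'rV[R]_n) : bform K z v = p * v 0 i + r * v 0 j.
  by rewrite /bform zK mulmxDl -!scalemxAl -!rowE !mxE.
clearbody z. rewrite bformDl !bformDr (bform_sym del z) !bz zi zj di dj; ring.
Qed.

End PositiveDefinite.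

(** * Marginals of a Gaussian density *)

Section GaussianDensity.
Variables (R : realType) (n : nat) (mu : 'rV[R]_n) (Sigma : 'M[R]_n).
Hypothesis pd : positive_definite Sigma.
Let K := invmx Sigma.
Local Notation leb := (@lebesgue_measure R).
Local Notation lti := lebesgue_tuple_integral.

Definition rowt (z : n.-tuple R) : 'rV[R]_n := \row_i tnth z i.
Definition peak : R := (Num.sqrt ((2 * pi) ^+ n * \det Sigma))^-1.

Lemma peak_ge0 : 0 <= peak. Proof. by rewrite invr_ge0 sqrtr_ge0. Qed.

Lemma gaussian_pdfE z :
  gaussian_pdf mu Sigma z = peak * expR (- bform K (rowt z - mu) (rowt z - mu) / 2).
Proof. by []. Qed.

Lemma gaussian_pdf_ge0 z : 0 <= gaussian_pdf mu Sigma z.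
Proof. by rewrite gaussian_pdfE mulr_ge0 ?peak_ge0 ?expR_ge0. Qed.

Lemma measurable_bform (c : 'rV[R]_n) :
  measurable_fun [set: n.-tuple R] (fun z => bform K (rowt z - c) (rowt z - c)).
Proof.
rewrite (_ : (fun z => _) = fun z => \sum_j (\sum_i (tnth z i - c 0 i) * K i j) * (tnth z j - c 0 j)).
  apply: measurable_sum => j; apply: measurable_funM.
    apply: measurable_sum => i; apply: measurable_funM => //.
    by apply: measurable_funB => //; exact: measurable_tnth.
  by apply: measurable_funB => //; exact: measurable_tnth.
apply/funext => z; rewrite /bform mxE; apply: eq_bigr => j _; rewrite !mxE; congr (_ * _).
by apply: eq_bigr => i _; rewrite !mxE.
Qed.

Lemma measurable_gauss (c : 'rV[R]_n) :
  measurable_fun [set: n.-tuple R] (fun z => expR (- bform K (rowt z - c) (rowt z - c) / 2)).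
Proof.
apply: (comp_measurable (f := @expR R)); first exact: measurable_expR.
apply: measurable_funM => //; apply: measurableT_comp => //; exact: measurable_bform.
Qed.

Lemma measurable_gaussian_pdf : measurable_fun [set: n.-tuple R] (gaussian_pdf mu Sigma).
Proof. by apply: measurable_funM => //; exact: measurable_gauss. Qed.

(** The ratio of the two products is the exponential of a mixed second
    difference of the quadratic exponent. *)
Lemma gaussian_exchange z (a b : n.-tuple R) : 0 < peak ->
  gaussian_pdf mu Sigma (tuple_shift b (tuple_shift a z)) * gaussian_pdf mu Sigma z =
  gaussian_pdf mu Sigma (tuple_shift a z) * gaussian_pdf mu Sigma (tuple_shift b z) ->
  bform K (rowt a) (rowt b) = 0.
Proof.
move=> c0; rewrite !gaussian_pdfE.
have sh c t : rowt (tuple_shift c t) = rowt t + rowt c.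
  by apply/rowP => i; rewrite !mxE tnth_mktuple.
rewrite !sh; set y := rowt z - mu.
have -> : rowt z + rowt a + rowt b - mu = y + rowt a + rowt b.
  by rewrite /y; apply/rowP => i; rewrite !mxE; ring.
have -> : rowt z + rowt a - mu = y + rowt a.
  by rewrite /y; apply/rowP => i; rewrite !mxE; ring.
have -> : rowt z + rowt b - mu = y + rowt b.
  by rewrite /y; apply/rowP => i; rewrite !mxE; ring.
clearbody y; rewrite mulrACA [RHS]mulrACA -!expRD.
move=> /mulfI; rewrite mulf_eq0 gt_eqF //= => /(_ isT) /expR_inj.
rewrite !bformDl !bformDr (bform_sym pd (rowt b) (rowt a)) (bform_sym pd (rowt a) y)
  (bform_sym pd (rowt b) y); lra.
Qed.

Section Pair.
Variables (i j : 'I_n).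
Hypothesis ij : i != j.

Let dt := Sigma i i * Sigma j j - Sigma i j ^+ 2.
(** The inverse of the covariance matrix of the pair, written out. *)
Definition pair_form (x y : R) : R :=
  (Sigma j j * x - Sigma i j * y) / dt * x + (Sigma i i * y - Sigma i j * x) / dt * y.

(** Integrate the other coordinates first: after the shift by the conditional
    mean, their integral does not depend on x and y any more, and becomes the
    constant kappa. *)
Lemma gaussian_marginal : exists2 kappa : \bar R, (0 <= kappa)%E &
  forall h : R * R -> \bar R, measurable_fun [set: R * R] h -> (forall q, 0 <= h q)%E ->
   lti (fun z => h (tnth z i, tnth z j) * (gaussian_pdf mu Sigma z)%:E)%E =
   (\int[leb]_x \int[leb]_y
     (kappa * (h (x, y) * (expR (- pair_form (x - mu 0 i) (y - mu 0 j) / 2))%:E)))%E.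
Proof.
have [m1 [ins1 [a1 a2 a3 a4 a5]]] := lti_split R i.
have ji : j != i by rewrite eq_sym.
have [j' aj] := a2 j ji.
have [m2 [ins2 [b1 b2 b3 b4 b5]]] := lti_split R j'.
pose mg x y s := ins1 x (ins2 y s).
have mgi x y s : tnth (mg x y s) i = x by rewrite /mg a1.
have mgj x y s : tnth (mg x y s) j = y by rewrite /mg aj b1.
have mgc c : c != i -> c != j -> exists c', forall x y s, tnth (mg x y s) c = tnth s c'.
  move=> ci cj; have [c1 h1] := a2 c ci.
  have [c1j|c1j] := eqVneq c1 j'.
    (* two coordinates of a tuple cannot always agree *)
    exfalso; pose t0 : n.-tuple R := [tuple (if k == c then 1 else 0) | k < n].
    have [t Et] := a3 t0; have E1 := h1 (tnth t0 i) t; have E2 := aj (tnth t0 i) t.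
    rewrite -Et in E1; rewrite -Et in E2; move: E1.
    rewrite c1j -E2 /t0 !tnth_mktuple eqxx [j == c]eq_sym (negbTE cj) => /eqP.
    by rewrite oner_eq0.
  have [c2 h2] := b2 c1 c1j; exists c2 => x y s; by rewrite /mg h1 h2.
have mgs z : exists s, z = mg (tnth z i) (tnth z j) s.
  have [t Et] := a3 z; have [s Es] := b3 t; exists s.
  have E : tnth z j = tnth t j' by rewrite [in LHS]Et aj.
  by rewrite /mg E -Es -Et.
have mmg d (T : measurableType d) (f g : T -> R) (s : T -> m2.-tuple R) :
    measurable_fun [set: T] f -> measurable_fun [set: T] g -> measurable_fun [set: T] s ->
    measurable_fun [set: T] (fun q => mg (f q) (g q) (s q)).
  move=> mf mg' ms.
  apply: (comp_measurable a4 (g := fun q => (f q, ins2 (g q) (s q)))).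
  apply: measurable_fun_pair => //.
  apply: (comp_measurable b4 (g := fun q => (g q, s q))); exact: measurable_fun_pair.
pose G s : R := peak * expR (- bform K (rowt (mg 0 0 s) - 0) (rowt (mg 0 0 s) - 0) / 2).
have G0 s : 0 <= G s by rewrite mulr_ge0 ?peak_ge0 ?expR_ge0.
have mG : measurable_fun [set: m2.-tuple R] G.
  apply: measurable_funM => //.
  apply: (comp_measurable (measurable_gauss 0) (g := fun s => mg 0 0 s)).
  by apply: mmg => //; exact: measurable_cst.
pose zz x y := (Sigma j j * x - Sigma i j * y) / dt *: row i Sigma +
               (Sigma i i * y - Sigma i j * x) / dt *: row j Sigma.
have key x y s0 s : rowt (mg x y s0) = mu + zz (x - mu 0 i) (y - mu 0 j) ->
    gaussian_pdf mu Sigma (mg x y s) =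
    expR (- pair_form (x - mu 0 i) (y - mu 0 j) / 2) *
    G (tuple_shift [tuple - tnth s0 k | k < m2] s).
  move=> H; rewrite gaussian_pdfE /G subr0.
  set del := rowt (mg 0 0 _).
  have di : del 0 i = 0 by rewrite mxE mgi.
  have dj : del 0 j = 0 by rewrite mxE mgj.
  have [_ _ sq] := pair_conditional_square pd (x - mu 0 i) (y - mu 0 j) ij di dj.
  have -> : rowt (mg x y s) - mu = zz (x - mu 0 i) (y - mu 0 j) + del.
    suff -> : rowt (mg x y s) = rowt (mg x y s0) + del.
      by rewrite H addrAC [mu + _]addrC addrK.
    apply/rowP => c; rewrite !mxE.
    have EB : tnth (mg 0 0 (tuple_shift [tuple - tnth s0 k  | k < m2] s)) c = del 0 c.
      by rewrite /del mxE.
    rewrite {}EB.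
    have [->|ci] := eqVneq c i; first by rewrite di !mgi addr0.
    have [->|cj] := eqVneq c j; first by rewrite dj !mgj addr0.
    have [c' hc] := mgc c ci cj; rewrite /del mxE !hc !tnth_mktuple; ring.
  by rewrite sq /pair_form -/dt mulrCA -expRD -mulrDl -opprD.
have inner x y : lti (fun s => (gaussian_pdf mu Sigma (mg x y s))%:E) =
    ((expR (- pair_form (x - mu 0 i) (y - mu 0 j) / 2))%:E * lti (fun s => (G s)%:E))%E.
  pose z0 := zz (x - mu 0 i) (y - mu 0 j).
  pose t0 : n.-tuple R := [tuple (mu + z0) 0 c | c < n].
  have [zi zj _] := pair_conditional_square pd (x - mu 0 i) (y - mu 0 j) ij
    (mxE _ (fun _ _ => 0) 0 i : (0 : 'rV[R]_n) 0 i = 0) (mxE _ (fun _ _ => 0) 0 j : (0 : 'rV[R]_n) 0 j = 0).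
  have [s0 Es0] := mgs t0.
  have t0i : tnth t0 i = x by rewrite tnth_mktuple mxE zi addrC subrK.
  have t0j : tnth t0 j = y by rewrite tnth_mktuple mxE zj addrC subrK.
  have H : rowt (mg x y s0) = mu + z0.
    by rewrite -t0i -t0j -Es0; apply/rowP => c; rewrite mxE tnth_mktuple.
  rewrite -(lti_shift [tuple - tnth s0 k | k < m2] (g := fun s => (G s)%:E)); first last.
  - by move=> s; rewrite lee_fin.
  - exact/measurable_EFinP.
  rewrite -ltiZ.
  - by apply: lti_ext => s; rewrite (key _ _ _ _ H) EFinM.
  - apply/measurable_EFinP; apply: (comp_measurable mG); exact: measurable_tuple_shift.
  - by move=> s; rewrite lee_fin.
  - by rewrite lee_fin expR_ge0.
exists (lti (fun s => (G s)%:E)); first by apply: lti_ge0 => s; rewrite lee_fin.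
move=> h mh h0.
have mpdf : measurable_fun [set: n.-tuple R] (fun z => (gaussian_pdf mu Sigma z)%:E).
  apply/measurable_EFinP; exact: measurable_gaussian_pdf.
have p0 z : (0 <= (gaussian_pdf mu Sigma z)%:E)%E by rewrite lee_fin gaussian_pdf_ge0.
have mF : measurable_fun [set: n.-tuple R]
    (fun z => h (tnth z i, tnth z j) * (gaussian_pdf mu Sigma z)%:E)%E.
  apply: emeasurable_funM => //.
  apply: (comp_measurable mh (g := fun z => (tnth z i, tnth z j))).
  by apply: measurable_fun_pair; exact: measurable_tnth.
have F0 z : (0 <= h (tnth z i, tnth z j) * (gaussian_pdf mu Sigma z)%:E)%E by rewrite mule_ge0.
rewrite a5 //; apply: eq_integral => x _.
have msec : measurable_fun [set: m1.-tuple R] (fun t => ins1 x t).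
  apply: (comp_measurable a4 (g := fun t => (x, t))).
  by apply: measurable_fun_pair => //; exact: measurable_cst.
rewrite b5 //; last exact: (comp_measurable mF).
apply: eq_integral => y _.
under lti_ext => s do rewrite -/(mg x y s) mgi mgj.
rewrite ltiZ //; last first.
  apply: (comp_measurable mpdf); apply: mmg => //; exact: measurable_cst.
by rewrite inner muleA muleC.
Qed.

End Pair.
End GaussianDensity.

(** * The precision matrix of a graphical model *)

Section Densities.
Variables (R : realType) (disp : measure_display) (Omega : measurableType disp).
Variables (P : probability Omega R) (V : finType) (Z : V -> {RV P >-> R}).
Local Notation leb := (@lebesgue_measure R).
Local Notation lti := lebesgue_tuple_integral.
Implicit Types f g : #|V|.-tuple R -> R.

Lemma density_total f : has_density Z f -> lti (fun z => (f z)%:E) = 1%E.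
Proof.
move=> [_ _ /(_ setT measurableT)]; rewrite preimage_setT probability_setT => E.
by rewrite [RHS]E; apply: lti_ext => z; rewrite indicT mul1r.
Qed.

Lemma measurable_lt_set f g : measurable_fun [set: #|V|.-tuple R] f ->
  measurable_fun [set: #|V|.-tuple R] g -> measurable [set z | f z < g z].
Proof.
move=> mf mg; rewrite (_ : [set z | _] = (fun z => g z - f z) @^-1` `]0, +oo[%classic); last first.
  by apply/seteqP; split=> z /=; rewrite in_itv /= andbT subr_gt0.
by rewrite -[X in measurable X]setTI; apply: measurable_funB.
Qed.

(** Two densities of the same vector agree almost everywhere: over the set where
    f < g, the integrals of f and g agree. *)
Lemma density_lt_null f g : has_density Z f -> has_density Z g ->
  lti (fun z => (\1_[set z | f z < g z] z : R)%:E) = 0%E.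
Proof.
move=> [mf f0 df] [mg g0 dg]; set A := [set z | _].
have mA : measurable A by exact: measurable_lt_set.
have m1 : measurable_fun [set: #|V|.-tuple R] (\1_A : _ -> R) by exact: measurable_indic.
pose h z := ((\1_A z : R) * (g z - f z))%R.
have h0 z : 0 <= h z.
  rewrite /h indicE; case: (boolP (z \in A)) => [|_]; last by rewrite mul0r.
  by rewrite inE /A /= mul1r subr_ge0 => /ltW.
have mh : measurable_fun [set: #|V|.-tuple R] h.
  by apply: measurable_funM => //; exact: measurable_funB.
have E : P (random_vector Z @^-1` A) =
    (P (random_vector Z @^-1` A) + lti (fun z => (h z)%:E))%E.
  rewrite [LHS]dg // [X in (X + _)%E]df // -ltiD.
  - by apply: lti_ext => z; rewrite -EFinD /h; congr EFin; ring.
  - by apply/measurable_EFinP; exact: measurable_funM.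
  - exact/measurable_EFinP.
  - by move=> z; rewrite lee_fin mulr_ge0.
  - by move=> z; rewrite lee_fin.
have fin : P (random_vector Z @^-1` A) \is a fin_num.
  apply: fin_num_measure; rewrite -[X in measurable X]setTI.
  have -> : random_vector Z = fun w => random_vector Z w by [].
  have mrv : measurable_fun [set: Omega] (random_vector Z).
    apply/measurable_fun_tnthP => i.
    rewrite (_ : _ \o _ = Z (enum_val i)); first exact: measurable_funP.
    by apply/funext => w /=; rewrite tnth_mktuple.
  exact: mrv.
have ih : lti (fun z => (h z)%:E) = 0%E.
  have : (0 <= lti (fun z => (h z)%:E))%E by apply: lti_ge0 => z; rewrite lee_fin.
  move: E fin; case: (P _) => // r; case: (lti _) => // s; rewrite -EFinD => -[] E _ _.
  by congr EFin; lra.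
apply: (lti_eq0 (g := fun z => (h z)%:E) _ _ _ _ _ ih).
- exact/measurable_EFinP.
- exact/measurable_EFinP.
- by move=> z; rewrite lee_fin.
- by move=> z; rewrite lee_fin.
move=> z [] /eqP; rewrite /h indicE; case: (boolP (z \in A)) => // zA.
rewrite mul1r; move: zA; rewrite inE /A /= => lt; rewrite subr_eq0 => /eqP E2.
by rewrite E2 ltxx in lt.
Qed.

Definition unit_tuple (u : V) : #|V|.-tuple R := [tuple (k == enum_rank u)%:R | k < #|V|].

Lemma rowt_unit u : rowt (unit_tuple u) = delta_mx 0 (enum_rank u).
Proof. by apply/rowP => k; rewrite !mxE tnth_mktuple eqxx. Qed.

Lemma coord_shift (u : V) (z : #|V|.-tuple R) (v : V) : Defs.coord (tuple_shift (unit_tuple u) z) v = Defs.coord z v + (v == u)%:R.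
Proof. by rewrite /Defs.coord !tnth_mktuple (inj_eq enum_rank_inj). Qed.

(** Each factor depends on at most one of the coordinates u and v, so both sides
    contain the same factors. *)
Lemma edge_product_exchange e psi u v (z : #|V|.-tuple R) : u != v -> ~~ e u v -> ~~ e v u ->
  let f := edge_product e psi in let a := tuple_shift (unit_tuple u) in
  let b := tuple_shift (unit_tuple v) in
  f (b (a z)) * f z = f (a z) * f (b z).
Proof.
move=> uv euv evu f a b; rewrite /f /edge_product -!big_split /=.
apply: eq_bigr => -[x y] /= /andP[exy _].
have ca w : Defs.coord (a z) w = Defs.coord z w + (w == u)%:R by exact: coord_shift.
have cb t w : Defs.coord (b t) w = Defs.coord t w + (w == v)%:R by exact: coord_shift.
rewrite !cb !ca.
have [/andP[/negbTE-> /negbTE->]|nb] := boolP ((x != v) && (y != v)); first by rewrite !addr0.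
have /andP[/negbTE-> /negbTE->] : (x != u) && (y != u).
  move: nb; rewrite negb_and !negbK => /orP[]/eqP E; subst;
    apply/andP; split; rewrite 1?eq_sym //.
  - by apply: contra evu => /eqP->.
  - by apply: contra euv => /eqP->.
by rewrite !addr0 mulrC.
Qed.

Variables (mu : 'rV[R]_#|V|) (Sigma : 'M[R]_#|V|).
Hypothesis pd : positive_definite Sigma.
Hypothesis gauss : has_density Z (gaussian_pdf mu Sigma).

(** Otherwise the density would be zero everywhere; this is how the positivity
    of the determinant is obtained. *)
Lemma peak_gt0 : 0 < peak Sigma.
Proof.
rewrite lt_neqAle peak_ge0 andbT eq_sym; apply/eqP => c0.
have := density_total gauss; have -> : lti (fun z => (gaussian_pdf mu Sigma z)%:E) = 0%E.
  rewrite (lti_ext (h := fun=> 0%E)); last by move=> z; rewrite gaussian_pdfE c0 mul0r.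
  by elim: #|V| => //= m ->; rewrite integral0.
by move=> /eqP; rewrite eq_sym; move=> /eqP[] /eqP; rewrite oner_eq0.
Qed.

(** The two densities, edge product and Gaussian, agree at almost every z, hence
    at z and its three shifts for some z, since null sets are stable under
    shifts. There the exchange relation of the edge product passes to the
    Gaussian density. *)
Lemma precision_zero e psi u v : has_density Z (edge_product e psi) ->
  u != v -> ~~ e u v -> ~~ e v u -> invmx Sigma (enum_rank u) (enum_rank v) = 0.
Proof.
set f := edge_product e psi; set g := gaussian_pdf mu Sigma => df uv euv evu.
have [mf f0 _] := df; have [mg g0 _] := gauss.
have N1 := density_lt_null df gauss; have N2 := density_lt_null gauss df.
set A1 := [set z | _] in N1; set A2 := [set z | _] in N2.
pose N z : \bar R := ((\1_A1 z : R)%:E + (\1_A2 z : R)%:E)%E.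
have mi A : measurable A -> measurable_fun [set: #|V|.-tuple R] (fun z => (\1_A z : R)%:E).
  by move=> mA; apply/measurable_EFinP; exact: measurable_indic.
have mA1 : measurable A1 by exact: measurable_lt_set.
have mA2 : measurable A2 by exact: measurable_lt_set.
have i0 (A : set (#|V|.-tuple R)) z : (0 <= (\1_A z : R)%:E)%E by rewrite lee_fin.
have N0 z : (0 <= N z)%E by rewrite adde_ge0.
have mN : measurable_fun [set: #|V|.-tuple R] N by apply: emeasurable_funD; exact: mi.
have iN : lti N = 0%E by rewrite ltiD ?N1 ?N2 ?adde0 //; exact: mi.
pose a := tuple_shift (unit_tuple u); pose b := tuple_shift (unit_tuple v).
have ma : measurable_fun [set: #|V|.-tuple R] a by exact: measurable_tuple_shift.
have mb : measurable_fun [set: #|V|.-tuple R] b by exact: measurable_tuple_shift.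
have mNb := comp_measurable mN mb; have mNa := comp_measurable mN ma.
have mNba := comp_measurable mNb ma.
pose S z : \bar R := ((N z + N (a z)) + (N (b z) + N (b (a z))))%E.
have iS : lti S = 0%E.
  rewrite ltiD; first last.
  - by move=> z; rewrite adde_ge0.
  - by move=> z; rewrite adde_ge0.
  - exact: emeasurable_funD.
  - exact: emeasurable_funD.
  have Na : lti (fun z => N (a z)) = 0%E by rewrite -iN; exact: (lti_shift _ mN N0).
  have Nb : lti (fun z => N (b z)) = 0%E by rewrite -iN; exact: (lti_shift _ mN N0).
  have Nba : lti (fun z => N (b (a z))) = 0%E.
    by rewrite -Nb; exact: (lti_shift _ mNb (fun z => N0 (b z))).
  rewrite [X in (X + _)%E]ltiD // [X in (_ + X)%E]ltiD //.
  by rewrite -/(lti N) iN Na Nb Nba !adde0.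
have S0 z : (0 <= S z)%E by rewrite !adde_ge0.
have [z Sz] : exists z, S z = 0%E.
  apply: contrapT => no; have := density_total gauss.
  have -> : lti (fun t => (gaussian_pdf mu Sigma t)%:E) = 0%E.
    apply: (lti_eq0 (g := S) _ _ _ _ _ iS).
    - by apply: emeasurable_funD; exact: emeasurable_funD.
    - exact/measurable_EFinP.
    - exact: S0.
    - by move=> t; rewrite lee_fin.
    - by move=> t St; case: no; exists t.
  by move=> /eqP; rewrite eq_sym; move=> /eqP[] /eqP; rewrite oner_eq0.
have fg t : N t = 0%E -> f t = g t.
  move=> /eqP; rewrite padde_eq0 // => /andP[/eqP[] + /eqP[]]; rewrite !indicE.
  case: (boolP (t \in A1)) => [|t1]; first by move=> _ /eqP; rewrite oner_eq0.
  case: (boolP (t \in A2)) => [|t2]; first by move=> _ _ /eqP; rewrite oner_eq0.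
  move=> _ _; apply/eqP; rewrite eq_le !leNgt; apply/andP; split; apply/negP => h.
    by case/negP: t2; rewrite inE.
  by case/negP: t1; rewrite inE.
have [E1 E2 E3 E4] : [/\ f z = g z, f (a z) = g (a z), f (b z) = g (b z) & f (b (a z)) = g (b (a z))].
  move/eqP: Sz; rewrite padde_eq0 ?adde_ge0 // => /andP[].
  rewrite (padde_eq0 (N0 z) (N0 (a z))) (padde_eq0 (N0 (b z)) (N0 (b (a z)))).
  move=> /andP[/eqP n1 /eqP n2] /andP[/eqP n3 /eqP n4].
  by split; apply: fg.
have : f (b (a z)) * f z = f (a z) * f (b z) := edge_product_exchange psi z uv euv evu.
rewrite E1 E2 E3 E4 => /(gaussian_exchange pd peak_gt0).
by rewrite !rowt_unit bform_delta.
Qed.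

(** The mass of the marginal is one, so its constant kappa is finite. *)
Lemma pair_law u v : u != v -> exists2 C : R, 0 <= C &
  forall A : set (R * R), measurable A ->
    P ((fun w => (Z u w, Z v w)) @^-1` A) =
    (\int[(leb \x leb)]_q (\1_A q * (C * expR (- pair_form Sigma (enum_rank u) (enum_rank v)
       (q.1 - mu 0 (enum_rank u)) (q.2 - mu 0 (enum_rank v)) / 2)))%:E)%E.
Proof.
move=> uv; set i := enum_rank u; set j := enum_rank v.
have ij : i != j by rewrite (inj_eq enum_rank_inj).
have [kappa k0 marg] := gaussian_marginal mu pd ij.
pose w (q : R * R) : R := expR (- pair_form Sigma i j (q.1 - mu 0 i) (q.2 - mu 0 j) / 2).
have w0 q : 0 <= w q by exact: expR_ge0.
have mw : measurable_fun [set: R * R] w.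
  apply: (comp_measurable (f := @expR R)); first exact: measurable_expR.
  apply: measurable_funM => //; apply: measurableT_comp => //.
  have m1 : measurable_fun [set: R * R] (fun q : R * R => q.1 - mu 0 i) by apply: measurable_funB.
  have m2 : measurable_fun [set: R * R] (fun q : R * R => q.2 - mu 0 j) by apply: measurable_funB.
  rewrite /pair_form; apply: measurable_funD; apply: measurable_funM => //;
    by apply: measurable_funM => //; apply: measurable_funB; apply: measurable_funM.
have law A : measurable A -> P ((fun o => (Z u o, Z v o)) @^-1` A) =
    (kappa * \int[(leb \x leb)]_q (\1_A q * w q)%:E)%E.
  move=> mA; have [mg g0 dg] := gauss.
  have mpair : measurable_fun [set: #|V|.-tuple R] (fun z : #|V|.-tuple R => (tnth z i, tnth z j)).
    by apply: measurable_fun_pair; exact: measurable_tnth.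
  pose A' := (fun z : #|V|.-tuple R => (tnth z i, tnth z j)) @^-1` A.
  have mA' : measurable A' by rewrite -[A']setTI; exact: mpair.
  have -> : (fun o => (Z u o, Z v o)) @^-1` A = random_vector Z @^-1` A'.
    by apply/seteqP; split=> o; rewrite /A' /= !tnth_mktuple !enum_rankK.
  rewrite dg //.
  rewrite (lti_ext (h := fun z => (((\1_A (tnth z i, tnth z j) : R)%:E) * (gaussian_pdf mu Sigma z)%:E)%E)).
    have mI : measurable_fun [set: R * R] (fun q => (\1_A q : R)%:E).
      by apply/measurable_EFinP; exact: measurable_indic.
    have I0 (q : R * R) : (0 <= (\1_A q : R)%:E)%E by rewrite lee_fin.
    rewrite (marg _ mI I0).
    have mF : measurable_fun [set: measurableTypeR R * measurableTypeR R]
        (fun q : R * R => (\1_A q * w q)%:E).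
      by apply/measurable_EFinP; apply: measurable_funM => //; exact: measurable_indic.
    have F0 (q : R * R) : (0 <= (\1_A q * w q)%:E)%E by rewrite lee_fin mulr_ge0.
    have mFk : measurable_fun [set: measurableTypeR R * measurableTypeR R]
        (fun q : measurableTypeR R * measurableTypeR R => (kappa * (\1_A q * w q)%:E)%E).
      exact: measurable_funeM.
    have Fk0 (q : measurableTypeR R * measurableTypeR R) : (0 <= kappa * (\1_A q * w q)%:E)%E.
      by rewrite mule_ge0 //; exact: F0.
    rewrite -(@ge0_integralZl _ _ _ (leb \x leb)%E setT measurableT _ mF kappa (fun q _ => F0 q) k0).
    rewrite (@fubini_tonelli1 _ _ (measurableTypeR R) (measurableTypeR R) R leb leb _ mFk Fk0).
    by apply: eq_integral => x _; apply: eq_integral => y _; rewrite /= EFinM.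
  by move=> z; rewrite EFinM.
have tot := law setT measurableT; rewrite preimage_setT probability_setT in tot.
have [C [C0 EC]] : exists C : R, 0 <= C /\ kappa = C%:E.
  move: k0 tot; case: kappa {marg law} => [C|_|//]; first by move=> C0 _; exists C.
  set J := integral _ _ _; have : (0 <= J)%E.
    by apply: integral_ge0 => q _; rewrite lee_fin mulr_ge0.
  case: J => // r; rewrite ?mulyy //.
  rewrite lee_fin le_eqVlt => /orP[/eqP<-|r0].
    by rewrite mule0 => -[] /eqP; rewrite oner_eq0.
  by rewrite gt0_mulye ?lte_fin.
exists C => // A mA; rewrite law // EC -ge0_integralZl_EFin //.
- by apply: eq_integral => q _; rewrite -EFinM; congr EFin; rewrite mulrCA.
- by move=> q _; rewrite lee_fin mulr_ge0.
- by apply/measurable_EFinP; apply: measurable_funM => //; exact: measurable_indic.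
Qed.

End Densities.

(** * Correlations along paths *)

Section Markov.
Variables (R : realType) (V : finType) (e : rel V) (Sigma : 'M[R]_#|V|).
Hypothesis pd : positive_definite Sigma.
Hypothesis treeT : is_tree e.
Hypothesis prec0 : forall u v, u != v -> ~~ e u v ->
  invmx Sigma (enum_rank u) (enum_rank v) = 0.
Let K := invmx Sigma.
Let S u v := Sigma (enum_rank u) (enum_rank v).
Definition gcorr u v : R := S u v / Num.sqrt (S u u * S v v).
Hypothesis edge_nz : forall u v, e u v -> S u v != 0.

(** Let y be the combination of the rows x and p of the covariance matrix that
    vanishes at p, cut off outside the side B of p opposite to x. Over B the
    inverse matrix does not see the cut, since nothing outside B but p is
    adjacent to B; hence the quadratic form of the inverse matrix vanishes at y,
    and y = 0. *)
Lemma separated_cov (D : V -> V -> R) x p v : tree_metric e D -> btw D x p v ->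
  S v x * S p p = S v p * S p x.
Proof.
move=> tm b; have [->|xp] := eqVneq x p; first by [].
have [->|vp] := eqVneq v p; first by rewrite mulrC.
pose B c := btw D x p c && (c != p).
have xB : ~~ B x by apply/negP => /andP[/(btw_id tm) E]; rewrite E eqxx in xp.
pose full : 'rV[R]_#|V| :=
  S p p *: row (enum_rank x) Sigma - S p x *: row (enum_rank p) Sigma.
(* The cut-off of full to the vertices behind p, where it will be shown to vanish. *)
pose y : 'rV[R]_#|V| := \row_k (if B (enum_val k) then full 0 k else 0).
have fullE c : full 0 (enum_rank c) = S c x * S p p - S c p * S p x.
  by rewrite !mxE -/(S x c) -/(S p c) /S (pd_sym pd (enum_rank x)) (pd_sym pd (enum_rank p) (enum_rank c)); ring.
have fullK k : (full *m K) 0 k = S p p * (k == enum_rank x)%:R - S p x * (k == enum_rank p)%:R.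
  rewrite mulmxBl -!scalemxAl -!row_mul mulmxV ?(pd_unit pd) // !row1 !mxE !eqxx /=.
  by [].
have yK b' : B b' -> (y *m K) 0 (enum_rank b') = 0.
  move=> Bb; have E : (y *m K) 0 (enum_rank b') = (full *m K) 0 (enum_rank b').
    rewrite !mxE; apply: eq_bigr => k _; rewrite [y 0 k]mxE; case: ifP => // nB.
    rewrite mul0r; pose c := enum_val k; have Ek : k = enum_rank c by rewrite enum_valK.
    have [cp|cp] := eqVneq c p.
      by rewrite Ek cp fullE [S p x * _]mulrC subrr mul0r.
    have cb : c != b' by apply: contraFneq nB => E; rewrite -/c E.
    rewrite Ek (prec0 cb) ?mulr0 //; apply: contraFN nB => ecb.
    rewrite -/c /B cp andbT; move/andP: Bb => [bb bp].
    case: (branch_trans tm c bb) => // h.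
    case: (btw_edge tm ecb h) => E; first by rewrite E eqxx in cp.
    by rewrite E eqxx in bp.
  rewrite E fullK; have -> : (enum_rank b' == enum_rank x) = false.
    rewrite (inj_eq enum_rank_inj); apply: contraNF xB => /eqP<-; exact: Bb.
  have -> : (enum_rank b' == enum_rank p) = false.
    by rewrite (inj_eq enum_rank_inj); case/andP: Bb => _ /negbTE.
  by rewrite !mulr0 subr0.
have yKy : bform K y y = 0.
  rewrite /bform mxE big1 // => k _; rewrite [y^T k 0]mxE [y 0 k]mxE.
  case: ifP => [Bk|]; last by rewrite mulr0.
  by have := yK _ Bk; rewrite enum_valK => ->; rewrite mul0r.
have y0 : y = 0.
  apply: contraTeq isT => yn; have := bform_inv_gt0 pd yn; by rewrite -/K yKy ltxx.
have : y 0 (enum_rank v) = 0 by rewrite y0 mxE.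
rewrite mxE enum_rankK /B b vp /= fullE => /eqP; by rewrite subr_eq0 => /eqP.
Qed.

Lemma S_diag u : 0 < S u u. Proof. exact: pd_diag pd _. Qed.

Lemma gcorr_sym u v : gcorr u v = gcorr v u.
Proof. by rewrite /gcorr /S (pd_sym pd) [_ * Sigma (enum_rank v) _]mulrC. Qed.

Lemma gcorr_norm_lt1 u v : u != v -> `|gcorr u v| < 1.
Proof.
move=> uv; rewrite /gcorr normf_div; have s0 : 0 < Num.sqrt (S u u * S v v).
  by rewrite sqrtr_gt0 mulr_gt0 ?S_diag.
rewrite (gtr0_norm s0) ltr_pdivrMr // mul1r.
rewrite -sqrtr_sqr ltr_sqrt ?mulr_gt0 ?S_diag //.
rewrite -subr_gt0; apply: (pd_minor pd); by rewrite (inj_eq enum_rank_inj).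
Qed.

Lemma gcorr_mul (D : V -> V -> R) x p v : tree_metric e D -> btw D x p v ->
  gcorr v x = gcorr v p * gcorr p x.
Proof.
move=> tm b; have E := separated_cov tm b.
rewrite /gcorr.
have n u : Num.sqrt (S u u) != 0 by rewrite gt_eqF // sqrtr_gt0 S_diag.
have sq : Num.sqrt (S p p) ^+ 2 = S p p by rewrite sqr_sqrtr // ltW // S_diag.
have sqM s t : 0 < s -> Num.sqrt (s * t) = Num.sqrt s * Num.sqrt t :> R by move=> /ltW; exact: sqrtrM.
rewrite !sqM ?S_diag //.
apply/eqP; rewrite mulf_div eqr_div ?mulf_neq0 //; apply/eqP.
have -> : Num.sqrt (S v v) * Num.sqrt (S p p) * (Num.sqrt (S p p) * Num.sqrt (S x x)) =
   Num.sqrt (S p p) ^+ 2 * (Num.sqrt (S v v) * Num.sqrt (S x x)) by ring.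
by rewrite sq -E; ring.
Qed.

(** Give the edges the lengths - ln |corr|; the resulting metric is - ln |corr|
    everywhere, by induction along paths, since correlations multiply. *)
Lemma gcorr_tree_metric : exists D : V -> V -> R, tree_metric e D /\
  forall u v, u != v -> D u v = - ln `|gcorr u v|.
Proof.
have [V0 es ei ec ea] := treeT.
pose len u v : R := - ln `|gcorr u v|.
have len_sym u v : len u v = len v u by rewrite /len gcorr_sym.
have nz u v : e u v -> gcorr u v != 0.
  move=> euv; rewrite /gcorr mulf_neq0 ?edge_nz // invr_neq0 // gt_eqF //.
  by rewrite sqrtr_gt0 mulr_gt0 ?S_diag.
have enq u v : e u v -> u != v by move=> euv; apply: contraTneq euv => ->; rewrite ei.
have len_pos u v : e u v -> 0 < len u v.
  move=> euv; rewrite /len oppr_gt0 ln_lt0 // normr_gt0 nz //=.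
  by apply: gcorr_norm_lt1; exact: enq.
have [D [tm Dl]] := tree_metric_exists len_pos len_sym es ei ea ec V0.
exists D; split=> // u v uv.
suff [] : gcorr u v != 0 /\ D u v = len u v by [].
have [k] := ubnP #|[set t | D t v < D u v]%SET|; elim: k u uv => // k IH u uv lek.
have [z ez bz] := neighbour_toward tm uv.
have [zv|zv] := eqVneq z v; first by subst z; split; [exact: nz|exact: Dl].
have Duz := bz; move/eqP: Duz => Duz.
have uz := dist_gt0 tm (edge_neq tm ez).
have [|nzv Dzv] := IH z zv.
  rewrite -ltnS; apply: leq_trans lek; rewrite ltnS; apply: proper_card.
  apply/properP; split.
    by apply/fintype.subsetP => t; rewrite !inE => h; apply: lt_trans h _; lra.
  by exists z; rewrite !inE ?ltxx //; lra.
have E : gcorr u v = gcorr u z * gcorr z v.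
  by apply: (gcorr_mul tm); rewrite (btw_sym tm).
split; first by rewrite E mulf_neq0 // nz.
rewrite /len E normrM lnM ?posrE ?normr_gt0 // ?nz // opprD -/(len u z) -/(len z v).
by rewrite -Dzv -(Dl _ _ ez) Duz.
Qed.

End Markov.

(** * Gaussian integrals over plane cones *)

Section HalfLine.
Variable R : realType.
Local Notation leb := (@lebesgue_measure R).

Lemma integral_half_line (f F : R -> R) (l : R) : (forall x, 0 <= x -> 0 <= f x) -> continuous f ->
  F x @[x --> +oo] --> l -> (forall x : R, is_derive x 1 F (f x)) ->
  (\int[leb]_(x in `[0%R, +oo[) (f x)%:E = (l - F 0)%:E)%E.
Proof.
move=> f0 cf Fl dF; have cF (x : R) : {for x, continuous F}.
  by apply: differentiable_continuous; apply/derivable1_diffP; apply: ex_derive.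
rewrite (ge0_continuous_FTC2y _ _ Fl) //.
- exact: continuous_subspaceT.
- by apply: cvg_at_right_filter; exact: cF.
- by move=> x _; rewrite derive1E; exact: derive_val.
Qed.

Lemma integral_abs_gauss (k : R) : 0 < k ->
  (\int[leb]_x (`|x| * expR (- (k * x ^+ 2)))%:E = (k^-1)%:E)%E.
Proof.
move=> k0; have kn := lt0r_neq0 k0.
have cg : continuous (fun x : R => expR (- (k * x ^+ 2))).
  move=> x; apply: (@continuous_comp _ _ _ (fun x : R => - (k * x ^+ 2)) expR);
    last exact: continuous_expR.
  by apply: cvgN; apply: cvgM; [exact: cvg_cst|exact: exprn_continuous].
have f0 (x : R) : 0 <= `|x| * expR (- (k * x ^+ 2)) by rewrite mulr_ge0 ?expR_ge0.
have ca : continuous (fun x : R => `|x| * expR (- (k * x ^+ 2))).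
  by move=> x; apply: cvgM; [exact: norm_continuous|exact: cg].
rewrite ge0_symfun_integralT //; last by move=> x /=; rewrite normrN sqrrN.
rewrite -set_itvcy.
pose F (x : R) := - (2 * k)^-1 * expR (- (k * x ^+ 2)).
have -> : (\int[leb]_(x in `[0%R, +oo[) (`|x| * expR (- (k * x ^+ 2)))%:E =
    \int[leb]_(x in `[0%R, +oo[) (x * expR (- (k * x ^+ 2)))%:E)%E.
  by apply: eq_integral => x; rewrite inE /= in_itv /= andbT => x0; rewrite ger0_norm.
have cx : continuous (fun x : R => x * expR (- (k * x ^+ 2))).
  by move=> x; apply: cvgM; [exact: cvg_id|exact: cg].
transitivity (2%:E * (0 - F 0)%:E)%E.
  congr (_ * _)%E; apply: integral_half_line.
  - by move=> x x0; rewrite mulr_ge0 ?expR_ge0.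
  - exact: cx.
  - rewrite -[X in _ --> X](mulr0 (- (2 * k)^-1)); apply: cvgMr.
    apply: (cvg_comp (fun x => k * x ^+ 2) (fun x => expR (- x))); last exact: cvgr_expR.
    apply: (cvg_comp (fun x : R => x ^+ 2) (fun x => k * x)); first exact: cvgr_expr2.
    exact: gt0_cvgMry.
  - by move=> x; apply: is_derive_eq; rewrite /GRing.scale /=; field; exact: kn.
by rewrite /F expr0n /= mulr0 oppr0 expR0 -EFinM; congr EFin; field.
Qed.

(** An antiderivative is atan ((c s - b) / sqrt dt) / sqrt dt, by c (c s^2 - 2 b
    s + a) = (c s - b)^2 + dt. *)
Lemma integral_inverse_quadratic (a b c dt : R) : 0 < c -> 0 < dt -> a * c - b ^+ 2 = dt ->
  (\int[leb]_(s in `[0%R, +oo[) ((c * s ^+ 2 - 2 * b * s + a)^-1)%:E =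
   ((pi / 2 + atan (b / Num.sqrt dt)) / Num.sqrt dt)%:E)%E.
Proof.
move=> c0 dt0 E; set D := Num.sqrt dt.
have D0 : 0 < D by rewrite sqrtr_gt0.
have DD : D ^+ 2 = dt by rewrite sqr_sqrtr // ltW.
have q0 s : 0 < c * s ^+ 2 - 2 * b * s + a.
  rewrite -(pmulr_rgt0 _ c0); have -> : c * (c * s ^+ 2 - 2 * b * s + a) = (c * s - b) ^+ 2 + dt.
    by rewrite -E; ring.
  by rewrite ltr_wpDl // sqr_ge0.
pose F (s : R) := D^-1 * atan (D^-1 * (c * s - b)).
transitivity ((D^-1 * (pi / 2) - F 0)%:E); last first.
  rewrite /F mulr0 sub0r mulrN atanN; congr EFin.
  by rewrite [D^-1 * b]mulrC; ring.
apply: integral_half_line.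
- by move=> s _; rewrite invr_ge0 ltW.
- move=> s; apply: cvgV; first by rewrite gt_eqF.
  apply: cvgD; last exact: cvg_cst.
  apply: cvgB; apply: cvgM; try exact: cvg_cst; first exact: exprn_continuous.
  exact: cvg_id.
- apply: cvgMr; apply: (cvg_comp (fun s => D^-1 * (c * s - b)) (@atan R)); last exact: cvgy_atan.
  apply: gt0_cvgMry; first by rewrite invr_gt0.
  apply: (cvg_comp (fun s => c * s) (fun s => s - b)); last exact: cvg_addrr.
  exact: gt0_cvgMry.
- move=> s; apply: is_derive_eq.
  rewrite /GRing.scale /=.
  have -> : 1 + (D^-1 * (c * s - b)) ^+ 2 = c * (c * s ^+ 2 - 2 * b * s + a) / D ^+ 2.
    rewrite exprMn exprVn; apply: (canRL (mulfK _)); first by rewrite expf_neq0 // gt_eqF.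
    rewrite mulrDl mul1r mulrAC mulVf ?expf_neq0 ?gt_eqF // mul1r DD -E; ring.
  by field; rewrite ?(gt_eqF D0) ?(gt_eqF c0) //= gt_eqF.
Qed.

End HalfLine.

Section Cone.
Variable R : realType.
Local Notation leb := (@lebesgue_measure R).
Local Notation leb2 := (leb \x leb)%E.
Variables (a b c dt : R).
Hypotheses (c0 : 0 < c) (dt0 : 0 < dt) (dtE : a * c - b ^+ 2 = dt).

Definition quad (q : R * R) : R := c * q.2 ^+ 2 - 2 * b * (q.1 * q.2) + a * q.1 ^+ 2.

Lemma measurable_quad : measurable_fun [set: R * R] quad.
Proof.
have m1 : measurable_fun [set: R * R] (fun q : R * R => q.1) by exact: measurable_fst.
have m2 : measurable_fun [set: R * R] (fun q : R * R => q.2) by exact: measurable_snd.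
rewrite /quad; apply: measurable_funD; last by apply: measurable_funM => //; exact: measurable_funX.
apply: measurable_funB; apply: measurable_funM => //; [exact: measurable_funX|exact: measurable_funM].
Qed.

Lemma slope_quad_gt0 s : 0 < c * s ^+ 2 - 2 * b * s + a.
Proof.
rewrite -(pmulr_rgt0 _ c0); have -> : c * (c * s ^+ 2 - 2 * b * s + a) = (c * s - b) ^+ 2 + dt.
  by rewrite -dtE; ring.
by rewrite ltr_wpDl // sqr_ge0.
Qed.

Lemma measurable_gauss_quad k : measurable_fun [set: R * R] (fun q => expR (- (k * quad q))).
Proof.
apply: (comp_measurable (f := @expR R)); first exact: measurable_expR.
apply: measurableT_comp => //; apply: measurable_funM => //; exact: measurable_quad.
Qed.

(** Integrate along rays: substitute y = x s for x nonzero, exchange the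
    integrals, and use the integral of |x| exp (- r x^2). The cone A enters
    through its slopes S only. *)
Lemma cone_integral (A : set (R * R)) (S : set R) k : 0 < k -> measurable A -> measurable S ->
  (forall x s, x != 0 -> A (x, x * s) <-> S s) ->
  (\int[leb2]_q (\1_A q * expR (- (k * quad q)))%:E =
   \int[leb]_(s in S) ((k * (c * s ^+ 2 - 2 * b * s + a))^-1)%:E)%E.
Proof.
move=> k0 mA mS AS.
pose F (q : R * R) := (\1_A q * expR (- (k * quad q)))%:E.
pose r s := k * (c * s ^+ 2 - 2 * b * s + a).
have r0 s : 0 < r s by rewrite mulr_gt0 // slope_quad_gt0.
pose H (q : R * R) := (\1_S q.2 * (`|q.1| * expR (- (r q.2 * q.1 ^+ 2))))%:E.
have mF : measurable_fun [set: measurableTypeR R * measurableTypeR R] F.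
  by apply/measurable_EFinP; apply: measurable_funM; [exact: measurable_indic|exact: measurable_gauss_quad].
have F0 q : (0 <= F q)%E by rewrite lee_fin mulr_ge0 ?expR_ge0.
have mH : measurable_fun [set: measurableTypeR R * measurableTypeR R] H.
  have m1 : measurable_fun [set: R * R] (fun q : R * R => q.1) by exact: measurable_fst.
  have m2 : measurable_fun [set: R * R] (fun q : R * R => q.2) by exact: measurable_snd.
  apply/measurable_EFinP; apply: measurable_funM.
    by apply: (comp_measurable (f := fun s : R => \1_S s : R) (g := fun q : R * R => q.2)); [exact: measurable_indic|exact: m2].
  apply: measurable_funM; first exact: measurableT_comp.
  apply: (comp_measurable (f := @expR R)); first exact: measurable_expR.
  apply: measurableT_comp => //; apply: measurable_funM; last exact: measurable_funX.
  rewrite /r; apply: measurable_funM => //; apply: measurable_funD => //.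
  by apply: measurable_funB; apply: measurable_funM => //; exact: measurable_funX.
have H0 q : (0 <= H q)%E by rewrite lee_fin mulr_ge0 // mulr_ge0 ?expR_ge0.
rewrite (@fubini_tonelli1 _ _ (measurableTypeR R) (measurableTypeR R) R leb leb F mF F0).
have mS1 : measurable_fun [set: R] (\1_S : R -> R) by exact: measurable_indic.
transitivity (\int[leb]_x \int[leb]_s H (x, s))%E.
  have mFF := @measurable_fun_fubini_tonelli_F _ _ (measurableTypeR R) (measurableTypeR R) R leb F mF F0.
  have mHH := @measurable_fun_fubini_tonelli_F _ _ (measurableTypeR R) (measurableTypeR R) R leb H mH H0.
  have mC : measurable ([set: R] `\ 0) by exact: measurableD.
  rewrite -[LHS](integral_setD1 (r := 0)) //; last exact: measurable_funS mFF.
  rewrite -[RHS](integral_setD1 (r := 0)) //; last exact: measurable_funS mHH.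
  apply: eq_integral => x; rewrite inE /= => -[_ /eqP x0]; rewrite /fubini_F.
  have mFx : measurable_fun [set: R] (fun y => F (x, y)).
    exact: (comp_measurable (f := F) (g := pair x) mF).
  rewrite -(ge0_integral_scale x0 mFx) //.
  have mFxs : measurable_fun [set: R] (fun s => F (x, x * s)).
    by apply: (comp_measurable (f := fun y => F (x, y))) => //; exact: measurable_mulr.
  rewrite -ge0_integralZl_EFin //.
  apply: eq_integral => s _; rewrite /F /H -EFinM /=; congr EFin.
  rewrite mulrCA; congr (_ * _).
    by rewrite !indicE; congr (_%:R); congr nat_of_bool; apply/asboolP/asboolP => /AS; apply.
  by congr (_ * expR (- _)); rewrite /r /quad /=; ring.
rewrite (@fubini_tonelli _ _ (measurableTypeR R) (measurableTypeR R) R leb leb H mH H0).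
rewrite [RHS]integral_mkcond; apply: eq_integral => s _.
rewrite patchE /H /= indicE; case: ifP => sS.
  under eq_integral => x _ do rewrite mul1r.
  exact: integral_abs_gauss.
by under eq_integral => x _ do rewrite mul0r; rewrite integral0.
Qed.

End Cone.

Section ConeValues.
Variable R : realType.
Local Notation leb := (@lebesgue_measure R).
Local Notation leb2 := (leb \x leb)%E.
Variables (a b c dt : R).
Hypotheses (c0 : 0 < c) (dt0 : 0 < dt) (dtE : a * c - b ^+ 2 = dt).

Definition same_sign : set (R * R) := [set q | 0 < q.1 * q.2].
Definition opposite_sign : set (R * R) := [set q | q.1 * q.2 < 0].
Definition axes : set (R * R) := [set q | q.1 * q.2 = 0].

Lemma measurable_fun_prod_coords : measurable_fun [set: R * R] (fun q : R * R => q.1 * q.2).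
Proof. by apply: measurable_funM; [exact: measurable_fst|exact: measurable_snd]. Qed.

Lemma measurable_same_sign : measurable same_sign.
Proof.
rewrite (_ : same_sign = (fun q : R * R => q.1 * q.2) @^-1` `]0, +oo[).
  by rewrite -[X in measurable X]setTI; apply: measurable_fun_prod_coords.
by apply/seteqP; split=> q; rewrite /same_sign /= in_itv /= andbT.
Qed.

Lemma measurable_opposite_sign : measurable opposite_sign.
Proof.
rewrite (_ : opposite_sign = (fun q : R * R => q.1 * q.2) @^-1` `]-oo, 0[).
  by rewrite -[X in measurable X]setTI; apply: measurable_fun_prod_coords.
by apply/seteqP; split=> q; rewrite /opposite_sign /= in_itv.
Qed.

Lemma measurable_axes : measurable axes.
Proof.
rewrite (_ : axes = (fun q : R * R => q.1 * q.2) @^-1` [set 0]) //.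
by rewrite -[X in measurable X]setTI; apply: measurable_fun_prod_coords.
Qed.

Lemma slope_sign (x s : R) : x != 0 ->
  [/\ (0 < x * (x * s)) = (0 < s), (x * (x * s) < 0) = (s < 0) & (x * (x * s) == 0) = (s == 0)].
Proof.
move=> x0; have x2 : 0 < x * x by rewrite -expr2 exprn_even_gt0.
rewrite mulrA; split; [exact: pmulr_rgt0|exact: pmulr_rlt0|].
by rewrite mulf_eq0 (gt_eqF x2).
Qed.

Lemma measurable_slope k (b' : R) : 0 < k -> a * c - b' ^+ 2 = dt ->
  measurable_fun [set: R] (fun s => ((k * (c * s ^+ 2 - 2 * b' * s + a))^-1)%:E).
Proof.
move=> k0 E; apply/measurable_EFinP; apply: continuous_measurable_fun => s.
apply: cvgV; first by rewrite mulf_neq0 // gt_eqF // (slope_quad_gt0 c0 dt0 E).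
apply: cvgMr; apply: cvgD; last exact: cvg_cst.
apply: cvgB; apply: cvgM; try exact: cvg_cst; first exact: exprn_continuous.
exact: cvg_id.
Qed.

Let half_slope k (b' : R) : 0 < k -> a * c - b' ^+ 2 = dt ->
  (\int[leb]_(s in `]0%R, +oo[) ((k * (c * s ^+ 2 - 2 * b' * s + a))^-1)%:E =
   (k^-1 * ((pi / 2 + atan (b' / Num.sqrt dt)) / Num.sqrt dt))%:E)%E.
Proof.
move=> k0 E; rewrite integral_itv_obnd_cbnd; last exact: measurable_funS (measurable_slope k0 E).
have E0 := E; have {}E := integral_inverse_quadratic c0 dt0 E.
rewrite EFinM -E -ge0_integralZl_EFin //.
- by apply: eq_integral => s _; rewrite -EFinM invfM.
- by move=> s _; rewrite lee_fin invr_ge0 ltW // (slope_quad_gt0 c0 dt0 E0).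
- have := measurable_slope ltr01 E0; under eq_fun do rewrite mul1r.
  exact: measurable_funS.
- by rewrite invr_ge0 ltW.
Qed.

Lemma integral_same_sign k : 0 < k ->
  (\int[leb2]_q (\1_same_sign q * expR (- (k * quad a b c q)))%:E =
   (k^-1 * ((pi / 2 + atan (b / Num.sqrt dt)) / Num.sqrt dt))%:E)%E.
Proof.
move=> k0; rewrite (cone_integral (S := `]0, +oo[) c0 dt0 dtE k0) //.
- exact: half_slope.
- exact: measurable_same_sign.
- by move=> x s x0; rewrite /same_sign /= in_itv /= andbT; case: (slope_sign s x0) => ->.
Qed.

(** Reflecting the slope changes the sign of b. *)
Lemma integral_opposite_sign k : 0 < k ->
  (\int[leb2]_q (\1_opposite_sign q * expR (- (k * quad a b c q)))%:E =
   (k^-1 * ((pi / 2 - atan (b / Num.sqrt dt)) / Num.sqrt dt))%:E)%E.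
Proof.
move=> k0; rewrite (cone_integral (S := `]-oo, 0[) c0 dt0 dtE k0) //; first last.
- by move=> x s x0; rewrite /opposite_sign /= in_itv /=; case: (slope_sign s x0) => _ ->.
- exact: measurable_opposite_sign.
have := half_slope (b' := - b) k0; rewrite sqrrN mulNr atanN => <- //.
rewrite integral_mkcond [RHS]integral_mkcond.
have m1 : (-1 : R) != 0 by rewrite oppr_eq0 oner_eq0.
rewrite -[LHS](ge0_integral_scale m1) ?normrN1 ?mul1e.
- apply: eq_integral => s _; rewrite !patchE !mem_setE !in_itv /= andbT mulN1r oppr_lt0.
  by case: ifP => // _; congr (_%:E); congr (_^-1); ring.
- by apply/(measurable_restrictT _ _).1 => //; exact: measurable_funS (measurable_slope k0 dtE).
- by move=> s; rewrite patchE; case: ifP => // _; rewrite lee_fin invr_ge0 mulr_ge0 ?ltW // (slope_quad_gt0 c0 dt0 dtE).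
Qed.

Lemma integral_axes k : 0 < k ->
  (\int[leb2]_q (\1_axes q * expR (- (k * quad a b c q)))%:E = 0)%E.
Proof.
move=> k0; rewrite (cone_integral (S := [set 0]) c0 dt0 dtE k0) //; first exact: integral_set1.
- exact: measurable_axes.
- by move=> x s x0; case: (slope_sign s x0) => _ _ E; split=> /eqP; rewrite ?E => /eqP // ->; apply/eqP; rewrite /= mulr0 mulr0.
Qed.

End ConeValues.

Section PlaneTranslation.
Variable R : realType.
Local Notation leb := (@lebesgue_measure R).
Local Notation leb2 := (leb \x leb)%E.

Definition translate (m q : R * R) : R * R := (q.1 + m.1, q.2 + m.2).

Lemma measurable_translate m : measurable_fun [set: R * R] (translate m).
Proof.
by apply: measurable_fun_pair; apply: measurable_funD.
Qed.

Lemma integral2_shift (m : R * R) (f : R * R -> \bar R) :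
  measurable_fun [set: R * R] f -> (forall q, 0 <= f q)%E ->
  (\int[leb2]_q f (translate m q) = \int[leb2]_q f q)%E.
Proof.
move=> mf f0.
have mg : measurable_fun [set: R * R] (fun q : R * R => f (translate m q)).
  exact: comp_measurable (measurable_translate m).
have sec x : measurable_fun [set: R] (fun y => f (x, y)).
  exact: (comp_measurable (f := f) (g := pair x) mf).
rewrite (@fubini_tonelli1 _ _ (measurableTypeR R) (measurableTypeR R) R leb leb _ mg (fun q => f0 _)).
rewrite (@fubini_tonelli1 _ _ (measurableTypeR R) (measurableTypeR R) R leb leb f mf f0).
have mF := @measurable_fun_fubini_tonelli_F _ _ (measurableTypeR R) (measurableTypeR R) R leb f mf f0.
rewrite -[RHS](ge0_integral_shift m.1) //.
  apply: eq_integral => x _; rewrite /fubini_F /=.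
  exact: (ge0_integral_shift m.2 (sec (x + m.1)) (fun y => f0 _)).
by move=> x; apply: integral_ge0.
Qed.

End PlaneTranslation.

(** * Differences of independent Gaussian pairs *)

Section Plane.
Variable R : realType.
Local Notation leb := (@lebesgue_measure R).
Local Notation plane := (measurableTypeR R * measurableTypeR R)%type.

(** The product of the Lebesgue measure with itself under its own name, to carry
    the structure of a sigma-finite measure that Tonelli on pairs of planes
    needs. *)
Definition plane_measure : set plane -> \bar R := (leb \x leb)%E.
HB.instance Definition _ := Measure.on plane_measure.
Lemma plane_sigma_finite : sigma_finite setT plane_measure.
Proof.
pose I (k : nat) : set (measurableTypeR R) := [set` `[- k%:R, k%:R]].
exists (fun k => I k `*` I k).
  apply/esym/seteqP; split=> // -[x y] _.
  exists (Num.truncn (Num.max `|x| `|y|)).+1 => //.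
  have := truncnS_gt (Num.max `|x| `|y|); rewrite gt_max => /andP[lx ly].
  by split; rewrite /I /= in_itv /= -ler_norml ltW.
have mI k : measurable (I k) by exact: measurable_itv.
move=> k; split; first by apply: measurableX; exact: mI.
have fI : (leb (I k) < +oo)%E.
  by rewrite /I lebesgue_measure_itv; case: ifP => // _; rewrite -EFinB ltry.
by rewrite /plane_measure product_measure1E // lte_mul_pinfty // ge0_fin_numE.
Qed.
HB.instance Definition _ := Measure_isSigmaFinite.Build _ plane R plane_measure plane_sigma_finite.

End Plane.

Section DifferenceLaw.
Variables (R : realType) (disp : measure_display) (Omega : measurableType disp).
Variables (P : probability Omega R).
Local Notation leb := (@lebesgue_measure R).
Local Notation plane := (measurableTypeR R * measurableTypeR R)%type.
Local Notation leb2 := (leb \x leb)%E.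
Variables (p : {RV P >-> plane}).
Variables (a b c dt C : R) (m : R * R).
Hypotheses (dt0 : 0 < dt) (C0 : 0 <= C).

Definition gauss2 (q : R * R) : R :=
  C * expR (- (quad a b c (translate (- m.1, - m.2) q) / dt) / 2).
Hypothesis law : forall A : set (R * R), measurable A ->
  P (p @^-1` A) = (\int[leb2]_q (\1_A q * gauss2 q)%:E)%E.

Lemma gauss2_ge0 q : 0 <= gauss2 q.
Proof. by rewrite mulr_ge0 ?expR_ge0. Qed.

Lemma measurable_gauss2 : measurable_fun [set: R * R] gauss2.
Proof.
apply: measurable_funM => //; apply: (comp_measurable (f := @expR R)); first exact: measurable_expR.
apply: measurable_funM => //; apply: measurableT_comp => //; apply: measurable_funM => //.
apply: (comp_measurable (f := quad a b c)); [exact: measurable_quad|exact: measurable_translate].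
Qed.

Lemma law_integral (f : R * R -> \bar R) : measurable_fun [set: R * R] f ->
  (forall q, 0 <= f q)%E ->
  (\int[P]_w f (p w) = \int[leb2]_q (f q * (gauss2 q)%:E))%E.
Proof.
move=> mf f0; rewrite -[LHS](@ge0_integral_distribution _ _ _ _ _ _ p f) //.
exact: (@ge0_integral_density _ plane R leb2 (distribution P p) gauss2 measurable_gauss2 gauss2_ge0 law f mf f0). 
Qed.

(** The parallelogram law: the squares at z and z + u add up to twice the square
    at the midpoint plus half the square of u. *)
Lemma gauss2_convolution z u : gauss2 (translate z u) * gauss2 z =
  expR (- ((4 * dt)^-1 * quad a b c u)) *
  (C ^+ 2 * expR (- (quad a b c (translate (u.1 / 2 - m.1, u.2 / 2 - m.2) z) / dt))).
Proof.
rewrite /gauss2 /translate /quad /=; rewrite mulrACA -expRD [RHS]mulrCA -expRD expr2.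
by congr (_ * expR _); field; exact: lt0r_neq0.
Qed.

Definition displacement (z u : R * R) : R * R := translate (- z.1, - z.2) u.

(** Up to a constant factor, the difference of two independent copies of p has
    the density exp (- q / 4): integrating the parallelogram law over z leaves a
    factor that does not depend on u, by translation invariance. The constant is
    determined in the end by the total mass, which is one. *)
Lemma difference_law : exists2 N : \bar R, (0 <= N)%E & forall Q : set (R * R), measurable Q ->
  (\int[P]_w P [set w' | Q (displacement (p w) (p w'))] =
   N * \int[leb2]_u (\1_Q u * expR (- ((4 * dt)^-1 * quad a b c u)))%:E)%E.
Proof.
pose G (q : R * R) : \bar R := (C ^+ 2 * expR (- (quad a b c q / dt)))%:E.
have mG : measurable_fun [set: R * R] G.
  apply/measurable_EFinP; apply: measurable_funM => //.
  apply: (comp_measurable (f := @expR R)); first exact: measurable_expR.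
  by apply: measurableT_comp => //; apply: measurable_funM => //; exact: measurable_quad.
have G0 q : (0 <= G q)%E by rewrite lee_fin mulr_ge0 ?expR_ge0 ?sqr_ge0.
exists (\int[leb2]_q G q)%E; first exact: integral_ge0.
move=> Q mQ.
have mI : measurable_fun [set: R * R] (\1_Q : R * R -> R) by exact: measurable_indic.
pose Phi (z : R * R) := (\int[leb2]_u (\1_Q u * gauss2 (translate z u))%:E)%E.
have sec z : P [set w' | Q (displacement z (p w'))] = Phi z.
  pose A := displacement z @^-1` Q.
  have mA : measurable A by rewrite -[A]setTI; apply: measurable_translate.
  rewrite -[X in P X]/(p @^-1` A) law // -(integral2_shift z).
  - apply: eq_integral => u _; congr (_ * _)%:E; rewrite !indicE; congr (nat_of_bool _)%:R.
    have E : displacement z (translate z u) = u.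
      by rewrite /displacement /translate /= ![_ + _ - _]addrK; case: u.
    by apply/idP/idP; rewrite !inE /A /= E.
  - by apply/measurable_EFinP; apply: measurable_funM; [exact: measurable_indic|exact: measurable_gauss2].
  - by move=> q; rewrite lee_fin mulr_ge0 ?gauss2_ge0.
have mF : measurable_fun [set: (R * R) * (R * R)] (fun q : (R * R) * (R * R) =>
    (\1_Q q.2 * gauss2 (translate q.1 q.2))).
  apply: measurable_funM; first exact: comp_measurable mI measurable_snd.
  apply: (comp_measurable (f := gauss2)); first exact: measurable_gauss2.
  apply: measurable_fun_pair; apply: measurable_funD => //.
  - exact: (comp_measurable (f := @fst R R)).
  - exact: (comp_measurable (f := @fst R R)).
  - exact: (comp_measurable (f := @snd R R)).
  - exact: (comp_measurable (f := @snd R R)).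
under eq_integral => w _ do rewrite sec.
pose F (q : (R * R) * (R * R)) := (\1_Q q.2 * gauss2 (translate q.1 q.2))%:E.
have mFE : measurable_fun [set: (R * R) * (R * R)] F by exact/measurable_EFinP.
have F0 q : (0 <= F q)%E by rewrite lee_fin mulr_ge0 ?gauss2_ge0.
have mPhi : measurable_fun [set: R * R] Phi
  := @measurable_fun_fubini_tonelli_F _ _ plane plane R (@plane_measure R) F mFE F0.
rewrite law_integral //; last first.
  by move=> q; apply: integral_ge0 => u _; rewrite lee_fin mulr_ge0 ?gauss2_ge0.
pose H (q : (R * R) * (R * R)) := (\1_Q q.2 * gauss2 (translate q.1 q.2) * gauss2 q.1)%:E.
have mH : measurable_fun [set: (R * R) * (R * R)] H.
  apply/measurable_EFinP; apply: measurable_funM => //.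
  exact: comp_measurable measurable_gauss2 measurable_fst.
have H0 q : (0 <= H q)%E by rewrite lee_fin !mulr_ge0 ?gauss2_ge0.
transitivity (\int[leb2]_z \int[leb2]_u H (z, u))%E.
  apply: eq_integral => z _; rewrite muleC -ge0_integralZl_EFin ?gauss2_ge0 //.
  - by apply: eq_integral => u _; rewrite -EFinM mulrC.
  - by move=> u _; rewrite lee_fin mulr_ge0 ?gauss2_ge0.
  - apply/measurable_EFinP; exact: (comp_measurable (g := pair z) mF).
transitivity (\int[leb2]_u \int[leb2]_z H (z, u))%E.
  exact: (@fubini_tonelli _ _ plane plane R (@plane_measure R) (@plane_measure R) H mH H0).
rewrite muleC -ge0_integralZr //; first last.
- exact: integral_ge0.
- by apply/measurable_EFinP; apply: measurable_funM => //; exact: measurable_gauss_quad.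
apply: eq_integral => u _.
rewrite -(integral2_shift (u.1 / 2 - m.1, u.2 / 2 - m.2) mG G0) -ge0_integralZl_EFin.
- by apply: eq_integral => z _; rewrite -EFinM; congr EFin; rewrite -[LHS]mulrA gauss2_convolution -[RHS]mulrA.
- exact: measurableT.
- by [].
- exact: comp_measurable mG (measurable_translate _).
- by rewrite mulr_ge0 ?expR_ge0.
Qed.

End DifferenceLaw.

(** * Independent copies and signs *)

Section PairedVariables.
Context d d1 d2 (T : measurableType d) (T1 : measurableType d1) (T2 : measurableType d2).
Variables (U : {mfun T >-> T1}) (V : {mfun T >-> T2}).

Definition paired (w : T) : T1 * T2 := (U w, V w).

Lemma measurable_paired : measurable_fun [set: T] paired.
Proof. by apply: measurable_fun_pair. Qed.

HB.instance Definition _ := isMeasurableFun.Build _ _ T (T1 * T2)%type paired measurable_paired.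
End PairedVariables.

Section JointLaw.
Variables (R : realType) (disp : measure_display) (Omega : measurableType disp).
Variables (P : probability Omega R).
(** The joint law agrees with the product law on rectangles, hence everywhere. *)
Lemma independent_pair_law d (plane : measurableType d) (p q : {RV P >-> plane}) :
  (forall A B : set plane, measurable A -> measurable B ->
     P (p @^-1` A `&` q @^-1` B) = (P (p @^-1` A) * P (p @^-1` B))%E) ->
  forall E : set (plane * plane), measurable E ->
  P [set w | E (p w, q w)] = (\int[P]_w P [set w' | E (p w, p w')])%E.
Proof.
move=> indep E mE.
pose pq : {RV P >-> (plane * plane)%type} := paired p q.
transitivity ((distribution P p \x distribution P p)%E E).
  by rewrite (@product_measure_unique _ _ plane plane R (distribution P p) (distribution P p) (distribution P pq)).
rewrite /product_measure1 (@ge0_integral_distribution _ _ _ _ _ _ p (distribution P p \o xsection E)) //.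
  by apply: eq_integral => w _; congr (P _); apply/seteqP; split=> w' /=; rewrite /xsection /= inE.
exact: measurable_fun_xsection.
Qed.

Local Notation plane := (R * R)%type.
Variables (n : nat) (X X' : 'I_n -> {RV P >-> R}).
Hypothesis copy : independent_copy X X'.
Variables i j : 'I_n.

(** The pair of X with its copy and the pair of the copy with X both have the
    product law, so the two events have the same probability. *)
Lemma copy_pair_law (E : set (plane * plane)) : measurable E ->
  P [set w | E ((X i w, X j w), (X' i w, X' j w))] =
    (\int[P]_w P [set w' | E ((X i w, X j w), (X i w', X j w'))])%E /\
  P [set w | E ((X' i w, X' j w), (X i w, X j w))] =
    (\int[P]_w P [set w' | E ((X i w, X j w), (X i w', X j w'))])%E.
Proof.
move=> mE; case: copy => same ind.
pose p : {RV P >-> plane} := paired (X i) (X j).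
pose p' : {RV P >-> plane} := paired (X' i) (X' j).
pose tup (A : set plane) : set (n.-tuple R) := (fun t : n.-tuple R => (tnth t i, tnth t j)) @^-1` A.
have mtup A : measurable A -> measurable (tup A).
  move=> mA; have mf : measurable_fun [set: n.-tuple R] (fun t : n.-tuple R => (tnth t i, tnth t j)).
    by apply: measurable_fun_pair; exact: measurable_tnth.
  by rewrite -[tup A]setTI; exact: mf.
have pE A : p @^-1` A = random_tuple X @^-1` tup A.
  by apply/seteqP; split=> w; rewrite /tup /= !tnth_mktuple.
have p'E A : p' @^-1` A = random_tuple X' @^-1` tup A.
  by apply/seteqP; split=> w; rewrite /tup /= !tnth_mktuple.
have law' A : measurable A -> P (p' @^-1` A) = P (p @^-1` A).
  by move=> mA; rewrite pE p'E same //; exact: mtup.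
have indep A B : measurable A -> measurable B ->
    P (p @^-1` A `&` p' @^-1` B) = (P (p @^-1` A) * P (p @^-1` B))%E.
  by move=> mA mB; rewrite -(law' B) // pE p'E ind //; exact: mtup.
split; first exact: (independent_pair_law indep).
transitivity (\int[P]_w P [set w' | E (p' w, p' w')])%E.
  rewrite (independent_pair_law (p := p') (q := p)) // => A B mA mB.
  by rewrite setIC indep // !law' // muleC.
have mx : measurable_fun [set: plane] (fun z => P (p @^-1` xsection E z)).
  exact: (measurable_fun_xsection (distribution P p) mE).
transitivity (\int[P]_w P (p @^-1` xsection E (p' w)))%E.
  apply: eq_integral => w _; rewrite -law'; last exact: measurable_xsection.
  by congr (P _); apply/seteqP; split=> w' /=; rewrite /xsection /= inE.
transitivity (\int[P]_w P (p @^-1` xsection E (p w)))%E.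
  rewrite -(@ge0_integral_distribution _ _ _ _ _ _ p' (fun z => P (p @^-1` xsection E z))) //.
  rewrite -(@ge0_integral_distribution _ _ _ _ _ _ p (fun z => P (p @^-1` xsection E z))) //.
  by apply: eq_measure_integral => A mA _; exact: law'.
by apply: eq_integral => w _; congr (P _); apply/seteqP; split=> w' /=; rewrite /xsection /= inE.
Qed.

End JointLaw.

Section SignMoments.
Variables (R : realType) (disp : measure_display) (Omega : measurableType disp).
Variables (P : probability Omega R).

Lemma expectation_sg (h : Omega -> R) : measurable_fun [set: Omega] h ->
  ('E_P[fun w => Num.sg (h w)] = P [set w | 0 < h w]%R - P [set w | h w < 0]%R)%E.
Proof.
move=> mh.
have mp : measurable [set w | 0 < h w].
  rewrite (_ : [set w | _] = h @^-1` `]0, +oo[); first by rewrite -[X in measurable X]setTI; exact: mh.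
  by apply/seteqP; split=> w; rewrite /= in_itv /= andbT.
have mn : measurable [set w | h w < 0].
  rewrite (_ : [set w | _] = h @^-1` `]-oo, 0[); first by rewrite -[X in measurable X]setTI; exact: mh.
  by apply/seteqP; split=> w; rewrite /= in_itv /=.
rewrite unlock (eq_integral (fun w => (\1_[set w | 0 < h w] w)%:E - (\1_[set w | h w < 0] w)%:E)%E).
  by rewrite integralB_EFin //; [rewrite !integral_indic // !setIT|exact: integrable_indic..].
move=> w _; rewrite -EFinB; congr EFin; rewrite !indicE.
have -> : (w \in [set w | 0 < h w]) = (0 < h w) by apply/idP/idP; rewrite inE.
have -> : (w \in [set w | h w < 0]) = (h w < 0) by apply/idP/idP; rewrite inE.
by case: ltgtP => [h0|h0|<-]; rewrite ?(ltr0_sg h0) ?(gtr0_sg h0) ?sgr0 ?subr0 ?sub0r.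
Qed.

(** Symmetry centres the signs, and the absence of ties gives them variance one. *)
Lemma corr_sg (f g : Omega -> R) : measurable_fun [set: Omega] f -> measurable_fun [set: Omega] g ->
  P [set w | 0 < f w] = P [set w | f w < 0] -> P [set w | 0 < g w] = P [set w | g w < 0] ->
  P [set w | f w = 0] = 0%E -> P [set w | g w = 0] = 0%E ->
  corr P (fun w => Num.sg (f w)) (fun w => Num.sg (g w)) =
  fine (P [set w | 0 < f w * g w]%R - P [set w | f w * g w < 0]%R)%E.
Proof.
have mpos (h : Omega -> R) : measurable_fun [set: Omega] h -> measurable [set w | 0 < h w].
  move=> mh; rewrite (_ : [set w | _] = h @^-1` `]0, +oo[); first by rewrite -[X in measurable X]setTI; exact: mh.
  by apply/seteqP; split=> w; rewrite /= in_itv /= andbT.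
have cen (h : Omega -> R) : measurable_fun [set: Omega] h ->
    P [set w | 0 < h w] = P [set w | h w < 0] -> fine 'E_P[fun w => Num.sg (h w)] = 0.
  move=> mh e; rewrite expectation_sg // -e subee //.
  by apply: fin_num_measure; exact: mpos.
have cov (h k : Omega -> R) : measurable_fun [set: Omega] h -> measurable_fun [set: Omega] k ->
    P [set w | 0 < h w] = P [set w | h w < 0] -> P [set w | 0 < k w] = P [set w | k w < 0] ->
    covariance P (fun w => Num.sg (h w)) (fun w => Num.sg (k w)) =
    (P [set w | 0 < h w * k w]%R - P [set w | h w * k w < 0]%R)%E.
  move=> mh mk eh ek; rewrite -expectation_sg; last exact: measurable_funM.
  rewrite covariance.unlock !cen //; congr expectation; apply/funext => w.
  by rewrite /= !fctE /= !subr0 sgrM.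
have var (h : Omega -> R) : measurable_fun [set: Omega] h -> P [set w | 0 < h w] = P [set w | h w < 0] ->
    P [set w | h w = 0] = 0%E -> 'V_P[fun w => Num.sg (h w)] = 1%E.
  move=> mh eh h0; rewrite /variance cov //.
  rewrite [X in (_ - P X)%E](_ : _ = set0) ?measure0 ?sube0; last first.
    by apply/seteqP; split=> w //=; rewrite -expr2 ltNge sqr_ge0.
  have mhz : measurable [set w | h w = 0].
    rewrite (_ : [set w | _] = h @^-1` [set 0]) //.
    by rewrite -[X in measurable X]setTI; exact: mh.
  rewrite (_ : [set w | _] = ~` [set w | h w = 0]); last first.
    apply/seteqP; split=> w /=; rewrite -expr2 exprn_even_gt0 //= => /eqP; by [].
  by rewrite probability_setC // h0 sube0.
by move=> mf mg ef eg f0 g0; rewrite /corr cov // !var //= sqrtr1 mulr1 divr1.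
Qed.

End SignMoments.

(** * Kendall coefficients *)

Lemma sg_increasing (R : realType) (f : R -> R) x y : {homo f : x y / x < y} ->
  Num.sg (f x - f y) = Num.sg (x - y).
Proof.
move=> hf; case: (ltgtP x y) => [xy|yx|->]; last by rewrite !subrr.
  by rewrite !ltr0_sg ?subr_lt0 ?hf.
by rewrite !gtr0_sg ?subr_gt0 ?hf.
Qed.

(** The three events only depend on the signs of the coordinates, which
    increasing transformations preserve. *)
Lemma sign_sets (R : realType) (x y x' y' : R) : Num.sg x = Num.sg x' -> Num.sg y = Num.sg y' ->
  [/\ same_sign (x, y) = same_sign (x', y'), opposite_sign (x, y) = opposite_sign (x', y')
    & axes (x, y) = axes (x', y')].
Proof.
move=> ex ey; have E : Num.sg (x * y) = Num.sg (x' * y') by rewrite !sgrM ex ey.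
rewrite /same_sign /opposite_sign /axes /=; split.
- by rewrite -sgr_gt0 E sgr_gt0.
- by rewrite -sgr_lt0 E sgr_lt0.
- by apply/propext; rewrite !(rwP eqP) -[x * y == 0]sgr_eq0 E sgr_eq0.
Qed.

Lemma sin_atan_ratio (R : realType) (b D : R) : 0 < D ->
  sin (atan (b / Num.sqrt D)) = b / Num.sqrt (D + b ^+ 2).
Proof.
move=> D0; set t := b / _; have s0 : 0 < Num.sqrt D by rewrite sqrtr_gt0.
have c0 : cos (atan t) != 0 by rewrite cos_atan invr_neq0 // gt_eqF // sqrtr_gt0 ltr_wpDr ?sqr_ge0.
have -> : sin (atan t) = tan (atan t) * cos (atan t) by rewrite /tan divfK.
rewrite atanK cos_atan /t -mulrA; congr (_ * _).
rewrite -invfM -sqrtrM ?ltW //; congr (Num.sqrt _)^-1.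
by rewrite exprMn exprVn sqr_sqrtr ?ltW //; field; exact: lt0r_neq0.
Qed.

Section Kendall.
Variables (R : realType) (disp : measure_display) (Omega : measurableType disp).
Variables (P : probability Omega R) (V : finType) (Z : V -> {RV P >-> R}).
Variables (mu : 'rV[R]_#|V|) (Sigma : 'M[R]_#|V|).
Hypothesis pd : positive_definite Sigma.
Hypothesis gauss : has_density Z (gaussian_pdf mu Sigma).
Local Notation plane := (measurableTypeR R * measurableTypeR R)%type.
Local Notation leb := (@lebesgue_measure R).
Variables (n : nat) (X X' : 'I_n -> {RV P >-> R}) (i j : 'I_n) (u v : V).
Hypothesis copy : independent_copy X X'.
Hypothesis uv : u != v.
Variables (f g : R -> R).
Hypotheses (f_incr : {homo f : x y / x < y}) (g_incr : {homo g : x y / x < y}).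
Hypotheses (XiE : forall w, X i w = f (Z u w)) (XjE : forall w, X j w = g (Z v w)).

Let a := Sigma (enum_rank v) (enum_rank v).
Let b := Sigma (enum_rank u) (enum_rank v).
Let c := Sigma (enum_rank u) (enum_rank u).
Let dt := a * c - b ^+ 2.

Let pair_Z (w : Omega) : plane := (Z u w, Z v w).
Let measurable_pair_Z : measurable_fun [set: Omega] pair_Z.
Proof. exact: (measurable_paired (Z u) (Z v)). Qed.
Let p : {RV P >-> plane} :=
  HB.pack pair_Z (isMeasurableFun.Build _ _ _ _ pair_Z measurable_pair_Z).
Let h w := (X i w - X' i w) * (X j w - X' j w).

Let c0 : 0 < c. Proof. exact: pd_diag. Qed.
Let dt0 : 0 < dt.
Proof. by rewrite /dt mulrC; apply: (pd_minor pd); rewrite (inj_eq enum_rank_inj). Qed.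

Lemma pair_gauss2 : exists2 C : R, 0 <= C & forall A : set (R * R), measurable A ->
  P (p @^-1` A) = (\int[(leb \x leb)]_q (\1_A q *
     gauss2 a b c dt C (mu 0 (enum_rank u), mu 0 (enum_rank v)) q)%:E)%E.
Proof.
have [C C0 law] := pair_law pd gauss uv; exists C => // A mA.
rewrite [LHS]law //; apply: eq_integral => q _; congr (_ * (_ * expR (- _ / 2)))%:E.
rewrite /pair_form /quad /translate /= -/a -/b -/c.
have -> : c * a - b ^+ 2 = dt by rewrite mulrC.
by field; exact: lt0r_neq0.
Qed.

Lemma sign_difference_law : exists2 N : \bar R, (0 <= N)%E &
  forall Q : set (R * R), measurable Q ->
  (forall x y x' y', Num.sg x = Num.sg x' -> Num.sg y = Num.sg y' -> Q (x, y) = Q (x', y')) ->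
  P [set w | Q (X i w - X' i w, X j w - X' j w)] =
    (N * \int[(leb \x leb)]_q (\1_Q q * expR (- ((4 * dt)^-1 * quad a b c q)))%:E)%E.
Proof.
have [C C0 law] := pair_gauss2.
have [N N0 diff] := difference_law dt0 C0 law.
exists N => // Q mQ sgQ; rewrite -diff //.
pose E : set ((R * R) * (R * R)) := [set z | Q (displacement z.1 z.2)].
have mE : measurable E.
  have md : measurable_fun [set: (R * R) * (R * R)] (fun z => displacement z.1 z.2).
    apply: measurable_fun_pair; apply: measurable_funB => //;
      by [exact: (comp_measurable (f := @fst R R)) | exact: (comp_measurable (f := @snd R R))].
  by rewrite -[E]setTI; exact: md.
have [_ ->] := copy_pair_law copy i j mE.
apply: eq_integral => w _; congr (P _); apply/funext => w'; rewrite /E /displacement /translate /=.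
by apply: sgQ; rewrite ?XiE ?XjE sg_increasing.
Qed.

(** The three events exhaust the possibilities, and their probabilities are
    proportional to the cone integrals pi / 2 + theta, pi / 2 - theta and 0;
    their sum is one. *)
Lemma concordance :
  [/\ P [set w | 0 < h w] = ((pi / 2 + atan (b / Num.sqrt dt)) / pi)%:E,
      P [set w | h w < 0] = ((pi / 2 - atan (b / Num.sqrt dt)) / pi)%:E
    & P [set w | h w = 0] = 0%E].
Proof.
have [N N0 law] := sign_difference_law.
have k0 : 0 < (4 * dt)^-1 by rewrite invr_gt0 mulr_gt0.
have mh : measurable_fun [set: Omega] h by apply: measurable_funM; apply: measurable_funB.
have sP := law _ (@measurable_same_sign R) (fun x y x' y' ex ey => let: And3 e _ _ := sign_sets ex ey in e).
have oP := law _ (@measurable_opposite_sign R) (fun x y x' y' ex ey => let: And3 _ e _ := sign_sets ex ey in e).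
have xP := law _ (@measurable_axes R) (fun x y x' y' ex ey => let: And3 _ _ e := sign_sets ex ey in e).
rewrite (integral_same_sign c0 dt0 erefl k0) in sP.
rewrite (integral_opposite_sign c0 dt0 erefl k0) in oP.
rewrite (integral_axes c0 dt0 erefl k0) mule0 in xP.
rewrite -[LHS]/(P [set w | 0 < h w]) in sP; rewrite -[LHS]/(P [set w | h w < 0]) in oP.
rewrite -[LHS]/(P [set w | h w = 0]) in xP.
set th := atan (b / Num.sqrt dt) in sP oP *.
have th1 : 0 < pi / 2 + th by rewrite -ltrBlDl sub0r atan_gtNpi2.
set k := (4 * dt)^-1 in sP oP xP k0.
pose K := k^-1 / Num.sqrt dt.
have K0 : 0 < K by apply: divr_gt0; [rewrite invr_gt0; exact: k0|rewrite sqrtr_gt0].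
have sE : P [set w | 0 < h w] = (N * (K * (pi / 2 + th))%:E)%E.
  by rewrite sP /K; congr (_ * _%:E)%E; ring.
have oE : P [set w | h w < 0] = (N * (K * (pi / 2 - th))%:E)%E.
  by rewrite oP /K; congr (_ * _%:E)%E; ring.
have mle (I : interval R) : measurable (h @^-1` [set` I]).
  by rewrite -[X in measurable X]setTI; exact: mh.
have mp : measurable [set w | 0 < h w].
  rewrite (_ : [set w | _] = h @^-1` `]0, +oo[); first exact: mle.
  by apply/seteqP; split=> w; rewrite /= in_itv /= andbT.
have mn : measurable [set w | h w < 0].
  rewrite (_ : [set w | _] = h @^-1` `]-oo, 0[); first exact: mle.
  by apply/seteqP; split=> w; rewrite /= in_itv.
have mz : measurable [set w | h w = 0].
  by rewrite (_ : [set w | _] = h @^-1` [set 0]) // -[X in measurable X]setTI; exact: mh.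
have tot : (P [set w | 0 < h w]%R + P [set w | h w < 0]%R)%E = 1%E.
  rewrite -[LHS]adde0 -xP -[RHS](probability_setT P).
  have <- : ([set w | 0 < h w] `|` [set w | h w < 0]) `|` [set w | h w = 0] = setT.
    apply/seteqP; split=> // w _ /=.
    by case: (ltgtP (h w) 0) => ?; [left; right|left; left|right].
  have dis1 : [set w | 0 < h w] `&` [set w | h w < 0] = set0.
    by apply/seteqP; split=> w //= [] /lt_trans/[apply]; rewrite ltxx.
  have dis2 : ([set w | 0 < h w] `|` [set w | h w < 0]) `&` [set w | h w = 0] = set0.
    by apply/seteqP; split=> w //= [] [] + E; rewrite E ltxx.
  by rewrite !measureU //; exact: measurableU.
have [r rE] : exists r : R, N = r%:E.
  move: tot N0; rewrite sE; case: (N) => [r|//|//] tot _; first by exists r.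
  have KA : (0 < (K * (pi / 2 + th))%:E)%E by rewrite lte_fin; exact: mulr_gt0.
  by move: tot; rewrite gt0_mulye // addye // -ltNye (lt_le_trans _ (measure_ge0 _ _)).
rewrite rE -!EFinM in sE oE; rewrite sE oE -EFinD in tot.
have {}tot : r * K * pi = 1.
  by case: tot => <-; rewrite [in LHS](splitr pi); ring.
have rK : r * K = pi^-1 by rewrite -[LHS](mulfK (lt0r_neq0 (pi_gt0 R))) tot mul1r.
by rewrite sE oE xP; split=> //; congr EFin; rewrite mulrA rK mulrC.
Qed.

(** X and its copy can be exchanged. *)
Lemma copy_difference_symmetric k : k \in [:: i; j] ->
  P [set w | 0 < X k w - X' k w] = P [set w | X k w - X' k w < 0].
Proof.
pose c1 (z : (R * R) * (R * R)) := if k == i then z.1.1 - z.2.1 else z.1.2 - z.2.2.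
move=> kij; have mE : measurable [set z : (R * R) * (R * R) | 0 < c1 z].
  have mc : measurable_fun [set: (R * R) * (R * R)] c1.
    by rewrite /c1; case: (k == i); apply: measurable_funB;
      [exact: (comp_measurable (f := @fst R R))|exact: (comp_measurable (f := @fst R R))
      |exact: (comp_measurable (f := @snd R R))|exact: (comp_measurable (f := @snd R R))].
  rewrite (_ : [set z | 0 < c1 z] = c1 @^-1` `]0, +oo[); first by rewrite -[X in measurable X]setTI; exact: mc.
  by apply/seteqP; split=> w; rewrite /= in_itv /= andbT.
have [e1 e2] := copy_pair_law copy i j mE.
have {e1 e2} : P [set w | 0 < c1 ((X i w, X j w), (X' i w, X' j w))] =
    P [set w | 0 < c1 ((X' i w, X' j w), (X i w, X j w))] := etrans e1 (esym e2).
rewrite /c1 /=; have [->|ki] := eqVneq k i.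
  by move=> ->; congr (P _); apply/funext => w /=; rewrite subr_gt0 subr_lt0.
move: kij; rewrite !inE (negbTE ki) => /eqP ->.
by move=> ->; congr (P _); apply/funext => w /=; rewrite subr_gt0 subr_lt0.
Qed.

(** The coefficient is the difference of the two probabilities of concordance,
    that is 2 / pi * atan (b / sqrt dt), and the sine of that arctangent is b /
    sqrt (dt + b^2). *)
Lemma sin_kendall_tau : sin (pi / 2 * kendall_tau X X' i j) = gcorr Sigma u v.
Proof.
have [sP oP xP] := concordance.
have mh : measurable_fun [set: Omega] h by apply: measurable_funM; apply: measurable_funB.
have mhz : measurable [set w | h w = 0].
  by rewrite (_ : [set w | _] = h @^-1` [set 0]) // -[X in measurable X]setTI; exact: mh.
have tie k : k \in [:: i; j] -> P [set w | X k w - X' k w = 0] = 0%E.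
  move=> kij; apply/eqP; rewrite -measure_le0 -xP; apply: le_measure; rewrite ?inE //.
    rewrite (_ : [set w | _] = (fun w => X k w - X' k w) @^-1` [set 0]) //.
    rewrite -[X in measurable X]setTI.
    have mk : measurable_fun [set: Omega] (fun w => X k w - X' k w) by exact: measurable_funB.
    exact: mk.
  move=> w /= E; move: kij; rewrite !inE /h => /orP[] /eqP Ek; rewrite Ek in E; by rewrite E ?mul0r ?mulr0.
have ii : i \in [:: i; j] by rewrite inE eqxx.
have jj : j \in [:: i; j] by rewrite !inE eqxx orbT.
have -> : kendall_tau X X' i j = 2 / pi * atan (b / Num.sqrt dt).
  rewrite /kendall_tau corr_sg ?tie ?copy_difference_symmetric //; try exact: measurable_funB.
  by rewrite sP oP /=; move: (@pi R) (lt0r_neq0 (pi_gt0 R)) => q q0; field; exact: q0.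
have -> : pi / 2 * (2 / pi * atan (b / Num.sqrt dt)) = atan (b / Num.sqrt dt).
  by move: (@pi R) (lt0r_neq0 (pi_gt0 R)) => q q0; field; exact: q0.
rewrite sin_atan_ratio // /gcorr -/a -/b -/c; congr (_ / Num.sqrt _); rewrite /dt; ring.
Qed.

End Kendall.

(** * Edges are correlated *)

Section Reflection.
Variable R : realType.
Local Notation leb := (@lebesgue_measure R).
Local Notation leb2 := (leb \x leb)%E.

Definition reflect1 (m : R) (q : R * R) : R * R := (-1 * q.1 + 2 * m, q.2).

Lemma measurable_reflect1 m : measurable_fun [set: R * R] (reflect1 m).
Proof.
apply: measurable_fun_pair; last exact: measurable_snd.
by apply: measurable_funD => //; apply: measurable_funM => //; exact: measurable_fst.
Qed.

Lemma integral2_reflect1 (m : R) (f : R * R -> \bar R) :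
  measurable_fun [set: R * R] f -> (forall q, 0 <= f q)%E ->
  (\int[leb2]_q f (reflect1 m q) = \int[leb2]_q f q)%E.
Proof.
move=> mf f0.
have mg : measurable_fun [set: R * R] (fun q : R * R => f (reflect1 m q)).
  exact: comp_measurable (measurable_reflect1 m).
rewrite (@fubini_tonelli1 _ _ (measurableTypeR R) (measurableTypeR R) R leb leb _ mg (fun q => f0 _)).
rewrite (@fubini_tonelli1 _ _ (measurableTypeR R) (measurableTypeR R) R leb leb f mf f0).
pose F x := (\int[leb]_y f (x, y))%E.
have mF : measurable_fun [set: R] F
  := @measurable_fun_fubini_tonelli_F _ _ (measurableTypeR R) (measurableTypeR R) R leb f mf f0.
have F0 x : (0 <= F x)%E by apply: integral_ge0.
have m1 : (-1 : R) != 0 by rewrite oppr_eq0 oner_eq0.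
have mS : measurable_fun [set: R] (fun x => F (x + 2 * m)).
  exact: (comp_measurable mF (measurable_addr (2 * m))).
transitivity (\int[leb]_x F (-1 * x + 2 * m)%R)%E; first by apply: eq_integral.
transitivity (\int[leb]_x F (x + 2 * m)%R)%E; last exact: (ge0_integral_shift (2 * m) mF F0).
by rewrite -[RHS](ge0_integral_scale m1 mS) // normrN1 mul1e.
Qed.

Lemma quad_reflect1 (a c m1 m2 : R) q :
  quad a 0 c (translate (- m1, - m2) (reflect1 m1 q)) = quad a 0 c (translate (- m1, - m2) q).
Proof. by rewrite /quad /translate /reflect1 /=; ring. Qed.

End Reflection.

Section Uncorrelated.
Variables (R : realType) (disp : measure_display) (Omega : measurableType disp).
Variables (P : probability Omega R) (V : finType) (Z : V -> {RV P >-> R}).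
Variables (mu : 'rV[R]_#|V|) (Sigma : 'M[R]_#|V|).
Hypothesis pd : positive_definite Sigma.
Hypothesis gauss : has_density Z (gaussian_pdf mu Sigma).
Variables (u v : V).
Hypothesis uv : u != v.
Hypothesis uncorrelated : Sigma (enum_rank u) (enum_rank v) = 0.
Local Notation plane := (measurableTypeR R * measurableTypeR R)%type.
Let m := mu 0 (enum_rank u).

(** The law of the pair is invariant under the reflection of the first
    coordinate, so the positive and negative parts have the same integral x; x -
    x is zero or infinite, and fine sends both to zero. *)
Lemma odd_moment (phi : R * R -> R) : measurable_fun [set: R * R] phi ->
  (forall q, phi (reflect1 m q) = - phi q) ->
  fine (\int[P]_w (phi (Z u w, Z v w))%:E)%E = 0.
Proof.
move=> mphi odd.
have mpZ : measurable_fun [set: Omega] (fun w => (Z u w, Z v w)) := measurable_paired (Z u) (Z v).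
pose p : {RV P >-> plane} :=
  HB.pack (fun w => (Z u w, Z v w) : plane) (isMeasurableFun.Build _ _ _ _ (fun w => (Z u w, Z v w) : plane) mpZ).
have [C C0 law] := pair_gauss2 pd gauss uv.
pose g := gauss2 (Sigma (enum_rank v) (enum_rank v)) (Sigma (enum_rank u) (enum_rank v))
  (Sigma (enum_rank u) (enum_rank u)) (Sigma (enum_rank v) (enum_rank v) * Sigma (enum_rank u) (enum_rank u) -
    Sigma (enum_rank u) (enum_rank v) ^+ 2) C (m, mu 0 (enum_rank v)).
have mg : measurable_fun [set: R * R] (fun q => (g q)%:E) by apply/measurable_EFinP; exact: measurable_gauss2.
have g0 q : (0 <= (g q)%:E)%E by rewrite lee_fin gauss2_ge0.
have gE q : g (reflect1 m q) = g q.
  by rewrite /g /gauss2 uncorrelated quad_reflect1.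
have sym (f : R * R -> \bar R) : measurable_fun [set: R * R] f -> (forall q, 0 <= f q)%E ->
    (\int[P]_w f (reflect1 m (Z u w, Z v w)) = \int[P]_w f (Z u w, Z v w))%E.
  move=> mf f0.
  have mfr : measurable_fun [set: R * R] (fun q => f (reflect1 m q)).
    exact: comp_measurable (measurable_reflect1 m).
  have E1 := law_integral (p := p) C0 law mf f0.
  have E2 := law_integral (p := p) C0 law mfr (fun q => f0 _).
  transitivity (\int[P]_w f (reflect1 m (p w)))%E; first by [].
  transitivity (\int[P]_w f (p w))%E; last by [].
  rewrite E1 E2 -(integral2_reflect1 m (f := fun q => (f q * (g q)%:E)%E)).
  - by apply: eq_integral => q _; rewrite gE.
  - exact: emeasurable_funM.
  - by move=> q; rewrite mule_ge0.
have mphiE : measurable_fun [set: R * R] (fun q => (phi q)%:E) by exact/measurable_EFinP.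
have pm : (\int[P]_w ((fun w => (phi (Z u w, Z v w))%:E) ^\- w) =
           \int[P]_w ((fun w => (phi (Z u w, Z v w))%:E) ^\+ w))%E.
  have E := sym ((fun q => (phi q)%:E)^\+)%E (measurable_funepos mphiE) (fun q => funepos_ge0 _ q).
  transitivity (\int[P]_w ((fun q => (phi q)%:E)^\+ (reflect1 m (Z u w, Z v w))))%E; last first.
    by rewrite E; apply: eq_integral => w _; rewrite !funeposE.
  by apply: eq_integral => w _; rewrite funeposE funenegE odd EFinN.
rewrite integralE pm; set x := integral _ _ _.
have [xf|] := boolP (x \is a fin_num); first by rewrite subee.
have : (0 <= x)%E by apply: integral_ge0 => w _; exact: funepos_ge0.
by case: x.
Qed.

(** A finite variance makes Z u integrable; then its mean is the centre of
    symmetry. *)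
Lemma reflected_mean : fine 'V_P[Z u] != 0 -> fine 'E_P[Z u] = m.
Proof.
set k := fine 'E_P[Z u] => V0.
have Vfin : ('V_P[Z u] < +oo)%E.
  by rewrite ltey; apply: contraNneq V0 => ->.
have sq : ('V_P[Z u] = \int[P]_w ((Z u w - k) ^+ 2)%:E)%E.
  rewrite /variance covariance.unlock -/k expectation.unlock.
  by apply: eq_integral => w _; rewrite /= !fctE /= expr2.
have iZ : P.-integrable [set: Omega] (fun w => (Z u w)%:E).
  have mk : measurable_fun [set: Omega] (fun w => ((Z u w - k) ^+ 2)%:E).
    by apply/measurable_EFinP; apply: measurable_funX; apply: measurable_funB.
  have i2 : P.-integrable [set: Omega] (fun w => ((Z u w - k) ^+ 2)%:E).
    apply/integrableP; split=> //; rewrite sq in Vfin; apply: le_lt_trans Vfin.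
    by under eq_integral => w _ do rewrite gee0_abs ?lee_fin ?sqr_ge0 //.
  have i1 : P.-integrable [set: Omega] (fun w => (`|k| + 1)%:E).
    exact: finite_measure_integrable_cst.
  apply: (le_integrable _ _ _ (integrableD measurableT i1 i2)) => //.
    by apply/measurable_EFinP.
  move=> w _ /=; rewrite lee_fin.
  have t0 : 0 <= `|k| + 1 + (Z u w - k) ^+ 2 by rewrite addr_ge0 ?addr_ge0 ?sqr_ge0.
  rewrite (ger0_norm t0); set t := Z u w - k.
  have tri : `|Z u w| <= `|k| + `|t| by have := ler_normD k t; rewrite /t addrC subrK.
  have sq0 : 0 <= (`|t| - 1) ^+ 2 by exact: sqr_ge0.
  have sqt : `|t| ^+ 2 = t ^+ 2 by rewrite real_normK ?num_real.
  have t1 := normr_ge0 t; apply: le_trans tri _; rewrite -addrA lerD2l -sqt.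
  by move: sq0 t1; move: `|t| => s; nra.
have := odd_moment (phi := fun q : R * R => q.1 - m) _ _.
rewrite /= (eq_integral (fun w => ((Z u w)%:E - (m%:E))%E)); last by move=> w _; rewrite EFinB.
rewrite integralB_EFin //; last exact: finite_measure_integrable_cst.
have Efin : (\int[P]_w (Z u w)%:E)%E \is a fin_num by exact: integrable_fin_num.
rewrite integral_cst // [X in (m%:E * X)%E]probability_setT mule1 fineB //= => E.
rewrite /k expectation.unlock; apply/eqP; rewrite -subr_eq0; apply/eqP; apply: E.
- by apply: measurable_funB => //; exact: measurable_fst.
- by move=> q; rewrite /reflect1 /=; ring.
Qed.

(** The centred product is odd under the reflection. If the variance is not a
    positive real number, the quotient defining corr is zero anyway. *)
Lemma uncorrelated_corr0 : corr P (Z u) (Z v) = 0.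
Proof.
have [V0|V0] := eqVneq (fine 'V_P[Z u]) 0.
  by rewrite /corr V0 sqrtr0 mul0r invr0 mulr0.
pose phi (q : R * R) := (q.1 - m) * (q.2 - fine 'E_P[Z v]).
have phi0 : fine (\int[P]_w (phi (Z u w, Z v w))%:E)%E = 0.
  apply: odd_moment; last by move=> q; rewrite /phi /reflect1 /=; ring.
  by apply: measurable_funM; apply: measurable_funB.
have Ei (W : Omega -> R) : ('E_P[W] = \int[P]_w (W w)%:E)%E by rewrite expectation.unlock.
rewrite /corr covariance.unlock reflected_mean // Ei.
by rewrite [X in X / _]phi0 mul0r.
Qed.

End Uncorrelated.

(** * Recovery of the tree *)

Theorem proposition5p5 (R : realType)
  (n : nat) (V : finType) (e : rel V) (lab : 'I_n -> V)
  (lab_inj : injective lab)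
  (treeT : semi_labeled e [set lab i | i : 'I_n]%SET)
  (disp : measure_display) (Omega : measurableType disp)
  (P : probability Omega R)
  (Z : V -> {RV P >-> R})
  (Z_gauss : gaussian_vector Z)
  (Z_model : graphical_model e Z)
  (Z_corr : forall u v, e u v -> 0 < `|corr P (Z u) (Z v)| < 1)
  (f : V -> R -> R)
  (f_incr : forall v, {homo f v : x y / x < y})
  (Y : V -> {RV P >-> R})
  (Y_def : forall v w, Y v w = f v (Z v w))
  (X X' : 'I_n -> {RV P >-> R})
  (X_def : forall i, X i = Y (lab i))
  (X'_copy : independent_copy X X')
  (d : 'I_n -> 'I_n -> R)
  (d_def : forall i j, i != j ->
     d i j = - ln `|sin (pi / 2 * kendall_tau X X' i j)|)
  (sel_arg sel_exp : seq (node n) -> node n)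
  (sel_argP : selector sel_arg) (sel_expP : selector sel_exp)
  (solve : nat -> bag R n -> nat * seq (edge n))
  (solveP : exact_solver d solve)
  (u : 'I_n) :
  (fun fuel : nat =>
     prob_returns (TREE d sel_arg sel_exp solve (max_degree e) u fuel)
                  (recovers e lab)) @ \oo --> (1 : R).
Proof.
have [mu [Sigma [pd gauss]]] := Z_gauss.
have [psi [_ model]] := Z_model.
have [T _] := treeT; have [_ es ei _ _] := T.
have prec0 a b : a != b -> ~~ e a b -> invmx Sigma (enum_rank a) (enum_rank b) = 0.
  by move=> ab eab; apply: (precision_zero pd gauss model ab eab); rewrite es.
have edge_nz a b : e a b -> Sigma (enum_rank a) (enum_rank b) != 0.
  move=> eab; have ab : a != b by apply: contraTneq eab => ->; rewrite ei.
  apply/eqP => S0; have := Z_corr _ _ eab.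
  by rewrite (uncorrelated_corr0 pd gauss ab S0) normr0 ltxx.
have [D [tm DE]] := gcorr_tree_metric pd T prec0 edge_nz.
apply: (TREE_converges lab_inj tm treeT) => // i j ij.
have lij : lab i != lab j by rewrite (inj_eq lab_inj).
rewrite d_def // DE //; congr (- ln `|_|).
apply: (sin_kendall_tau pd gauss X'_copy lij (f_incr (lab i)) (f_incr (lab j))) => w;
  by rewrite X_def Y_def.
Qed.
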